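(* Let the functions $f$ and $g^r$, $r=1,\ldots,m$, be admissible (as defined in the context) with constants $L\in(0,\infty)$, $q\in(1,\infty)$ and some $\eta\in(\frac12,\infty)$. Let $\overline{h}\in(0,L^{-1})$ with $\overline{h}\le T$. If the exact solution $X$ to the SODE $\mathrm{d}X(t)=f(t,X(t))\,\mathrm{d}t+\sum_{r=1}^m g^r(t,X(t))\,\mathrm{d}W^r(t)$, $X(0)=X_0$, satisfies $\sup_{\tau\in[0,T]}\|X(\tau)\|_{L^{4q-2}(\Omega;\mathbb{R}^d)}<\infty$, then the split-step backward Euler method $(\Psi^{\mathrm{SSBE}},\overline{h},X_0)$ is stochastically B-consistent of order $\gamma=\frac12$.
   Context: Let $d,m\in\mathbb{N}$, $T\in(0,\infty)$, and let $(\Omega,\mathcal{F},(\mathcal{F}_t)_{t\in[0,T]},\mathbf{P})$ be a filtered probability space satisfying the usual conditions, with independent real-valued standard $(\mathcal{F}_t)$-Brownian motions $W^1,\ldots,W^m$. $|\cdot|$ and $\langle\cdot,\cdot\rangle$ are the Euclidean norm and inner product; $\|Y\|_{L^p(\Omega;\mathbb{R}^d)}=(\mathbb{E}|Y|^p)^{1/p}$. Admissible: $f,g^r\colon[0,T]\times\mathbb{R}^d\to\mathbb{R}^d$, $r=1,\ldots,m$, are admissible with constants $L>0$, $\eta\in(\frac12,\infty)$, $q\in(1,\infty)$ if they are continuous and for all $t,t_1,t_2\in[0,T]$, $x,x_1,x_2\in\mathbb{R}^d$ and $r=1,\ldots,m$: $\langle f(t,x_1)-f(t,x_2),x_1-x_2\rangle+\eta\sum_{r=1}^m|g^r(t,x_1)-g^r(t,x_2)|^2\le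 L|x_1-x_2|^2$; $|f(t,x)|\vee|g^r(t,x)|\le L(1+|x|^q)$; $|f(t_1,x)-f(t_2,x)|\vee|g^r(t_1,x)-g^r(t_2,x)|\le L(1+|x|^q)|t_1-t_2|^{1/2}$; $|f(t,x_1)-f(t,x_2)|\vee|g^r(t,x_1)-g^r(t,x_2)|\le L(1+|x_1|^{q-1}+|x_2|^{q-1})|x_1-x_2|$. The initial value $X_0$ is in $L^p(\Omega,\mathcal{F}_0,\mathbf{P};\mathbb{R}^d)$ for a sufficiently large $p\in[2,\infty)$. The exact solution $X$ is the unique almost surely continuous, $(\mathcal{F}_t)$-adapted process satisfying the integral form of the SODE $\mathbf{P}$-a.s. for all $t\in[0,T]$. Let $\mathbb{T}:=\{(t,\delta)\in[0,T)\times(0,\overline{h}]:t+\delta\le T\}$. SSBE one-step map: for $\delta\in(0,\overline{h}]$ with $\overline{h}<L^{-1}$ put $F_\delta(t,x)=x-\delta f(t,x)$; then $F_\delta(t,\cdot)\colon\mathbb{R}^d\to\mathbb{R}^d$ is a homeomorphism with inverse $F_\delta^{-1}(t,\cdot)$. For $x\in\mathbb{R}^d$, $(t,\delta)\in\mathbb{T}$ define $\Psi^{\mathrm{SSBE}}(x,t,\delta)=F_\delta^{-1}(t+\delta,x)+\sum_{r=1}^m g^r(t+\delta,F_\delta^{-1}(t+\delta,x))(W^r(t+\delta)-W^r(t))$. A stochastic one-step method $(\Psi,\overline{h},\xi)$ is stochastically B-consistent of order $\gamma>0$ to the SODE if there exists a constant $C_{\mathrm{cons}}$ such that for every $(t,\delta)\in\mathbb{T}$: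 $\|\mathbb{E}[X(t+\delta)-\Psi(X(t),t,\delta)|\mathcal{F}_t]\|_{L^2(\Omega;\mathbb{R}^d)}\le C_{\mathrm{cons}}\delta^{\gamma+1}$ and $\|(\mathrm{id}-\mathbb{E}[\,\cdot\,|\mathcal{F}_t])(X(t+\delta)-\Psi(X(t),t,\delta))\|_{L^2(\Omega;\mathbb{R}^d)}\le C_{\mathrm{cons}}\delta^{\gamma+\frac12}$, where $(\mathrm{id}-\mathbb{E}[\,\cdot\,|\mathcal{F}_t])V:=V-\mathbb{E}[V|\mathcal{F}_t]$. *)

(* Defs.v *)
From HB Require Import structures.
From mathcomp Require Import all_boot all_order all_algebra.
From mathcomp Require Import all_classical all_reals all_analysis.

Set Implicit Arguments.
Unset Strict Implicit.
Unset Printing Implicit Defensive.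

Import Order.TTheory GRing.Theory Num.Theory.
Import numFieldNormedType.Exports.

Local Open Scope classical_set_scope.
Local Open Scope ring_scope.

(* The library norm on ['rV[R]_d] is the sup norm, hence these definitions.
   The topology of ['rV[R]_d] is the usual one. *)
Definition dotp (R : realType) (d : nat) (x y : 'rV[R]_d) : R :=
  \sum_(i < d) x 0 i * y 0 i.

Definition enorm (R : realType) (d : nat) (x : 'rV[R]_d) : R :=
  Num.sqrt (dotp x x).

(* ||Y||_{L^p(Omega; R^d)}, possibly +oo *)
Definition LpNorm (disp : measure_display) (Omega : measurableType disp)
    (R : realType) (P : probability Omega R) (d : nat) (p : R)
    (Y : Omega -> 'rV[R]_d) : \bar R :=
  Lnorm P p%:E (fun w => (enorm (Y w))%:E).

Definition smeasurable (Omega : Type) (R : realType) (G : set (set Omega))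
    (Y : Omega -> R) : Prop :=
  forall B : set R, measurable B -> G (Y @^-1` B).

Definition vmeasurable (Omega : Type) (R : realType) (d : nat)
    (G : set (set Omega)) (Y : Omega -> 'rV[R]_d) : Prop :=
  forall i : 'I_d, smeasurable G (fun w => Y w 0 i).

Record usual_filtration (disp : measure_display) (Omega : measurableType disp)
    (R : realType) (P : probability Omega R) (T : R)
    (F : R -> set (set Omega)) : Prop := {
  filtration_sigma : forall t : R, 0 <= t <= T -> sigma_algebra setT (F t);
  filtration_sub : forall t : R, 0 <= t <= T -> F t `<=` measurable;
  filtration_mono : forall s t : R, 0 <= s -> s <= t -> t <= T -> F s `<=` F t;
  filtration_right : forall t : R, 0 <= t < T -> forall A : set Omega,
    (forall s : R, t < s <= T -> F s A) -> F t A;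
  (* every subset of a P-null set is in F_0 *)
  filtration_complete : forall A : set Omega, P.-negligible A -> F 0 A }.

(* Z is a version of E[V | G], for integrable V *)
Definition cond_expectation (disp : measure_display)
    (Omega : measurableType disp) (R : realType) (P : probability Omega R)
    (G : set (set Omega)) (V Z : Omega -> R) : Prop :=
  [/\ P.-integrable setT (EFin \o V),
      smeasurable G Z,
      P.-integrable setT (EFin \o Z) &
      forall A : set Omega, G A ->
        \int[P]_(w in A) Z w = \int[P]_(w in A) V w].

Definition vcond_expectation (disp : measure_display)
    (Omega : measurableType disp) (R : realType) (P : probability Omega R)
    (G : set (set Omega)) (d : nat) (V Z : Omega -> 'rV[R]_d) : Prop :=
  forall i : 'I_d,
    cond_expectation P G (fun w => V w 0 i) (fun w => Z w 0 i).

Record brownian_motion (disp : measure_display) (Omega : measurableType disp)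
    (R : realType) (P : probability Omega R) (T : R)
    (F : R -> set (set Omega)) (W : R -> Omega -> R) : Prop := {
  bm_adapted : forall t : R, 0 <= t <= T -> smeasurable (F t) (W t);
  bm_start : {ae P, forall w, W 0 w = 0};
  bm_continuous : {ae P, forall w, {within `[0, T], continuous (W ^~ w)}};
  (* [normal_prob] takes the standard deviation, not the variance *)
  bm_normal : forall s t : R, 0 <= s -> s < t -> t <= T ->
    forall B : set R, measurable B ->
      P ((fun w => W t w - W s w) @^-1` B) =
      normal_prob 0 (Num.sqrt (t - s)) B;
  bm_indep : forall s t : R, 0 <= s -> s < t -> t <= T ->
    forall (A : set Omega) (B : set R), F s A -> measurable B ->
      P (A `&` (fun w => W t w - W s w) @^-1` B) =
      (P A * P ((fun w => W t w - W s w)%R @^-1` B))%E }.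

Definition sigma_process (Omega : Type) (R : realType) (T : R)
    (W : R -> Omega -> R) : set (set Omega) :=
  <<s [set A | exists t : R, exists B : set R,
         [/\ 0 <= t <= T, measurable B & A = W t @^-1` B]] >>.

Definition independent_processes (disp : measure_display)
    (Omega : measurableType disp) (R : realType) (P : probability Omega R)
    (T : R) (m : nat) (W : 'I_m -> R -> Omega -> R) : Prop :=
  forall (J : {set 'I_m}) (A : 'I_m -> set Omega),
    (forall r, r \in J -> sigma_process T (W r) (A r)) ->
    P (\big[setI/setT]_(r in J) A r) = (\prod_(r in J) P (A r))%E.

Definition cvg_in_probability0 (disp : measure_display)
    (Omega : measurableType disp) (R : realType) (P : probability Omega R)
    (Y : nat -> Omega -> \bar R) : Prop :=
  forall e : R, 0 < e ->
    (fun n => P [set w | (e%:E < `|Y n w|)%E]) @ \oo --> (0 : \bar R).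

(* The process \sum_(k < n) c_k 1_{]t_k, t_{k+1}]}, with n = [sp_size],
   t_k = [sp_time k] and c_k = [sp_coef k]. *)
Record simple_process (Omega : Type) (R : realType) := SimpleProcess {
  sp_size : nat;
  sp_time : nat -> R;
  sp_coef : nat -> Omega -> R }.

Definition sp_predictable (Omega : Type) (R : realType) (T : R)
    (F : R -> set (set Omega)) (S : simple_process Omega R) : Prop :=
  [/\ (forall k, (k <= sp_size S)%N -> 0 <= sp_time S k <= T),
      (forall k, (k < sp_size S)%N -> sp_time S k <= sp_time S k.+1),
      (forall k, (k < sp_size S)%N ->
         smeasurable (F (sp_time S k)) (sp_coef S k)) &
      (forall k, (k < sp_size S)%N ->
         exists M : R, forall w, `|sp_coef S k w| <= M)].

Definition sp_val (Omega : Type) (R : realType) (S : simple_process Omega R)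
    (s : R) (w : Omega) : R :=
  \sum_(k < sp_size S)
    sp_coef S k w * \1_(`]sp_time S k, sp_time S k.+1]) s.

Definition sp_integral (Omega : Type) (R : realType)
    (W : R -> Omega -> R) (S : simple_process Omega R)
    (t : R) (w : Omega) : R :=
  \sum_(k < sp_size S)
    sp_coef S k w *
      (W (Num.min (sp_time S k.+1) t) w - W (Num.min (sp_time S k) t) w).

(* I is (a version of) the Ito integral process (\int_0^t H dW), t in [0, T].
   Relational form of the usual construction: H is approximated by simple
   predictable processes S_n, \int_0^T |S_n - H|^2 ds -> 0 in probability, and
   the integral is the adapted a.s. continuous process whose value at every t
   is the limit in probability of the elementary integrals of the S_n.
   No moment condition is imposed on H. *)
Definition ito_integral (disp : measure_display)
    (Omega : measurableType disp) (R : realType) (P : probability Omega R)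
    (T : R) (F : R -> set (set Omega)) (W : R -> Omega -> R)
    (H I : R -> Omega -> R) : Prop :=
  [/\ (forall t : R, 0 <= t <= T -> smeasurable (F t) (I t)),
      {ae P, forall w, {within `[0, T], continuous (I ^~ w)}} &
      exists S : nat -> simple_process Omega R,
        [/\ (forall n, sp_predictable T F (S n)),
            cvg_in_probability0 P (fun n w =>
              (\int[lebesgue_measure]_(s in `[0%R, T])
                 ((sp_val (S n) s w - H s w) ^+ 2)%:E)%E) &
            (forall t : R, 0 <= t <= T ->
               cvg_in_probability0 P (fun n w =>
                 (sp_integral W (S n) t w - I t w)%:E))]].

Record admissible (R : realType) (d m : nat) (T L eta q : R)
    (f : R -> 'rV[R]_d -> 'rV[R]_d)
    (g : 'I_m -> R -> 'rV[R]_d -> 'rV[R]_d) : Prop := {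
  adm_L : 0 < L;
  adm_eta : 2^-1 < eta;
  adm_q : 1 < q;
  adm_cont_f : {within [set z : R * 'rV[R]_d | 0 <= z.1 <= T],
    continuous (fun z : R * 'rV[R]_d => f z.1 z.2)};
  adm_cont_g : forall r, {within [set z : R * 'rV[R]_d | 0 <= z.1 <= T],
    continuous (fun z : R * 'rV[R]_d => g r z.1 z.2)};
  adm_monotone : forall (t : R) x1 x2, 0 <= t <= T ->
    dotp (f t x1 - f t x2) (x1 - x2)
      + eta * (\sum_(r < m) enorm (g r t x1 - g r t x2) ^+ 2)
    <= L * enorm (x1 - x2) ^+ 2;
  adm_growth : forall (t : R) x, 0 <= t <= T ->
    let B := L * (1 + enorm x `^ q) in
    enorm (f t x) <= B /\ (forall r, enorm (g r t x) <= B);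
  adm_time : forall (t1 t2 : R) x, 0 <= t1 <= T -> 0 <= t2 <= T ->
    let B := L * (1 + enorm x `^ q) * `|t1 - t2| `^ 2^-1 in
    enorm (f t1 x - f t2 x) <= B /\
    (forall r, enorm (g r t1 x - g r t2 x) <= B);
  adm_lipschitz : forall (t : R) x1 x2, 0 <= t <= T ->
    let B := L * (1 + enorm x1 `^ (q - 1) + enorm x2 `^ (q - 1))
               * enorm (x1 - x2) in
    enorm (f t x1 - f t x2) <= B /\
    (forall r, enorm (g r t x1 - g r t x2) <= B) }.

(* X solves X(t) = X0 + \int_0^t f(s, X(s)) ds
                      + \sum_r \int_0^t g^r(s, X(s)) dW^r(s);
   [I r i] is the i-th coordinate of the r-th stochastic integral. *)
Definition sode_solution (disp : measure_display)
    (Omega : measurableType disp) (R : realType) (P : probability Omega R)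
    (T : R) (F : R -> set (set Omega)) (d m : nat)
    (W : 'I_m -> R -> Omega -> R)
    (f : R -> 'rV[R]_d -> 'rV[R]_d)
    (g : 'I_m -> R -> 'rV[R]_d -> 'rV[R]_d)
    (X0 : Omega -> 'rV[R]_d) (X : R -> Omega -> 'rV[R]_d) : Prop :=
  [/\ (forall t : R, 0 <= t <= T -> vmeasurable (F t) (X t)),
      {ae P, forall w, {within `[0, T], continuous (X ^~ w)}} &
      exists I : 'I_m -> 'I_d -> R -> Omega -> R,
        (forall r i, ito_integral P T F (W r)
           (fun s w => g r s (X s w) 0 i) (I r i)) /\
        (forall t : R, 0 <= t <= T -> {ae P, forall w, forall i : 'I_d,
           X t w 0 i = X0 w 0 i
             + \int[lebesgue_measure]_(s in `[0, t]) (f s (X s w) 0 i)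
             + \sum_(r < m) I r i t w})].

Definition ssbe_F (R : realType) (d : nat)
    (f : R -> 'rV[R]_d -> 'rV[R]_d) (delta t : R) (x : 'rV[R]_d) : 'rV[R]_d :=
  x - delta *: f t x.

(* F_delta(t, .)^{-1}; [pinv_] takes the junk value 0 outside the range *)
Definition ssbe_Finv (R : realType) (d : nat)
    (f : R -> 'rV[R]_d -> 'rV[R]_d) (delta t : R) : 'rV[R]_d -> 'rV[R]_d :=
  'pinv_(fun=> 0) setT (ssbe_F f delta t).

Definition ssbe (Omega : Type) (R : realType) (d m : nat)
    (W : 'I_m -> R -> Omega -> R)
    (f : R -> 'rV[R]_d -> 'rV[R]_d)
    (g : 'I_m -> R -> 'rV[R]_d -> 'rV[R]_d)
    (x : 'rV[R]_d) (t delta : R) (w : Omega) : 'rV[R]_d :=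
  let y := ssbe_Finv f delta (t + delta) x in
  y + \sum_(r < m) (W r (t + delta) w - W r t w) *: g r (t + delta) y.

(* Stochastic B-consistency of order gamma of (Psi, hbar, X 0) to the SODE
   solved by X.  Existence of the conditional expectation [Z] is part of the
   claim, so the bounds cannot hold vacuously; [Z] is a.s. unique. *)
Definition B_consistent (disp : measure_display)
    (Omega : measurableType disp) (R : realType) (P : probability Omega R)
    (T : R) (F : R -> set (set Omega)) (d : nat)
    (X : R -> Omega -> 'rV[R]_d)
    (Psi : 'rV[R]_d -> R -> R -> Omega -> 'rV[R]_d) (hbar gamma : R) : Prop :=
  0 < gamma /\
  exists C : R, forall t delta : R,
    0 <= t < T -> 0 < delta <= hbar -> t + delta <= T ->
    let V := fun w => X (t + delta) w - Psi (X t w) t delta w in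
    exists Z : Omega -> 'rV[R]_d,
      [/\ vcond_expectation P (F t) V Z,
          (LpNorm P 2 Z <= (C * delta `^ (gamma + 1))%:E)%E &
          (LpNorm P 2 (fun w => (V w - Z w)%R)
             <= (C * delta `^ (gamma + 2^-1))%:E)%E].

(* Main.v *)
(* Let [u = t + delta] and let [Y] be the implicit stage, [Y = X_t + delta f(u, Y)].
   The one-step error splits as [A + M], with drift part
   [A = int_t^u (f(s, X_s) - f(u, Y)) ds] and martingale part
   [M = sum_r (int_t^u g^r(s, X_s) dW^r - g^r(u, Y) (W^r_u - W^r_t))].
   Monotonicity of [f] makes [x - delta f(u, x)] strongly monotone, so [Y] exists,
   [|Y| <= C (1 + |X_t|)] and [|X_t - Y| <= C delta (1 + |X_t|^q)]; together with
   [E|X_s - X_t|^rho <= C |s - t|^(rho/2)], [rho = (4 q - 2)/q], and Young's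
   inequality, this bounds [E|h(s, X_s) - h(u, Y)|^2] by [C delta] for [h = f, g^r].
   Hence [E|A|^2 <= C delta^3] and [E|M|^2 <= C delta^2]; as [E[M | F_t] = 0], the
   conditional mean of the error is [E[A | F_t]], of size [delta^(3/2)].

   Moments of Ito integrals are computed on Riemann sums: since the integrand has
   continuous paths, the simple processes defining the integral may be replaced, up
   to an error small in probability (Lenglart's inequality), by values of the
   integrand itself on a fine grid, for which a discrete Gronwall argument gives
   [E|sum_k xi_k (W_(t_(k+1)) - W_(t_k))|^p <= C h^(p/2 - 1) E sum_k |xi_k|^p (t_(k+1) - t_k)]. *)
Require Import Defs.
From HB Require Import structures.
From mathcomp Require Import all_boot all_order all_algebra.
From mathcomp Require Import all_classical all_reals all_analysis.
From mathcomp Require Import measurable_realfun ring lra.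

Import Order.TTheory GRing.Theory Num.Theory.
Import numFieldNormedType.Exports.

Local Open Scope classical_set_scope.
Local Open Scope ring_scope.

(** * Power inequalities *)

Section real_inequalities.
Set Implicit Arguments.
Unset Strict Implicit.
Context {R : realType}.
Implicit Types a b x y p h : R.

(** The solution has moments of order [4 q - 2] and the coefficients grow like [|x|^q], so
    [f(s, X_s)] and [g^r(s, X_s)] are controlled only up to the order [rho = 4 - 2/q]. This fixes
    the range [2 <= p <= 4] of all stochastic moment bounds: [p = rho] for the increments of [X],
    [p = 2] for the error. In that range a second-order expansion of [|a + b|^p] with explicit
    constants takes the place of the Burkholder inequality. The Ito integral is given only through
    limits in probability and without moment conditions, so neither an isometry nor a martingale
    property is at hand: moment bounds and vanishing means are proved for elementary integrals and
    must survive convergence in probability. Moments pass by truncation, at the cost of a factor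
    [2^p]; means pass because the approximants are bounded in [L^2]. The stage [Y] is
    [F_t]-measurable, so [g^r(u, Y)] can be subtracted from the integrand on [[t, u]] as a random
    constant [xi]; the same remainder with [xi = 0] describes the increments of [X]. *)

Lemma powR_le_tangent y (r : R) : 0 <= y -> 0 <= r <= 1 -> y `^ r <= 1 + r * (y - 1).
Proof.
move=> y0 /andP[r0 r1].
have [->|rn0] := eqVneq r 0; first by rewrite powRr0 mul0r addr0.
have [->|rn1] := eqVneq r 1; first by rewrite powRr1// mul1r addrC subrK.
have r_gt0 : 0 < r by rewrite lt_def rn0.
have r_lt1 : 0 < 1 - r by rewrite subr_gt0 lt_def eq_sym rn1.
have := @conjugate_powR R (y `^ r) 1 r^-1 (1 - r)^-1.
rewrite powR_ge0 ler01 !invrK !invr_gt0 mulr1 powR1 -powRrM divff// powRr1//.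
move=> /(_ isT isT r_gt0 r_lt1); rewrite addrC subrK => /(_ erefl) /le_trans; apply.
by rewrite le_eqVlt; apply/orP; left; apply/eqP; ring.
Qed.

Lemma powRD_le x y p : 0 <= x -> 0 <= y -> 0 <= p ->
  (x + y) `^ p <= 2 `^ p * (x `^ p + y `^ p).
Proof.
move=> x0 y0 p0.
wlog xy : x y x0 y0 / x <= y.
  move=> H; have [/H|/ltW/H] := leP x y; first exact.
  by rewrite [x + y]addrC [x `^ p + _]addrC; exact.
apply: (@le_trans _ _ ((2 * y) `^ p)).
  by apply: ge0_ler_powR; rewrite ?nnegrE//; lra.
by rewrite powRM// ler_wpM2l ?powR_ge0// lerDr powR_ge0.
Qed.

Lemma powR_half_sqr a p : (a ^+ 2) `^ (p / 2) = `|a| `^ p.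
Proof.
rewrite -[a ^+ 2]real_normK ?num_real// -powR_mulrn//.
by rewrite -powRrM; congr (_ `^ _); field.
Qed.

(** The term linear in [b] is kept exact, as it averages to zero when [b] is a multiple of a fresh
    Brownian increment. If [|a| < |b|], everything is dominated by [|b|^p]; otherwise [b / a] lies
    in [[-1, 1]] and a quadratic bound remains. The constant 40 is generous. *)
Lemma powR_taylor2 p a b : 2 <= p <= 4 ->
  `|a + b| `^ p <= `|a| `^ p + p * (a * `|a| `^ (p - 2)) * b +
     40 * (`|a| `^ (p - 2) * b ^+ 2 + `|b| `^ p).
Proof.
move=> /andP[p2 p4].
have p0 : 0 <= p by lra.
have [ab|ba] := ltP `|a| `|b|.
  have b0 : 0 < `|b| by apply: le_lt_trans ab.
  have H1 : `|a + b| `^ p <= 16 * `|b| `^ p.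
    apply: (@le_trans _ _ ((2 * `|b|) `^ p)).
      by apply: ge0_ler_powR; rewrite ?nnegrE ?mulr_ge0//;
        apply: (le_trans (ler_normD _ _)); lra.
    rewrite powRM// ler_wpM2r ?powR_ge0//.
    have -> : (16 : R) = 2 `^ 4 by rewrite (powR_mulrn 4)//; ring.
    by rewrite ler_powR//; lra.
  have H2 : `|p * (a * `|a| `^ (p - 2)) * b| <= 4 * `|b| `^ p.
    rewrite !normrM (ger0_norm p0) (@ger0_norm _ (`|a| `^ _)) ?powR_ge0//.
    rewrite -mulrA ler_pM// ?mulr_ge0 ?powR_ge0//.
    have -> : `|b| `^ p = (`|b| * `|b| `^ (p - 2)) * `|b|.
      rewrite mulrAC -expr2 -powR_mulrn// -powRD; first by congr (_ `^ _); ring.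
      by rewrite (gt_eqF b0) implybT.
    rewrite ler_wpM2r// ler_pM ?powR_ge0// ?(ltW ab)//.
    by apply: ge0_ler_powR; rewrite ?nnegrE//; [lra | exact: ltW].
  have H3 : 0 <= `|a| `^ (p - 2) * b ^+ 2 by rewrite mulr_ge0 ?powR_ge0 ?sqr_ge0.
  have H4 := powR_ge0 `|a| p.
  have := ler_norm (- (p * (a * `|a| `^ (p - 2)) * b)); rewrite normrN => H5.
  have H6 := powR_ge0 `|b| p.
  lra.
have [a0|an0] := eqVneq a 0.
  have /eqP : `|b| == 0 by rewrite eq_le normr_ge0 andbT (le_trans ba)// a0 normr0.
  move/eqP; rewrite normr_eq0 => /eqP ->.
  rewrite a0 addr0 expr0n/= mulr0 normr0 powR0; last by apply/eqP; lra.
  by lra.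
have a_gt0 : 0 < `|a| by rewrite normr_gt0.
have D : `|a| `^ p = `|a| `^ (p - 2) * a ^+ 2.
  have -> : a ^+ 2 = `|a| `^ 2 by rewrite (powR_mulrn 2)// real_normK ?num_real.
  by rewrite -powRD ?(gt_eqF a_gt0) ?implybT// subrK.
set c := b / a.
have c1 : `|c| <= 1 by rewrite normf_div ler_pdivrMr// mul1r.
have bE : b = c * a by rewrite /c divfK.
have -> : a + b = a * (1 + c) by rewrite bE; ring.
rewrite normrM powRM// -(powR_half_sqr (1 + c)).
set y := (1 + c) ^+ 2.
have y0 : 0 <= y by rewrite sqr_ge0.
(* Since [2 <= p <= 4], the exponent [p / 2 - 1] lies in [[0, 1]]; only this power is replaced by
   its tangent at 1, and the remaining factor [y] stays polynomial. *)
have yp : y `^ (p / 2) <= y * (1 + (p / 2 - 1) * (y - 1)).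
  have [->|yn0] := eqVneq y 0; first by rewrite mul0r powR0//; apply/eqP; lra.
  have -> : p / 2 = 1 + (p / 2 - 1) by ring.
  rewrite powRD ?yn0 ?implybT// powRr1//; rewrite ler_wpM2l//.
  have -> : 1 + (p / 2 - 1) - 1 = p / 2 - 1 by ring.
  by apply: powR_le_tangent => //; apply/andP; split; lra.
have cb : -1 <= c <= 1 by rewrite -ler_norml.
have key : y `^ (p / 2) <= 1 + p * c + 40 * c ^+ 2.
  apply: (le_trans yp); rewrite -subr_ge0.
  have -> : 1 + p * c + 40 * c ^+ 2 - y * (1 + (p / 2 - 1) * (y - 1)) =
    c ^+ 2 * (40 - p / 2 - (p / 2 - 1) * (2 + c) ^+ 2) by rewrite /y; field.
  rewrite mulr_ge0 ?sqr_ge0//.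
  have : (2 + c) ^+ 2 <= 9.
    have -> : (9 : R) = 3 ^+ 2 by ring.
    by move/andP: cb => [? ?]; rewrite lerXn2r// ?nnegrE; lra.
  have : 0 <= (2 + c) ^+ 2 by rewrite sqr_ge0.
  move: ((2 + c) ^+ 2) => z z0 z9.
  have : (p / 2 - 1) * z <= 1 * 9 by rewrite ler_pM//; lra.
  lra.
apply: (le_trans (ler_wpM2l (powR_ge0 _ _) key)).
rewrite bE D; have H6 := powR_ge0 `|c * a| p.
have : 0 <= `|a| `^ (p - 2) by exact: powR_ge0.
move: (`|a| `^ (p - 2)) => z z0.
rewrite -subr_ge0.
set u := _ `^ p.
have -> : z * a ^+ 2 + p * (a * z) * (c * a) + 40 * (z * (c * a) ^+ 2 + u) -
   z * a ^+ 2 * (1 + p * c + 40 * c ^+ 2) = 40 * u by ring.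
by rewrite mulr_ge0.
Qed.

(** The two terms on the right balance at [x = sqrt h * y], and the proof compares [x] with that
    threshold. The weight [1 / h] is made for steps of total length at most [h], over which a
    Gronwall factor stays bounded. *)
Lemma powR_young p x y h : 2 <= p -> 0 <= x -> 0 <= y -> 0 < h ->
  x `^ (p - 2) * y ^+ 2 <= x `^ p / h + h `^ (p / 2 - 1) * y `^ p.
Proof.
move=> p2 x0 y0 h0.
have hs : 0 < Num.sqrt h by rewrite sqrtr_gt0.
have hE : h `^ (p / 2 - 1) = Num.sqrt h `^ (p - 2).
  by rewrite -powR12_sqrt ?ltW// -powRrM; congr (_ `^ _); field.
have hE2 : h = Num.sqrt h ^+ 2 by rewrite sqr_sqrtr// ltW.
have spl z : z != 0 -> 0 <= z -> z `^ p = z `^ (p - 2) * z ^+ 2.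
  move=> zn z0; rewrite -(powR_mulrn 2 z0) -powRD ?zn ?implybT//.
  by congr (_ `^ _); ring.
have [hyx|xhy] := leP (Num.sqrt h * y) x.
  have [xz|xn0] := eqVneq x 0.
    have yz : y = 0.
      by apply/eqP; move: hyx; rewrite xz pmulr_rle0// => y00; rewrite eq_le y0 y00.
    rewrite yz expr0n/= mulr0 addr_ge0// mulr_ge0 ?powR_ge0// ?invr_ge0 ltW//.
  apply: (@le_trans _ _ (x `^ p / h)); last by rewrite lerDl mulr_ge0 ?powR_ge0.
  rewrite (spl x)// -mulrA ler_wpM2l ?powR_ge0//.
  rewrite ler_pdivlMr// [X in _ * X]hE2 -exprMn mulrC.
  by rewrite lerXn2r ?nnegrE// mulr_ge0// ltW.
have y_gt0 : 0 < y by rewrite -(pmulr_rgt0 _ hs) (le_lt_trans x0).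
apply: (@le_trans _ _ (h `^ (p / 2 - 1) * y `^ p)); last first.
  by rewrite lerDr mulr_ge0 ?powR_ge0// invr_ge0 ltW.
rewrite (spl y) ?gt_eqF// mulrA ler_wpM2r ?sqr_ge0// hE -powRM ?sqrtr_ge0//.
by apply: ge0_ler_powR; rewrite ?nnegrE ?mulr_ge0 ?sqrtr_ge0//; [lra|exact: ltW].
Qed.

End real_inequalities.

(** * Independence *)

Section independence.
Set Implicit Arguments.
Unset Strict Implicit.
Context {R : realType} {disp : measure_display} {Omega : measurableType disp}
  (P : probability Omega R).
Local Open Scope ereal_scope.

Definition indep_rv (U D : Omega -> R) := forall A B : set R,
  measurable A -> measurable B ->
  P (U @^-1` A `&` D @^-1` B) = P (U @^-1` A) * P (D @^-1` B).

Variables (U D : Omega -> R).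
Hypotheses (mU : measurable_fun setT U) (mD : measurable_fun setT D).
Hypothesis UD : indep_rv U D.

Let U' : {mfun Omega >-> R} := HB.pack U (isMeasurableFun.Build _ _ _ _ _ mU).
Let D' : {mfun Omega >-> R} := HB.pack D (isMeasurableFun.Build _ _ _ _ _ mD).
Let mX : measurable_fun setT (fun w => (U w, D w)).
Proof. exact: measurable_fun_pair. Qed.
Let X : {mfun Omega >-> (R * R)%type} :=
  HB.pack (fun w => (U w, D w)) (isMeasurableFun.Build _ _ _ _ _ mX).

(** Rectangles determine a measure on the product, so independence identifies the joint law with the
    product of the marginals; the product formulas for expectations are then Tonelli and Fubini. *)
Let prodE (A : set (R * R)) : measurable A ->
  (distribution P U' \x distribution P D') A = distribution P X A.
Proof.
by apply: product_measure_unique => B C mB mC; rewrite -UD.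
Qed.

Lemma indep_ge0_integralM (phi psi : R -> R) :
  measurable_fun setT phi -> measurable_fun setT psi ->
  (forall x, 0 <= phi x)%R -> (forall x, 0 <= psi x)%R ->
  \int[P]_w (phi (U w) * psi (D w))%:E =
  \int[P]_w (phi (U w))%:E * \int[P]_w (psi (D w))%:E.
Proof.
move=> mphi mpsi phi0 psi0.
have m1 : measurable_fun setT (fun z : R * R => (phi z.1 * psi z.2)%:E).
  apply/measurable_EFinP; apply: measurable_funM.
    by apply: measurableT_comp => //; exact: measurable_fst.
  by apply: measurableT_comp => //; exact: measurable_snd.
transitivity (\int[distribution P X]_z (phi z.1 * psi z.2)%:E).
  by rewrite ge0_integral_distribution// => z; rewrite lee_fin mulr_ge0.
transitivity (\int[distribution P U' \x distribution P D']_z (phi z.1 * psi z.2)%:E).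
  by apply: eq_measure_integral => A mA _; exact/esym/prodE.
rewrite fubini_tonelli1//; last by move=> z; rewrite lee_fin mulr_ge0.
transitivity (\int[distribution P U']_x
   ((phi x)%:E * \int[distribution P D']_y (psi y)%:E)).
  apply: eq_integral => x _ /=; rewrite /fubini_F.
  under eq_integral do rewrite EFinM.
  rewrite /= ge0_integralZl//.
  - exact/measurable_EFinP.
  - by move=> y _; rewrite lee_fin.
  - by rewrite lee_fin.
have mphiE : measurable_fun setT (EFin \o phi) by exact/measurable_EFinP.
have mpsiE : measurable_fun setT (EFin \o psi) by exact/measurable_EFinP.
rewrite ge0_integralZr//; last 2 first.
- by move=> y _; rewrite lee_fin.
- by apply: integral_ge0 => y _; rewrite lee_fin.
by rewrite !ge0_integral_distribution// => y; rewrite lee_fin.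
Qed.

Lemma indep_integrableM :
  P.-integrable setT (EFin \o U) -> P.-integrable setT (EFin \o D) ->
  P.-integrable setT (fun w => (U w * D w)%:E).
Proof.
move=> /integrableP[_ iU] /integrableP[_ iD]; apply/integrableP; split.
  by apply/measurable_EFinP; apply: measurable_funM.
under eq_integral do rewrite abse_EFin normrM.
by rewrite (indep_ge0_integralM (phi := Num.norm) (psi := Num.norm))// lte_mul_pinfty//;
  [exact: integral_ge0|rewrite ge0_fin_numE//; exact: integral_ge0].
Qed.

Lemma indep_integralM :
  P.-integrable setT (EFin \o U) -> P.-integrable setT (EFin \o D) ->
  \int[P]_w (U w * D w)%:E = \int[P]_w (U w)%:E * \int[P]_w (D w)%:E.
Proof.
move=> iU iD.
have m1 : measurable_fun setT (fun z : R * R => (z.1 * z.2)%:E).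
  by apply/measurable_EFinP; apply: measurable_funM; [exact: measurable_fst|exact: measurable_snd].
have iUD := indep_integrableM iU iD.
transitivity (\int[distribution P X]_z (z.1 * z.2)%:E).
  by rewrite integral_distribution.
have iX : (distribution P X).-integrable setT (fun z : R * R => (z.1 * z.2)%:E).
  exact: integrable_pushforward.
have iUD' : (distribution P U' \x distribution P D').-integrable setT (fun z : R * R => (z.1 * z.2)%:E).
  move/integrableP: iX => [_ iX]; apply/integrableP; split => //.
  rewrite (_ : integral _ _ _ = \int[distribution P X]_z `|(z.1 * z.2)%:E|)//.
  by apply: eq_measure_integral => A mA _; exact: prodE.
transitivity (\int[distribution P U' \x distribution P D']_z (z.1 * z.2)%:E).
  by apply: eq_measure_integral => A mA _; exact/esym/prodE.
rewrite -integral12_prod_meas1//.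
have iD' : (distribution P D').-integrable setT (@EFin R).
  exact: integrable_pushforward.
have iU' : (distribution P U').-integrable setT (@EFin R).
  exact: integrable_pushforward.
have ED : \int[distribution P D']_y y%:E = \int[P]_w (D w)%:E.
  by rewrite integral_distribution.
have EU : \int[distribution P U']_y y%:E = \int[P]_w (U w)%:E.
  by rewrite integral_distribution.
transitivity (\int[distribution P U']_x (x%:E * \int[distribution P D']_y y%:E)).
  apply: eq_integral => x _ /=; rewrite /fubini_F.
  under eq_integral do rewrite EFinM.
  by rewrite integralZl.
rewrite ED -EU.
have : \int[P]_w (D w)%:E \is a fin_num by apply: integrable_fin_num.
move=> /fineK <-.
by rewrite integralZr.
Qed.

End independence.

(** * Gaussian moments *)

Section normal_moments.
Set Implicit Arguments.
Unset Strict Implicit.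
Context {R : realType}.
Local Open Scope ereal_scope.
Local Notation mu := (@lebesgue_measure R).

Lemma measurable_normr_powR d (T : measurableType d) (f : T -> R) (p : R) :
  measurable_fun setT f -> measurable_fun setT (fun w => `|f w| `^ p)%R.
Proof.
move=> mf; apply: (measurableT_comp (measurable_powR p)).
exact: (measurableT_comp (@normr_measurable _ _)).
Qed.

(** The Radon-Nikodym derivative of [normal_prob] is the density only almost everywhere, because the
    two have the same integrals over measurable sets. *)
Lemma ge0_integral_normal_prob (s : R) (f : R -> \bar R) :
  measurable_fun setT f -> (forall x, 0 <= f x) ->
  \int[normal_prob 0%R s]_x f x = \int[mu]_x (f x * (normal_pdf 0 s x)%:E).
Proof.
move=> mf f0.
rewrite -(Radon_Nikodym_SigmaFinite.change_of_variables (normal_prob_dominates 0%R s))//=.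
apply: ae_eq_integral => //.
- apply: emeasurable_funM => //; apply: (measurable_int mu).
  exact/Radon_Nikodym_SigmaFinite.f_integrable/normal_prob_dominates.
- apply: emeasurable_funM => //=.
  by apply/measurable_EFinP; exact: measurable_normal_pdf.
- apply: ae_eqe_mul2l => /=.
  apply: integral_ae_eq => //=.
  + exact/Radon_Nikodym_SigmaFinite.f_integrable/normal_prob_dominates.
  + by apply/measurable_EFinP; exact: measurable_normal_pdf.
  + by move=> E E01 mE; rewrite -Radon_Nikodym_SigmaFinite.f_integral//; exact: normal_prob_dominates.
Qed.

(** Half of the Gaussian exponent [x^2 / (2 s^2)] is spent on absorbing the power. With
    [y = |x| / s], the quadratic term of the exponential series gives [y^4 <= 32 exp(y^2 / 4)]. *)
Lemma powR_le_expR (p x s : R) : (0 < s)%R -> (2 <= p <= 4)%R ->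
  (`|x| `^ p <= 33 * s `^ p * expR (x ^+ 2 / (4 * s ^+ 2)))%R.
Proof.
move=> s0 /andP[p2 p4].
have [y0 yE] : (0 <= `|x| / s /\ `|x| = s * (`|x| / s))%R.
  by split; [rewrite divr_ge0// ltW|rewrite mulrC divfK// gt_eqF].
have -> : (x ^+ 2 / (4 * s ^+ 2) = (`|x| / s) ^+ 2 / 4)%R.
  by rewrite expr_div_n real_normK ?num_real//; field; rewrite gt_eqF.
rewrite [in leLHS]yE powRM ?(ltW s0)// -mulrA mulrCA ler_wpM2l ?powR_ge0//.
move: (`|x| / s)%R y0 => y y0.
have e1 : (1 <= expR (y ^+ 2 / 4))%R by apply: (le_trans _ (expR_ge1Dx _)); rewrite lerDl divr_ge0 ?sqr_ge0.
have [y1|y1] := leP y 1%R.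
  apply: (@le_trans _ _ 1%R); last lra.
  have <- : (1 `^ p = 1 :> R)%R by rewrite powR1.
  by rewrite ge0_ler_powR ?nnegrE//; lra.
apply: (@le_trans _ _ (y ^+ 4)%R).
  by rewrite -(powR_mulrn 4)// ler_powR//; exact: ltW.
have : ((y ^+ 2 / 4) ^+ 2 / 2 <= expR (y ^+ 2 / 4))%R.
  have := @expR_ge1Dxn R (y ^+ 2 / 4)%R 1 (divr_ge0 (sqr_ge0 y) (ler0n _ _)).
  rewrite (_ : (2`!)%:R = 2%R) //; lra.
have -> : ((y ^+ 2 / 4) ^+ 2 / 2 = y ^+ 4 / 32)%R by field.
lra.
Qed.

(** What is left of the density is again Gaussian, with variance [2 s^2], so moments need no
    explicit integration. *)
Lemma normal_pdf_expR (s x : R) : (0 < s)%R ->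
  (expR (x ^+ 2 / (4 * s ^+ 2)) * normal_pdf 0 s x =
   Num.sqrt 2 * normal_pdf 0 (Num.sqrt 2 * s) x)%R.
Proof.
move=> s0.
have t0 : (0 < Num.sqrt 2 :> R)%R by rewrite sqrtr_gt0.
have t2 : ((Num.sqrt 2) ^+ 2 = 2 :> R)%R by rewrite sqr_sqrtr.
rewrite !normal_pdfE ?gt_eqF ?mulr_gt0// /normal_fun /normal_peak !subr0.
rewrite mulrCA -expRD mulrA; rewrite [RHS]mulrA.
have -> : (x ^+ 2 / (4 * s * s) + - x ^+ 2 / (s ^+ 2 *+ 2) =
    - x ^+ 2 / ((Num.sqrt 2 * s) ^+ 2 *+ 2))%R.
  rewrite exprMn t2 !mulr2n; field.
  have s2 : (0 < s ^+ 2)%R by rewrite exprn_gt0.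
  by apply/and3P; split; rewrite gt_eqF//; lra.
congr (_ * _)%R.
have -> : ((Num.sqrt 2 * s) ^+ 2 * pi *+ 2 = 2 * (s ^+ 2 * pi *+ 2))%R.
  by rewrite exprMn t2 !mulr2n; ring.
by rewrite sqrtrM// invfM mulrA divff ?mul1r// gt_eqF.
Qed.

Lemma normal_prob_moment (p s : R) : (0 < s)%R -> (2 <= p <= 4)%R ->
  \int[normal_prob 0%R s]_x (`|x| `^ p)%:E <= (66 * s `^ p)%:E.
Proof.
move=> s0 p24.
rewrite ge0_integral_normal_prob; last 2 first.
- by apply/measurable_EFinP; exact: measurable_normr_powR.
- by move=> x; rewrite lee_fin powR_ge0.
have t0 : (0 < Num.sqrt 2 :> R)%R by rewrite sqrtr_gt0.
(* The constant 66 is [33 * 2], with [sqrt 2] bounded by 2. *)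
have t2 : (Num.sqrt 2 <= 2 :> R)%R.
  by rewrite -(@ler_sqr R) ?nnegrE ?sqrtr_ge0// sqr_sqrtr// expr2; lra.
have c0 : (0 <= 33 * s `^ p * Num.sqrt 2)%R by rewrite !mulr_ge0 ?powR_ge0// ltW.
apply: (@le_trans _ _ (\int[mu]_x ((33 * s `^ p * Num.sqrt 2)%:E * (normal_pdf 0 (Num.sqrt 2 * s) x)%:E))).
  apply: ge0_le_integral => //.
  - by move=> x _; rewrite -EFinM lee_fin mulr_ge0 ?powR_ge0 ?normal_pdf_ge0.
  - under eq_fun do rewrite -EFinM.
    apply/measurable_EFinP; apply: measurable_funM; last exact: measurable_normal_pdf.
    exact: measurable_normr_powR.
  - under eq_fun do rewrite -EFinM.
    by apply/measurable_EFinP; apply: measurable_funM => //; exact: measurable_normal_pdf.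
  - move=> x _; rewrite -!EFinM lee_fin -[leRHS]mulrA -normal_pdf_expR// [leRHS]mulrA.
    by rewrite ler_wpM2r ?normal_pdf_ge0// powR_le_expR.
rewrite ge0_integralZl//.
- rewrite integral_normal_pdf mule1 lee_fin mulrAC ler_wpM2r ?powR_ge0//; lra.
- by apply/measurable_EFinP; exact: measurable_normal_pdf.
- by move=> x _; rewrite lee_fin normal_pdf_ge0.
Qed.

(** The density is even and Lebesgue measure is invariant under reflection. Applied to [max x 0],
    this equates the positive and negative parts of a centred Gaussian variable. *)
Lemma normal_prob_symmetric (s : R) (f : R -> R) : (0 < s)%R ->
  measurable_fun setT f -> (forall x, 0 <= f x)%R ->
  \int[normal_prob 0%R s]_x (f x)%:E = \int[normal_prob 0%R s]_x (f (- x)%R)%:E.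
Proof.
move=> s0 mf f0.
have mN : measurable_fun setT (-%R : R -> measurableTypeR R) by exact: oppr_measurable.
have mfN : measurable_fun setT (fun x : R => f (- x)%R).
  exact: (measurableT_comp mf mN).
rewrite !ge0_integral_normal_prob//; try exact/measurable_EFinP;
  try by move=> x; rewrite lee_fin.
set h := fun x => (f x)%:E * (normal_pdf 0 s x)%:E.
have mh : measurable_fun setT h.
  rewrite /h; under eq_fun do rewrite -EFinM.
  by apply/measurable_EFinP; apply: measurable_funM => //; exact: measurable_normal_pdf.
transitivity (\int[pushforward mu (-%R : R -> measurableTypeR R)]_x h x).
  by apply: eq_measure_integral => //= A mA _; exact/esym/lebesgue_measureN.
transitivity (\int[mu]_(x in -%R @^-1` [set: R]) (h \o -%R) x).
  have Hp := @ge0_integral_pushforward _ _ (measurableTypeR R)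
    (measurableTypeR R) R -%R mN mu setT h measurableT mh.
  apply: Hp.
  by move=> x _; rewrite /h -EFinM lee_fin mulr_ge0// normal_pdf_ge0.
rewrite preimage_setT; apply: eq_integral => x _; rewrite /h /=; congr (_ * _%:E).
by rewrite !normal_pdfE ?gt_eqF// /normal_fun !subr0 sqrrN.
Qed.

Section normal_random_variable.
Context {disp : measure_display} {Omega : measurableType disp}
  (P : probability Omega R) (D : Omega -> R) (s : R).
Hypotheses (s0 : (0 < s)%R) (mD : measurable_fun setT D).
Hypothesis DE : forall B : set R, measurable B -> P (D @^-1` B) = normal_prob 0%R s B.

Let mD' : measurable_fun setT (D : Omega -> measurableTypeR R).
Proof. exact: mD. Qed.
Let D' : {mfun Omega >-> measurableTypeR R} :=
  HB.pack (D : Omega -> measurableTypeR R) (isMeasurableFun.Build _ _ _ _ _ mD').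

Let ge0E (f : R -> R) : measurable_fun setT f -> (forall x, 0 <= f x)%R ->
  \int[P]_w (f (D w))%:E = \int[normal_prob 0%R s]_x (f x)%:E.
Proof.
move=> mf f0.
transitivity (\int[distribution P D']_x (f x)%:E).
  by rewrite ge0_integral_distribution//; exact/measurable_EFinP.
by apply: eq_measure_integral => A mA _; exact: DE.
Qed.

Lemma normal_rv_moment (p : R) : (2 <= p <= 4)%R ->
  \int[P]_w (`|D w| `^ p)%:E <= (66 * s `^ p)%:E.
Proof.
move=> p24; rewrite (ge0E (f := fun x => `|x| `^ p)%R).
- exact: normal_prob_moment.
- exact: measurable_normr_powR.
- by move=> x; exact: powR_ge0.
Qed.

Lemma normal_rv_integrable : P.-integrable setT (EFin \o D).
Proof.
apply/integrableP; split; first exact/measurable_EFinP.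
apply: (@le_lt_trans _ _ (\int[P]_w (1 + `|D w| `^ 2)%:E)).
  apply: ge0_le_integral => //.
  - by apply: measurableT_comp => //; exact/measurable_EFinP.
  - apply/measurable_EFinP; apply: measurable_funD => //.
    exact: measurable_normr_powR.
  - move=> x _; rewrite /= lee_fin (powR_mulrn 2)//.
    have := sqr_ge0 (`|D x| - 1)%R; have := normr_ge0 (D x).
    by move: (`|D x|)%R => y; rewrite sqrrB !expr2; lra.
under eq_integral do rewrite EFinD.
rewrite ge0_integralD//; last first.
- apply/measurable_EFinP.
  exact: measurable_normr_powR.
rewrite integral_cst// mul1e lte_add_pinfty//.
  by rewrite (le_lt_trans (probability_le1 _ _))// ltry.
by rewrite (le_lt_trans (normal_rv_moment _)) ?ltry//; apply/andP; split; lra.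
Qed.

Lemma normal_rv_mean0 : \int[P]_w (D w)%:E = 0.
Proof.
have iD := normal_rv_integrable.
rewrite integralE.
have mmax : measurable_fun setT (fun x : R => Num.max x 0%R).
  exact: measurable_maxr.
have mmaxN : measurable_fun setT (fun x : R => Num.max (- x)%R 0%R).
  by apply: measurable_maxr => //; exact: oppr_measurable.
have -> : \int[P]_w (fun w => (D w)%:E)^\+ w = \int[normal_prob 0%R s]_x (Num.max x 0%R)%:E.
  rewrite -(ge0E (f := fun x => Num.max x 0%R))//; last first.
    by move=> x; rewrite le_max lexx orbT.
  by apply: eq_integral => w _; rewrite funeposE EFin_max.
have -> : \int[P]_w (fun w => (D w)%:E)^\- w = \int[normal_prob 0%R s]_x (Num.max x 0%R)%:E.
  rewrite (normal_prob_symmetric (f := fun x => Num.max x 0%R))//; last first.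
    by move=> x; rewrite le_max lexx orbT.
  rewrite -(ge0E (f := fun x => Num.max (- x)%R 0%R))//; last by move=> x; rewrite le_max lexx orbT.
  by apply: eq_integral => w _; rewrite funenegE EFin_max.
rewrite subee// -(ge0E (f := fun x => Num.max x 0%R))//; last first.
    by move=> x; rewrite le_max lexx orbT.
have -> : \int[P]_w (Num.max (D w) 0%R)%:E = \int[P]_w ((EFin \o D)^\+ w).
  by apply: eq_integral => w _; rewrite funeposE EFin_max.
by apply: integrable_fin_num => //; exact: integrable_funepos.
Qed.

End normal_random_variable.
End normal_moments.

(** * Adapted variables and Brownian increments *)

Section smeasurable_theory.
Set Implicit Arguments.
Unset Strict Implicit.
Context {R : realType} {disp : measure_display} {Omega : measurableType disp}.
Variables (G : set (set Omega)) (sG : sigma_algebra setT G).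
Implicit Types U V : Omega -> R.

(** Membership in [G] becomes measurability on the type generated by [G], which gives adapted
    variables the closure properties of measurable functions. *)
Lemma smeasurableP U :
  smeasurable G U <-> measurable_fun setT (U : g_sigma_algebraType G -> R).
Proof.
split=> [h _ B mB|h B mB].
  rewrite setTI; change ((<<s G >>) (U @^-1` B)).
  by rewrite sigma_algebra_id//; exact: h.
have := h measurableT B mB; rewrite setTI => hB.
have : (<<s G >>) (U @^-1` B) by exact: hB.
by rewrite sigma_algebra_id.
Qed.

Lemma smeasurable_measurable U : G `<=` measurable -> smeasurable G U ->
  measurable_fun setT U.
Proof. by move=> GM h _ B mB; rewrite setTI; apply: GM; exact: h. Qed.

Lemma smeasurableS (H : set (set Omega)) U : G `<=` H -> smeasurable G U ->
  smeasurable H U.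
Proof. by move=> GH h B mB; apply: GH; exact: h. Qed.

Lemma smeasurable_cst (c : R) : smeasurable G (fun _ => c).
Proof. by apply/smeasurableP; exact: measurable_cst. Qed.

Lemma smeasurable_comp (f : R -> R) U : measurable_fun setT f ->
  smeasurable G U -> smeasurable G (fun w => f (U w)).
Proof. by move=> mf /smeasurableP mU; apply/smeasurableP; exact: measurableT_comp. Qed.

Lemma smeasurableD U V : smeasurable G U -> smeasurable G V ->
  smeasurable G (fun w => U w + V w).
Proof.
by move=> /smeasurableP mU /smeasurableP mV; apply/smeasurableP; exact: measurable_funD.
Qed.

Lemma smeasurableB U V : smeasurable G U -> smeasurable G V ->
  smeasurable G (fun w => U w - V w).
Proof.
by move=> /smeasurableP mU /smeasurableP mV; apply/smeasurableP; exact: measurable_funB.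
Qed.

Lemma smeasurableM U V : smeasurable G U -> smeasurable G V ->
  smeasurable G (fun w => U w * V w).
Proof.
by move=> /smeasurableP mU /smeasurableP mV; apply/smeasurableP; exact: measurable_funM.
Qed.

Lemma smeasurable_normr_powR U (p : R) : smeasurable G U ->
  smeasurable G (fun w => `|U w| `^ p).
Proof. by move=> /smeasurableP mU; apply/smeasurableP; exact: measurable_normr_powR. Qed.

Lemma smeasurable_indic (A : set Omega) : G A -> smeasurable G (\1_A : Omega -> R).
Proof.
move=> GA; apply/smeasurableP; apply: measurable_indic.
exact: sub_sigma_algebra.
Qed.

End smeasurable_theory.

Section ge0_real_integrals.
Set Implicit Arguments.
Unset Strict Implicit.
Context {R : realType} {disp : measure_display} {Omega : measurableType disp}
  (P : {measure set Omega -> \bar R}).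
Implicit Types U V : Omega -> R.
Local Open Scope ereal_scope.

Lemma powRB1M_le (x y p : R) : (0 <= x)%R -> (0 <= y)%R -> (1 <= p)%R ->
  (x `^ (p - 1) * y <= x `^ p + y `^ p)%R.
Proof.
move=> x0 y0 p1.
have p0 : (0 < p)%R by lra.
have [xy|/ltW yx] := leP x y.
  apply: (@le_trans _ _ (y `^ p)%R); last by rewrite lerDr powR_ge0.
  rewrite -(mulr_powRB1 y0 p0) [X in (_ <= X)%R]mulrC ler_wpM2r//.
  by apply: ge0_ler_powR; rewrite ?nnegrE// subr_ge0.
apply: (@le_trans _ _ (x `^ p)%R); last by rewrite lerDl powR_ge0.
by rewrite -(mulr_powRB1 x0 p0) [X in (_ <= X)%R]mulrC ler_wpM2l ?powR_ge0.
Qed.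

Lemma ge0_le_integralR U V : measurable_fun setT U -> measurable_fun setT V ->
  (forall w, 0 <= U w)%R -> (forall w, U w <= V w)%R ->
  \int[P]_w (U w)%:E <= \int[P]_w (V w)%:E.
Proof.
move=> mU mV U0 UV; apply: ge0_le_integral => //.
- by move=> w _; rewrite lee_fin.
- exact/measurable_EFinP.
- exact/measurable_EFinP.
- by move=> w _; rewrite lee_fin.
Qed.

Lemma ge0_integralZlR (c : R) U : measurable_fun setT U -> (forall w, 0 <= U w)%R ->
  (0 <= c)%R -> \int[P]_w (c * U w)%:E = c%:E * \int[P]_w (U w)%:E.
Proof.
move=> mU U0 c0; under eq_integral do rewrite EFinM.
rewrite ge0_integralZl//; first exact/measurable_EFinP.
by move=> w _; rewrite lee_fin.
Qed.

Lemma ge0_integralDR U V : measurable_fun setT U -> measurable_fun setT V ->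
  (forall w, 0 <= U w)%R -> (forall w, 0 <= V w)%R ->
  \int[P]_w (U w + V w)%:E = \int[P]_w (U w)%:E + \int[P]_w (V w)%:E.
Proof.
move=> mU mV U0 V0; under eq_integral do rewrite EFinD.
rewrite ge0_integralD//; first by move=> w _; rewrite lee_fin.
- exact/measurable_EFinP.
- by move=> w _; rewrite lee_fin.
- exact/measurable_EFinP.
Qed.

Lemma ge0_integrableR U : measurable_fun setT U -> (forall w, 0 <= U w)%R ->
  \int[P]_w (U w)%:E < +oo -> P.-integrable setT (EFin \o U).
Proof.
move=> mU U0 h; apply/integrableP; split; first exact/measurable_EFinP.
by under eq_integral do rewrite /= ger0_norm//.
Qed.

Lemma le_integrableR U V : measurable_fun setT U ->
  (forall w, `|U w| <= V w)%R ->
  P.-integrable setT (EFin \o V) -> P.-integrable setT (EFin \o U).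
Proof.
move=> mU UV iV; apply: (le_integrable measurableT _ _ iV).
  exact/measurable_EFinP.
move=> w _ /=; rewrite lee_fin; apply: (le_trans (UV w)); exact: ler_norm.
Qed.

End ge0_real_integrals.

(** * Moments over a single Brownian step *)

Section brownian_step.
Set Implicit Arguments.
Unset Strict Implicit.
Context {R : realType} {disp : measure_display} {Omega : measurableType disp}
  (P : probability Omega R) (T : R) (F : R -> set (set Omega))
  (hF : usual_filtration P T F) (W : R -> Omega -> R)
  (hW : brownian_motion P T F W).
Local Open Scope ereal_scope.

(** No root is taken, so that moments add up over time steps; the extended value spares
    integrability conditions. *)
Definition moment (p : R) (U : Omega -> R) : \bar R := \int[P]_w (`|U w| `^ p)%:E.

Lemma moment_ge0 p U : 0 <= moment p U.
Proof. by apply: integral_ge0 => w _; rewrite lee_fin powR_ge0. Qed.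

(** 66 bounds the Gaussian moments, and [80 = 2 * 40]: the remainder of [powR_taylor2] has weight
    40, and [xi] enters it twice, through the Young term and through [|b|^p]. *)
Definition cstep : R := (80 * 66)%R.

Lemma cstep_gt0 : (0 < cstep)%R. Proof. by rewrite /cstep mulr_gt0. Qed.

Lemma adapted_measurable (t : R) (U : Omega -> R) : (0 <= t <= T)%R -> smeasurable (F t) U ->
  measurable_fun setT U.
Proof. by move=> tT; apply: smeasurable_measurable; exact: (filtration_sub hF). Qed.

Variables (s t : R).
Hypotheses (s0 : (0 <= s)%R) (st : (s < t)%R) (tT : (t <= T)%R).
Let sT : (0 <= s <= T)%R. Proof. by rewrite s0 (le_trans (ltW st)). Qed.
Let t0T : (0 <= t <= T)%R. Proof. by rewrite tT (le_trans s0 (ltW st)). Qed.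
Let D w := (W t w - W s w)%R.
Let sF := filtration_sigma hF sT.

Let mD : measurable_fun setT D.
Proof.
apply: measurable_funB; apply: adapted_measurable; [exact: t0T|exact: (bm_adapted hW)|
 exact: sT|exact: (bm_adapted hW)].
Qed.

Let sd := Num.sqrt (t - s).
Let sd0 : (0 < sd)%R. Proof. by rewrite sqrtr_gt0 subr_gt0. Qed.

Let DE (B : set R) : measurable B -> P (D @^-1` B) = normal_prob 0%R sd B.
Proof. exact: (bm_normal hW). Qed.

Let indepD U : smeasurable (F s) U -> indep_rv P U D.
Proof. by move=> mU A B mA mB; apply: (bm_indep hW) => //; exact: mU. Qed.

Let iD := normal_rv_integrable sd0 mD DE.
Let D0 := normal_rv_mean0 sd0 mD DE.
Let Dp := normal_rv_moment sd0 mD DE.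

Lemma brownian_step_mean0 U : smeasurable (F s) U ->
  P.-integrable setT (EFin \o U) ->
  P.-integrable setT (fun w => (U w * D w)%:E) /\
  \int[P]_w (U w * D w)%:E = 0.
Proof.
move=> mU iU; have mU' := adapted_measurable sT mU; split.
  exact: (indep_integrableM mU' mD (indepD mU)).
by rewrite (indep_integralM mU' mD (indepD mU))// D0 mule0.
Qed.

Lemma brownian_step_momentM U p : smeasurable (F s) U -> (2 <= p <= 4)%R ->
  \int[P]_w (`|U w| * `|D w| `^ p)%:E <=
  (66 * (t - s) `^ (p / 2))%:E * \int[P]_w (`|U w|)%:E.
Proof.
move=> mU p24; have mU' := adapted_measurable sT mU.
rewrite (indep_ge0_integralM mU' mD (indepD mU) (phi := Num.norm)
  (psi := fun x => `|x| `^ p)%R)//; last first.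
  exact: (@measurable_normr_powR R _ _ (fun x : R => x) p (@measurable_id _ _ setT)).
rewrite muleC lee_wpmul2r//; first by apply: integral_ge0 => w _; rewrite lee_fin.
apply: (le_trans (Dp p24)); rewrite lee_fin /sd -powR12_sqrt ?subr_ge0 ?(ltW st)//.
by rewrite -powRrM [(2^-1 * _)%R]mulrC.
Qed.

(** One step of the discrete Gronwall argument. The linear term has mean zero by independence;
    [powR_young] with the horizon [h] splits the mixed term, and [t - s <= h] brings the pure power
    of the increment to the same form. *)
Lemma brownian_step_moment (p h : R) (U xi : Omega -> R) :
  (2 <= p <= 4)%R -> (t - s <= h)%R ->
  smeasurable (F s) U -> smeasurable (F s) xi ->
  moment p (fun w => U w + xi w * D w)%R <=
  (1 + cstep * (t - s) / h)%:E * moment p U +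
  (cstep * (t - s) * h `^ (p / 2 - 1))%:E * moment p xi.
Proof.
move=> p24 tsh mU mxi.
have [p2 p4] : (2 <= p /\ p <= 4)%R by move/andP: p24.
have p1 : (1 <= p)%R by lra.
have ts0 : (0 < t - s)%R by rewrite subr_gt0.
have h0 : (0 < h)%R by lra.
have H0 : (0 < h `^ (p / 2 - 1))%R by rewrite powR_gt0.
have c1 : (0 < 1 + cstep * (t - s) / h)%R.
  by rewrite addr_gt0// divr_gt0// mulr_gt0// cstep_gt0.
have c2 : (0 < cstep * (t - s) * h `^ (p / 2 - 1))%R by rewrite !mulr_gt0// cstep_gt0.
(* An infinite moment makes the right-hand side infinite, because both coefficients are positive and
   the other summand is nonnegative. *)
have [Uoo|Ufin] := eqVneq (moment p U) +oo.
  rewrite Uoo gt0_muley ?lte_fin// addye ?leey//.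
  by rewrite -ltNye (lt_le_trans ltNy0)// mule_ge0// ?moment_ge0// lee_fin ltW.
have [xoo|xfin] := eqVneq (moment p xi) +oo.
  rewrite xoo gt0_muley ?lte_fin// addey ?leey//.
  by rewrite -ltNye (lt_le_trans ltNy0)// mule_ge0// ?moment_ge0// lee_fin ltW.
have mU' := adapted_measurable sT mU; have mxi' := adapted_measurable sT mxi.
have EU : moment p U \is a fin_num.
  by case: (moment p U) (moment_ge0 p U) Ufin.
have Ex : moment p xi \is a fin_num.
  by case: (moment p xi) (moment_ge0 p xi) xfin.
set V := fun w => (`|U w| `^ (p - 2) * `|xi w| ^+ 2)%R.
have sV : smeasurable (F s) V.
  apply: smeasurableM => //; first exact: smeasurable_normr_powR.
  apply: (smeasurable_comp sF (f := fun x : R => `|x| ^+ 2)%R) => //.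
  by apply: measurable_funX; exact: normr_measurable.
have mV := adapted_measurable sT sV.
have V0 w : (0 <= V w)%R by rewrite mulr_ge0 ?powR_ge0 ?sqr_ge0.
have mmom (Y : Omega -> R) : measurable_fun setT Y ->
    measurable_fun setT (fun w => (`|Y w| `^ p)%:E).
  by move=> mY; apply/measurable_EFinP; exact: measurable_normr_powR.
have EV : \int[P]_w (V w)%:E <= h^-1%:E * moment p U + (h `^ (p / 2 - 1))%:E * moment p xi.
  have mU1 := measurable_normr_powR p mU'; have mx1 := measurable_normr_powR p mxi'.
  rewrite /moment -!ge0_integralZlR//; try by [rewrite ?invr_ge0 ltW|move=> w; exact: powR_ge0].
  rewrite -ge0_integralDR//; last 4 first.
  - exact: measurable_funM.
  - exact: measurable_funM.
  - by move=> w; rewrite mulr_ge0 ?powR_ge0// invr_ge0 ltW.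
  - by move=> w; rewrite mulr_ge0 ?powR_ge0// ltW.
  apply: ge0_le_integralR => //.
  - by apply: measurable_funD; exact: measurable_funM.
  - by move=> w; rewrite [(h^-1 * _)%R]mulrC; exact: powR_young.
set A := fun w => (`|U w| `^ p)%R.
set B := fun w => (p * (U w * `|U w| `^ (p - 2) * xi w) * D w)%R.
set C1 := fun w => (V w * `|D w| `^ 2)%R.
set C2 := fun w => (`|xi w| `^ p * `|D w| `^ p)%R.
have mA : measurable_fun setT A by exact: measurable_normr_powR.
have mC1 : measurable_fun setT C1.
  by apply: measurable_funM => //; exact: measurable_normr_powR.
have mC2 : measurable_fun setT C2.
  by apply: measurable_funM; exact: measurable_normr_powR.
have EVfin : \int[P]_w (V w)%:E < +oo.
  by apply: (le_lt_trans EV); rewrite -(fineK EU) -(fineK Ex) ltry.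
have EC1 : \int[P]_w (C1 w)%:E <= (66 * (t - s))%:E * \int[P]_w (V w)%:E.
  have := brownian_step_momentM (p := 2%R) sV.
  have -> : (2 / 2 = 1 :> R)%R by lra.
  rewrite powRr1 ?(ltW ts0)//.
  under eq_integral do rewrite ger0_norm//.
  under [in X in _ -> X]eq_integral do rewrite /C1.
  under [X in _ <= _ * X]eq_integral do rewrite ger0_norm//.
  by apply; apply/andP; split; lra.
have EC2 : \int[P]_w (C2 w)%:E <= (66 * (t - s) `^ (p / 2))%:E * moment p xi.
  have sx : smeasurable (F s) (fun w => `|xi w| `^ p)%R by exact: smeasurable_normr_powR.
  have := brownian_step_momentM (p := p) sx p24.
  under eq_integral do rewrite ger0_norm ?powR_ge0//.
  by under [X in _ <= _ * X]eq_integral do rewrite ger0_norm ?powR_ge0//.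
have EC1fin : \int[P]_w (C1 w)%:E < +oo.
  apply: (le_lt_trans EC1); rewrite lte_mul_pinfty//; last 1 first.
  - by rewrite lee_fin mulr_ge0// ltW.
have EC2fin : \int[P]_w (C2 w)%:E < +oo.
  by apply: (le_lt_trans EC2); rewrite -(fineK Ex) ltry.
have C10 w : (0 <= C1 w)%R by rewrite mulr_ge0 ?powR_ge0.
have C20 w : (0 <= C2 w)%R by rewrite mulr_ge0 ?powR_ge0.
have A0 w : (0 <= A w)%R by rewrite powR_ge0.
have iA : P.-integrable setT (EFin \o A).
  apply: (ge0_integrableR mA A0); rewrite -[X in X < _]/(moment p U) ltey; exact: Ufin.
have iX : P.-integrable setT (EFin \o (fun w => `|xi w| `^ p)%R).
  apply: ge0_integrableR; [exact: measurable_normr_powR|by move=> w; exact: powR_ge0|].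
  rewrite -[X in X < _]/(moment p xi) ltey; exact: xfin.
(* The multiplier of the increment in the linear term is known at time [s]; it is integrable because
   [|U|^(p-1) |xi| <= |U|^p + |xi|^p]. *)
set B0 := fun w => (p * (U w * `|U w| `^ (p - 2) * xi w))%R.
have sB0 : smeasurable (F s) B0.
  apply: smeasurableM => //; first exact: smeasurable_cst.
  apply: smeasurableM => //; apply: smeasurableM => //; exact: smeasurable_normr_powR.
have iB0 : P.-integrable setT (EFin \o B0).
  apply: (le_integrableR (V := fun w => p * (`|U w| `^ p + `|xi w| `^ p))%R).
  - exact: adapted_measurable sT sB0.
  - move=> w; rewrite /B0 !normrM ger0_norm; last lra.
    rewrite ler_wpM2l//; first lra.
    rewrite (ger0_norm (powR_ge0 _ _)).
    have -> : (p - 2 = (p - 1) - 1)%R by ring.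
    rewrite mulr_powRB1//.
      exact: powRB1M_le.
    by rewrite subr_gt0 (lt_le_trans _ p2)// ltr1n.
  - apply: (eq_integrable _ (fun w => p%:E * ((`|U w| `^ p)%:E + (`|xi w| `^ p)%:E))) => //.
    by apply: integrableZl => //; exact: integrableD.
have [iB EB] := brownian_step_mean0 sB0 iB0.
set C := fun w => (40 * (C1 w + C2 w))%R.
have iC : P.-integrable setT (EFin \o C).
  apply: ge0_integrableR.
  - by apply: measurable_funM => //; exact: measurable_funD.
  - by move=> w; rewrite mulr_ge0// addr_ge0.
  rewrite ge0_integralZlR//; [|exact: measurable_funD|by move=> w; rewrite addr_ge0].
  by rewrite ge0_integralDR// lte_mul_pinfty// lte_add_pinfty.
have pw w : (`|U w + xi w * D w| `^ p <= A w + B w + C w)%R.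
  apply: (le_trans (powR_taylor2 (U w) (xi w * D w) p24)).
  rewrite /A /B /C /C1 /C2 /V normrM powRM// (powR_mulrn 2)// !real_normK ?num_real//.
  by rewrite exprMn !mulrA.
have -> : moment p (fun w => (U w + xi w * D w)%R) = \int[P]_w (`|U w + xi w * D w| `^ p)%:E by [].
apply: (@le_trans _ _ (\int[P]_w (A w + B w + C w)%:E)).
  apply: ge0_le_integralR => //.
  - apply: measurable_normr_powR; apply: measurable_funD => //.
    exact: measurable_funM.
  - apply: measurable_funD; last first.
      by apply: measurable_funM => //; exact: measurable_funD.
    apply: measurable_funD => //; apply: measurable_funM => //.
    exact: adapted_measurable sT sB0.
have -> : \int[P]_w (A w + B w + C w)%:E =
    \int[P]_w (A w)%:E + \int[P]_w (B w)%:E + \int[P]_w (C w)%:E.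
  under eq_integral do rewrite EFinD.
  rewrite integralD//; last by under eq_fun do rewrite EFinD; exact: integrableD.
  by under eq_integral do rewrite EFinD; rewrite integralD.
have -> : \int[P]_w (B w)%:E = 0 by exact: EB.
rewrite adde0 ge0_integralZlR//; [|exact: measurable_funD|by move=> w; rewrite addr_ge0].
rewrite ge0_integralDR//.
move: EC1 EC2 EV; rewrite -[\int[P]_w (A w)%:E]/(moment p U) -(fineK EU) -(fineK Ex).
have f1 : \int[P]_w (V w)%:E \is a fin_num.
  by rewrite ge0_fin_numE//; apply: integral_ge0 => w _; rewrite lee_fin.
have f2 : \int[P]_w (C1 w)%:E \is a fin_num.
  by rewrite ge0_fin_numE//; apply: integral_ge0 => w _; rewrite lee_fin.
have f3 : \int[P]_w (C2 w)%:E \is a fin_num.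
  by rewrite ge0_fin_numE//; apply: integral_ge0 => w _; rewrite lee_fin.
have u0 : (0 <= fine (moment p U))%R by rewrite fine_ge0// moment_ge0.
have x0 : (0 <= fine (moment p xi))%R by rewrite fine_ge0// moment_ge0.
have dH : ((t - s) `^ (p / 2) <= (t - s) * h `^ (p / 2 - 1))%R.
  rewrite -mulr_powRB1 ?(ltW ts0)//; last by rewrite divr_gt0// (lt_le_trans _ p2).
  rewrite ler_wpM2l ?(ltW ts0)//; apply: ge0_ler_powR.
  - by rewrite subr_ge0 ler_pdivlMr// mul1r.
  - by rewrite nnegrE ltW.
  - by rewrite nnegrE ltW.
  - exact: tsh.
move: f1 f2 f3 u0 x0 H0 ts0 h0 dH.
move: (\int[P]_w (V w)%:E) (\int[P]_w (C1 w)%:E) (\int[P]_w (C2 w)%:E).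
move: (fine (moment p U)) (fine (moment p xi)) (h `^ (p / 2 - 1))%R
  ((t - s) `^ (p / 2))%R (t - s)%R.
move=> u x H E d [v||] [k||] [l||] // _ _ _ u0 x0 H0 d0 h0 dH.
rewrite -!(EFinM, EFinD) !lee_fin => k1 l1 v1.
have k2 : (k <= 66 * d * (h^-1 * u + H * x))%R.
  by apply: (le_trans k1); rewrite ler_wpM2l// mulr_ge0// ltW.
have l2 : (l <= 66 * (d * H) * x)%R.
  by apply: (le_trans l1); rewrite ler_wpM2r// ler_wpM2l.
have du0 : (0 <= d * (h^-1 * u))%R.
  by rewrite !mulr_ge0// ?invr_ge0 ltW.
apply: (@le_trans _ _ (u + 40 * (66 * d * (h^-1 * u + H * x) + 66 * (d * H) * x))%R).
  by rewrite lerD2l ler_wpM2l// lerD.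
rewrite /cstep -subr_ge0.
set lhs := (X in (0 <= X)%R).
have -> : (lhs = 40 * 66 * (d * (h^-1 * u)))%R by rewrite /lhs; ring.
by rewrite mulr_ge0// mulr_ge0.
Qed.
End brownian_step.

(** * Elementary stochastic integrals *)

Lemma measurable_lt_set d (T : measurableType d) (R : realType) (U : T -> R) (r : R) :
  measurable_fun setT U -> measurable [set w | r < U w].
Proof.
move=> mU; have := mU measurableT [set x | r < x].
rewrite setTI; apply; rewrite -set_itvoy; exact: measurable_itv.
Qed.

Section elementary_integral.
Set Implicit Arguments.
Unset Strict Implicit.
Context {R : realType} {disp : measure_display} {Omega : measurableType disp}
  (P : probability Omega R) (T : R) (F : R -> set (set Omega))
  (hF : usual_filtration P T F) (W : R -> Omega -> R)
  (hW : brownian_motion P T F W).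
Variable (a : R).
Hypotheses (a0 : 0 <= a) (aT : a <= T).

(* [M] is the elementary integral over [[a, t]] of a step process with values
   [xi_k], and [Q p] is the Lebesgue integral of its [p]-th power. *)
Inductive elem_int : R -> (Omega -> R) -> (R -> Omega -> R) -> Prop :=
| elem_int0 : elem_int a (fun _ => 0) (fun _ _ => 0)
| elem_intS : forall (t t' : R) M Q (xi : Omega -> R),
    elem_int t M Q -> t <= t' -> t' <= T -> smeasurable (F t) xi ->
    elem_int t' (fun w => M w + xi w * (W t' w - W t w))
      (fun p w => Q p w + `|xi w| `^ p * (t' - t)).

Lemma elem_int_itv t M Q : elem_int t M Q -> a <= t <= T.
Proof.
elim => [|s t' {}M {}Q xi _ /andP[h1 h2] h3 h4 _]; first by rewrite lexx.
by rewrite h4 (le_trans h1).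
Qed.

Lemma elem_int_itv0 t M Q : elem_int t M Q -> 0 <= t <= T.
Proof. by move=> /elem_int_itv /andP[h1 ->]; rewrite (le_trans a0). Qed.

Lemma elem_int_adapted t M Q : elem_int t M Q ->
  smeasurable (F t) M /\ forall p, smeasurable (F t) (Q p).
Proof.
have aaT : 0 <= a <= T by rewrite a0.
elim => [|s t' {}M {}Q xi h [mM mQ] h3 h4 mxi].
  by split=> [|p]; apply: smeasurable_cst; exact: (filtration_sigma hF aaT).
have /andP[s0 sT] := elem_int_itv0 h.
have t'T : 0 <= t' <= T by rewrite h4 (le_trans s0).
have sF := filtration_sigma hF t'T.
have up U : smeasurable (F s) U -> smeasurable (F t') U.
  by apply: smeasurableS; exact: (filtration_mono hF).
have adW := bm_adapted hW.
split=> [|p].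
  apply: smeasurableD => //; first exact: up.
  apply: smeasurableM => //; first exact: up.
  apply: smeasurableB => //; first exact: adW.
  by apply: up; apply: adW; rewrite s0.
apply: smeasurableD => //; first exact: up.
apply: smeasurableM => //; first by apply: up; apply: smeasurable_normr_powR => //; apply: (filtration_sigma hF); rewrite s0.
exact: smeasurable_cst.
Qed.

Lemma elem_int_measurable t M Q : elem_int t M Q ->
  measurable_fun setT M /\ forall p, measurable_fun setT (Q p).
Proof.
move=> h; have [mM mQ] := elem_int_adapted h; have tT := elem_int_itv0 h.
by split=> [|p]; apply: (adapted_measurable hF tT).
Qed.

Lemma elem_int_Q_ge0 t M Q : elem_int t M Q -> forall p w, 0 <= Q p w.
Proof.
elim => [//|s t' {}M {}Q xi h ih h3 h4 mxi p w].
by rewrite addr_ge0// mulr_ge0 ?powR_ge0// subr_ge0.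
Qed.

(** The factors [1 + cstep (t' - s) / h] are bounded by exponentials, whose product telescopes to
    [exp (cstep (t - a) / h)]. As this factor is at least 1, it also covers the term added by the
    last step. *)
Lemma elem_int_moment t M Q (p h : R) : 2 <= p <= 4 -> 0 < h ->
  elem_int t M Q -> t - a <= h ->
  (moment P p M <= (expR (cstep * (t - a) / h) * (cstep * h `^ (p / 2 - 1)))%:E *
     \int[P]_w (Q p w)%:E)%E.
Proof.
move=> p24 h0; have [p2 p4] := andP p24.
have H0 : 0 <= h `^ (p / 2 - 1) by rewrite powR_ge0.
have c0 : 0 <= cstep :> R by rewrite ltW// cstep_gt0.
elim => [_|s t' {}M {}Q xi hE ih h3 h4 mxi hh].
  rewrite /moment (eq_integral (fun=> 0%E)) => [|w _].
    by rewrite !integral0 mule0.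
  by rewrite normr0 powR0//; apply/eqP; lra.
have /andP[s0 sT] := elem_int_itv0 hE.
have /andP[as_ _] := elem_int_itv hE.
have {}ih : (moment P p M <= (expR (cstep * (s - a) / h) * (cstep * h `^ (p / 2 - 1)))%:E *
     \int[P]_w (Q p w)%:E)%E by apply: ih; lra.
have [mM mQ] := elem_int_adapted hE.
have [mM' mQ'] := elem_int_measurable hE.
have sF : 0 <= s <= T by rewrite s0.
have mxi' := adapted_measurable hF sF mxi.
have Q0 := elem_int_Q_ge0 hE.
have [st|t's] := ltP s t'; last first.
  have -> : t' = s by apply/eqP; rewrite eq_le t's h3.
  rewrite [X in moment P p X](_ : _ = M); last first.
    by apply/funext => w; rewrite subrr mulr0 addr0.
  rewrite [X in (_ * X)%E](_ : _ = \int[P]_w (Q p w)%:E)%E//.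
  by apply: eq_integral => w _; rewrite subrr mulr0 addr0.
have tsh : t' - s <= h by lra.
have H1 := brownian_step_moment hF hW s0 st h4 p24 tsh mM mxi.
apply: (le_trans H1).
have d0 : 0 <= t' - s by lra.
rewrite ge0_integralDR; [|exact: mQ'| |exact: Q0|by move=> w; rewrite mulr_ge0// powR_ge0];
  last by apply: measurable_funM => //; exact: measurable_normr_powR.
have -> : (\int[P]_w (`|xi w| `^ p * (t' - s))%:E = (t' - s)%:E * moment P p xi)%E.
  rewrite /moment -ge0_integralZlR; [|exact: measurable_normr_powR|by move=> w; exact: powR_ge0|lra].
  by apply: eq_integral => w _; rewrite mulrC.
have q0 : (0 <= \int[P]_w (Q p w)%:E)%E by apply: integral_ge0 => w _; rewrite lee_fin.
have x0 := moment_ge0 P p xi.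
have y0 : (0 <= (t' - s)%:E * moment P p xi)%E by rewrite mule_ge0// lee_fin.
rewrite (ge0_muleDr _ q0 y0).
set H := h `^ (p / 2 - 1) in H0 ih *.
have e1 : 1 + cstep * (t' - s) / h <= expR (cstep * (t' - s) / h) by exact: expR_ge1Dx.
have e2 : 1 <= expR (cstep * (t' - a) / h).
  apply: (le_trans _ (expR_ge1Dx _)); rewrite lerDl divr_ge0 ?(ltW h0)// mulr_ge0//; lra.
have e3 : expR (cstep * (t' - a) / h) = expR (cstep * (t' - s) / h) * expR (cstep * (s - a) / h).
  by rewrite -expRD; congr expR; ring.
apply: leeD.
  apply: (@le_trans _ _ ((expR (cstep * (t' - s) / h))%:E * moment P p M)%E).
    by apply: lee_wpmul2r; [exact: moment_ge0|rewrite lee_fin].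
  rewrite e3 -[(_ * _ * (cstep * H))]mulrA EFinM -muleA; apply: lee_wpmul2l => //.
rewrite muleA -EFinM; apply: lee_wpmul2r => //.
rewrite lee_fin; have dH : 0 <= cstep * H * (t' - s) by rewrite !mulr_ge0.
rewrite [leLHS](_ : _ = 1 * (cstep * H * (t' - s))); last by ring.
by rewrite [leRHS](_ : _ = expR (cstep * (t' - a) / h) * (cstep * H * (t' - s))) ?ler_wpM2r//; ring.
Qed.

Lemma moment2_integrable (U : Omega -> R) : measurable_fun setT U ->
  (moment P 2 U < +oo)%E -> P.-integrable setT (EFin \o U).
Proof.
move=> mU hU; apply: (le_integrableR (V := fun w => 1 + `|U w| `^ 2)) => //.
  move=> w; rewrite (powR_mulrn 2)//; have := normr_ge0 (U w).
  by have := sqr_ge0 (`|U w| - 1); move: (`|U w|) => y; rewrite sqrrB !expr2; lra.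
apply: (eq_integrable _ (fun w => 1%:E + (`|U w| `^ 2)%:E)%E) => //.
apply: integrableD => //.
  exact: finite_measure_integrable_cst.
by apply: ge0_integrableR => //; exact: measurable_normr_powR.
Qed.

(** Each step contributes [1_A xi] times an increment, and [1_A xi] is known at the start of the
    step because [F a] is contained in [F s]. *)
Lemma elem_int_mean0 t M Q A : elem_int t M Q -> F a A ->
  (\int[P]_w (Q 2 w)%:E < +oo)%E ->
  P.-integrable setT (EFin \o M) /\ (\int[P]_w (\1_A w * M w)%:E = 0)%E.
Proof.
move=> + FA; have aaT : 0 <= a <= T by rewrite a0.
have mA : measurable A by exact: (filtration_sub hF aaT).
elim => [_|s t' {}M {}Q xi hE ih h3 h4 mxi fQ].
  split; first exact: integrable0.
  by rewrite (eq_integral (fun=> 0%E)) ?integral0// => w _; rewrite mulr0.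
have /andP[s0 sT] := elem_int_itv0 hE.
have /andP[as_ _] := elem_int_itv hE.
have [mM mQ] := elem_int_adapted hE.
have [mM' mQ'] := elem_int_measurable hE.
have sF : 0 <= s <= T by rewrite s0.
have mxi' := adapted_measurable hF sF mxi.
have Q0 := elem_int_Q_ge0 hE.
have d0 : 0 <= t' - s by rewrite subr_ge0.
move: fQ; rewrite ge0_integralDR; [|exact: mQ'| |exact: Q0|by move=> w; rewrite mulr_ge0// powR_ge0];
  last by apply: measurable_funM => //; exact: measurable_normr_powR.
have -> : (\int[P]_w (`|xi w| `^ 2 * (t' - s))%:E = (t' - s)%:E * moment P 2 xi)%E.
  rewrite /moment -ge0_integralZlR; [|exact: measurable_normr_powR|by move=> w; exact: powR_ge0|lra].
  by apply: eq_integral => w _; rewrite mulrC.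
have q0 : (0 <= \int[P]_w (Q 2 w)%:E)%E by apply: integral_ge0 => w _; rewrite lee_fin.
have x0 := moment_ge0 P 2 xi.
move=> fQ.
have /ih[iM EM] : (\int[P]_w (Q 2 w)%:E < +oo)%E.
  by apply: le_lt_trans fQ; rewrite leeDl// mule_ge0// lee_fin.
(* A step of length zero adds nothing to [Q], hence says nothing about the integrability of [xi]; it
   adds nothing to the sum either. *)
have [st|t's] := ltP s t'; last first.
  have -> : t' = s by apply/eqP; rewrite eq_le t's h3.
  split; first by apply: (eq_integrable _ (EFin \o M)) => // w _; rewrite /= subrr mulr0 addr0.
  by rewrite -EM; apply: eq_integral => w _; rewrite subrr mulr0 addr0.
have fx : (moment P 2 xi < +oo)%E.
  rewrite ltey; apply/eqP => xoo; move: fQ.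
  rewrite xoo gt0_muley ?lte_fin ?subr_gt0// addey ?ltxx//.
  by rewrite -ltNye (lt_le_trans ltNy0).
have ix := moment2_integrable mxi' fx.
set D := fun w => W t' w - W s w.
have [iD _] := brownian_step_mean0 hF hW s0 st h4 mxi ix.
have m1 : smeasurable (F s) (fun w => \1_A w * xi w).
  have sF' := filtration_sigma hF sF.
  apply: smeasurableM => //; apply: smeasurable_indic => //.
  exact: (filtration_mono hF a0 as_ sT).
have i1 : P.-integrable setT (EFin \o (fun w => \1_A w * xi w)).
  apply: (le_integrableR (V := fun w => `|xi w|)).
  - exact: (adapted_measurable hF sF m1).
  - by move=> w; rewrite normrM indicE; case: (_ \in _); rewrite ?normr0 ?normr1 ?mul0r ?mul1r.
  - exact: integrable_norm.
have [iD1 ED1] := brownian_step_mean0 hF hW s0 st h4 m1 i1.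
split.
  by apply: (eq_integrable _ (fun w => (M w)%:E + (xi w * D w)%:E)%E) => //; exact: integrableD.
rewrite (eq_integral (fun w => (\1_A w * M w)%:E + (\1_A w * xi w * D w)%:E)%E); last first.
  by move=> w _; rewrite mulrDr EFinD mulrA.
rewrite integralD//.
- by rewrite EM add0e.
- apply: (le_integrableR (V := fun w => `|M w|)).
  + by apply: measurable_funM => //; exact: measurable_indic.
  + by move=> w; rewrite normrM indicE; case: (_ \in _); rewrite ?normr0 ?normr1 ?mul0r ?mul1r.
  + exact: integrable_norm.
Qed.

(** The integral is stopped before [Q 2] exceeds [c]. The decision is adapted: the value [G] of
    [Q 2] at the end of a step involves only [xi] and the past, both known at its start. As [Q 2] is
    nondecreasing, paths with final [Q 2 <= c] are never stopped. *)
Lemma elem_int_stop t M Q c : 0 <= c -> elem_int t M Q ->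
  exists M' Q', [/\ elem_int t M' Q', (forall w, Q' 2 w <= c) &
    forall w, Q 2 w <= c -> M' w = M w /\ Q' 2 w = Q 2 w].
Proof.
move=> c0; elim => [|s t' {}M {}Q xi hE [M' [Q' [hE' Qc' MM']]] h3 h4 mxi].
  by exists (fun=> 0), (fun _ _ => 0); split => //; exact: elem_int0.
have [_ mQ] := elem_int_adapted hE.
have sT := elem_int_itv0 hE.
have sF := filtration_sigma hF sT.
have Q0 := elem_int_Q_ge0 hE.
have d0 : 0 <= t' - s by rewrite subr_ge0.
pose G w := Q 2 w + `|xi w| `^ 2 * (t' - s).
have mG : smeasurable (F s) G.
  apply: smeasurableD => //; apply: smeasurableM => //.
    exact: smeasurable_normr_powR.
  exact: smeasurable_cst.
have GA : F s (G @^-1` [set x | x <= c]).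
  by apply: mG; rewrite -[X in measurable X]/[set` `]-oo, c]]; exact: measurable_itv.
pose xi' w := \1_(G @^-1` [set x | x <= c]) w * xi w.
have mxi' : smeasurable (F s) xi'.
  by apply: smeasurableM => //; exact: smeasurable_indic.
exists (fun w => M' w + xi' w * (W t' w - W s w)), (fun p w => Q' p w + `|xi' w| `^ p * (t' - s)).
split; first exact: elem_intS.
- move=> w; rewrite /xi' indicE; case: (boolP (w \in _)) => [|_].
    rewrite inE /= /G => Gc; rewrite mul1r.
    have [|_ ->//] := MM' w.
    by apply: le_trans Gc; rewrite lerDl mulr_ge0// powR_ge0.
  by rewrite mul0r normr0 powR0// mul0r addr0.
- move=> w Gc; have [|-> ->] := MM' w.
    by apply: le_trans Gc; rewrite lerDl mulr_ge0// powR_ge0.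
  by rewrite /xi' indicE mem_set// mul1r.
Qed.

Lemma markov_moment2 (U : Omega -> R) (e : R) : measurable_fun setT U -> 0 < e ->
  ((e ^+ 2)%:E * P [set w | e < `|U w|]%R <= moment P 2 U)%E.
Proof.
move=> mU e0.
have mA : measurable [set w | e < `|U w|].
  by apply: measurable_lt_set; exact: measurableT_comp.
have -> : P [set w | e < `|U w|] = (\int[P]_w (\1_[set w | (e < `|U w|)%R] w)%:E)%E.
  by rewrite integral_indic// setIT.
rewrite -ge0_integralZlR; [|exact: measurable_indic|by []|exact: sqr_ge0].
apply: ge0_le_integralR => //.
- by apply: measurable_funM => //; exact: measurable_indic.
- exact: measurable_normr_powR.
- by move=> w; rewrite mulr_ge0 ?sqr_ge0// indicE ler0n.
- move=> w; rewrite indicE; case: (boolP (w \in _)) => [|_]; last by rewrite mulr0 powR_ge0.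
  by rewrite inE /= => ew; rewrite mulr1 (powR_mulrn 2)// lerXn2r ?nnegrE// ltW.
Qed.

(** Where [Q 2 <= c] the integral agrees with its stopped version, whose second moment is at most a
    multiple of [c]; Chebyshev's inequality does the rest. *)
Lemma elem_int_lenglart t M Q (c e : R) : elem_int t M Q -> 0 <= c -> 0 < e -> 0 < T ->
  (P [set w | e < `|M w|]%R <= P [set w | c < Q 2 w]%R +
     (expR cstep * cstep * c / e ^+ 2)%:E)%E.
Proof.
move=> hE c0 e0 T0.
have [M' [Q' [hE' Qc' MM']]] := elem_int_stop c0 hE.
have [mM mQ] := elem_int_measurable hE.
have [mM' mQ'] := elem_int_measurable hE'.
have mn (U : Omega -> R) : measurable_fun setT U -> measurable_fun setT (fun w => `|U w|).
  by move=> mU; exact: measurableT_comp.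
apply: (@le_trans _ _ (P ([set w | c < Q 2 w]%R `|` [set w | e < `|M' w|]%R))%E).
  apply: le_measure; rewrite ?inE.
  - by apply: measurable_lt_set; exact: mn.
  - by apply: measurableU; apply: measurable_lt_set => //; exact: mn.
  - move=> w /= eM; have [cQ|Qc] := ltP c (Q 2 w); [by left|right].
    by have [-> _] := MM' w Qc.
apply: (le_trans (measureU2 _ _ _)).
- exact: measurable_lt_set.
- by apply: measurable_lt_set; exact: mn.
rewrite leeD2l//.
have hm : (moment P 2 M' <= (expR cstep * cstep * c)%:E)%E.
  have /andP[at_ tT] := elem_int_itv hE'.
  (* For [p = 2] the power of the horizon is trivial, so [T] serves as [h] and the exponential is at
     most [expR cstep]. *)
  have := elem_int_moment (p := 2) _ T0 hE' _.
  rewrite lexx ler_nat /= => /(_ isT); rewrite divff// subrr powRr0 mulr1.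
  have taT : t - a <= T by rewrite lerBlDr (le_trans tT)// lerDl.
  move=> /(_ taT) /le_trans; apply.
  have qc : (\int[P]_w (Q' 2 w)%:E <= c%:E)%E.
    apply: (@le_trans _ _ (\int[P]_w c%:E)%E).
      by apply: ge0_le_integralR => // w; exact: (elem_int_Q_ge0 hE').
    rewrite integral_cst// -[leRHS]mule1; apply: lee_wpmul2l; first by rewrite lee_fin.
    exact: probability_le1.
  have c1 : 0 <= cstep :> R by rewrite ltW// cstep_gt0.
  apply: (@le_trans _ _ ((expR (cstep * (t - a) / T) * cstep)%:E * c%:E)%E).
    by apply: lee_wpmul2l => //; rewrite lee_fin mulr_ge0// expR_ge0.
  rewrite -EFinM lee_fin ler_wpM2r// ler_wpM2r// ler_expR.
  by rewrite -mulrA ler_piMr// ler_pdivrMr// mul1r.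
have := le_trans (markov_moment2 mM' e0) hm.
rewrite muleC -lee_pdivlMr ?exprn_gt0//.
Qed.
End elementary_integral.

(** * Riemann sums of continuous paths *)

Section riemann_sums.
Set Implicit Arguments.
Unset Strict Implicit.
Context {R : realType}.
Local Notation mu := (@lebesgue_measure R).
Implicit Types (a b : R) (u : R -> R).

(** Heine's theorem through near-covering compactness: the radius is the filter variable, tending to
    0 from the right. *)
Lemma within_itv_uniform a b u : {within `[a, b], continuous u} ->
  forall e, 0 < e -> exists2 d, 0 < d & forall x y, x \in `[a, b] -> y \in `[a, b] ->
    `|x - y| < d -> `|u x - u y| <= e.
Proof.
move=> cu e e0.
have e20 : 0 < e / 2 by rewrite divr_gt0.
have /compact_near_coveringP/near_covering_withinP := @segment_compact R a b.
move=> /(_ R (0^'+) (fun d x => forall y, y \in `[a, b] -> `|x - y| < d -> `|u x - u y| <= e)).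
have H x : `[a, b]%classic x -> \forall x' \near x & i \near 0^'+, `[a, b]%classic x' ->
    forall y : R, y \in `[a, b] -> `|x' - y| < i -> `|u x' - u y| <= e.
  move=> xab; have /subspace_continuousP/(_ x xab)/cvgrPdist_le/(_ _ e20) := cu.
  move=> [r /= r0 hr].
  exists ([set z | `|x - z| < r / 2], [set d | d < r / 2]) => /=.
    split; last by apply: nbhs_right_lt; rewrite divr_gt0.
    by exists (r / 2); [rewrite /= divr_gt0|move=> z].
  move=> [z d] /= [xz dr] zab y yab zy.
  have h1 : `|u x - u z| <= e / 2.
    by apply: hr => //=; apply: (lt_trans xz); rewrite ltr_pdivrMr// ltr_pMr// ltr1n.
  have h2 : `|u x - u y| <= e / 2.
    apply: hr => //=; rewrite -(subrKA z); apply: (le_lt_trans (ler_normD _ _)).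
    lra.
  by rewrite -(subrKA (u x)); apply: (le_trans (ler_normD _ _)); rewrite distrC; lra.
move=> /(_ _ H) hd.
have [d [hd' d0]] : exists d : R, (`[a, b]%classic `<=`
    (fun x => forall y : R, y \in `[a, b] -> `|x - y| < d -> `|u x - u y| <= e)) /\ 0 < d.
  apply: (@filter_ex _ _ (at_right_proper_filter (0 : R))).
  by apply: filterI; [exact: hd|exact: nbhs_right_gt].
by exists d => // x y xab; exact: hd'.
Qed.

Lemma within_itvS a b a' b' u : a <= a' -> b' <= b ->
  {within `[a, b], continuous u} -> {within `[a', b'], continuous u}.
Proof.
move=> aa bb; apply: continuous_subspaceW => x /=; rewrite !in_itv/= => /andP[h1 h2].
by rewrite (le_trans aa h1) (le_trans h2 bb).
Qed.

Lemma within_itv_integrable a b u : {within `[a, b], continuous u} ->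
  mu.-integrable `[a, b] (EFin \o u).
Proof. by move=> cu; apply: continuous_compact_integrable => //; exact: segment_compact. Qed.

Lemma Rintegral_itv_cat a b c u : a <= b -> b <= c -> {within `[a, c], continuous u} ->
  \int[mu]_(x in `[a, c]) u x =
  \int[mu]_(x in `[a, b]) u x + \int[mu]_(x in `[b, c]) u x.
Proof.
move=> ab bc cu; have iu := within_itv_integrable cu.
have := @Rintegral_itvB R u (BLeft a) (BRight c) b iu.
rewrite !bnd_simp => /(_ ab bc).
rewrite Rintegral_itv_obnd_cbnd => [<-|]; first by rewrite addrC subrK.
by apply: integrableS iu => //; apply: subset_itvr; rewrite bnd_simp.
Qed.

Lemma Rintegral_itv_sum (tau : nat -> R) u n : {homo tau : i j / (i <= j)%N >-> i <= j} ->
  {within `[tau 0%N, tau n], continuous u} ->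
  \int[mu]_(x in `[tau 0%N, tau n]) u x =
  \sum_(i < n) \int[mu]_(x in `[tau i, tau i.+1]) u x.
Proof.
move=> ht; elim: n => [|n ih] cu.
  by rewrite big_ord0 set_itv1 Rintegral_set1.
rewrite big_ord_recr/= -ih; last by apply: within_itvS cu => //; exact: ht.
by apply: Rintegral_itv_cat => //; exact: ht.
Qed.

Lemma Rintegral_itv_cst a b (c : R) : a <= b -> \int[mu]_(x in `[a, b]) c = c * (b - a).
Proof.
move=> ab; rewrite Rintegral_cst//= lebesgue_measure_itv/= lte_fin.
by case: ltP => // ba; rewrite (_ : b = a) ?subrr//; apply/eqP; rewrite eq_le ba ab.
Qed.

Lemma Rintegral_near_cst a b u (c e : R) : a <= b -> {within `[a, b], continuous u} ->
  (forall x, x \in `[a, b] -> `|u x - c| <= e) ->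
  `|\int[mu]_(x in `[a, b]) u x - c * (b - a)| <= e * (b - a).
Proof.
move=> ab cu h; have iu := within_itv_integrable cu.
have ic k : mu.-integrable `[a, b] (EFin \o (fun _ : R => k)).
  by apply: within_itv_integrable; apply: continuous_subspaceT => x; exact: cvg_cst.
rewrite -(Rintegral_itv_cst c ab) -RintegralB//.
have iB : mu.-integrable `[a, b] (EFin \o (fun x => u x - c)).
  apply: within_itv_integrable => x; apply: cvgB; [exact: cu|exact: cvg_cst].
apply: (le_trans (le_normr_Rintegral _ iB)) => //.
rewrite -(Rintegral_itv_cst e ab); apply: le_Rintegral => //.
exact: (integrable_norm iB).
Qed.

Definition mesh a b (N i : nat) : R := a + i%:R * ((b - a) / N%:R).

Lemma mesh0 a b N : mesh a b N 0 = a. Proof. by rewrite /mesh mul0r addr0. Qed.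

Lemma meshN a b N : mesh a b N.+1 N.+1 = b.
Proof. by rewrite /mesh mulrC divfK ?pnatr_eq0// addrC subrK. Qed.

Lemma meshB a b N i : mesh a b N i.+1 - mesh a b N i = (b - a) / N%:R.
Proof. by rewrite /mesh -natr1; ring. Qed.

Lemma mesh_homo a b N : a <= b -> {homo mesh a b N : i j / (i <= j)%N >-> i <= j}.
Proof.
move=> ab i j ij; rewrite /mesh lerD2l ler_wpM2r ?ler_nat//.
by rewrite divr_ge0// subr_ge0.
Qed.

Lemma mesh_itv a b N i : a <= b -> (i <= N.+1)%N -> a <= mesh a b N.+1 i <= b.
Proof.
move=> ab iN; have h := mesh_homo N.+1 ab.
by rewrite -{1}(mesh0 a b N.+1) -{4}(meshN a b N) !h.
Qed.

(** Left endpoints match the adapted values of an elementary integral, and [N.+1] cells avoid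
    division by zero. *)
Definition riemann_sum a b u N : R :=
  \sum_(i < N.+1) u (mesh a b N.+1 i) * ((b - a) / N.+1%:R).

Lemma riemann_sum_cvg a b u : a <= b -> {within `[a, b], continuous u} ->
  riemann_sum a b u N @[N --> \oo] --> \int[mu]_(x in `[a, b]) u x.
Proof.
move=> ab cu; apply/cvgrPdist_le => e e0.
have e'0 : 0 < e / (b - a + 1) by rewrite divr_gt0// ltr_wpDl// subr_ge0.
have [d d0 hd] := within_itv_uniform cu e'0.
have h : \forall N \near \oo, (b - a) / N.+1%:R < d.
  have : (b - a) * harmonic N @[N --> \oo] --> (b - a) * (0 : R).
    by apply: cvgM; [exact: cvg_cst|exact: cvg_harmonic].
  rewrite mulr0 => /cvgrPdist_lt /(_ d d0); apply: filterS => N.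
  by rewrite sub0r normrN => /(le_lt_trans (ler_norm _)).
apply: filterS h => N hN.
have hm := mesh_homo N.+1 ab.
have := @Rintegral_itv_sum (mesh a b N.+1) u N.+1 hm.
rewrite mesh0 meshN => /(_ cu) ->.
rewrite /riemann_sum -sumrB.
apply: (le_trans (ler_norm_sum _ _ _)).
apply: (@le_trans _ _ (\sum_(i < N.+1) (e / (b - a + 1)) * (mesh a b N.+1 i.+1 - mesh a b N.+1 i))).
  apply: ler_sum => i _.
  have iN := ltn_ord i.
  have /andP[i1 i2] := @mesh_itv a b N i ab (ltnW iN).
  have /andP[i3 i4] := @mesh_itv a b N i.+1 ab iN.
  rewrite -{1}(meshB a b N.+1 i); apply: Rintegral_near_cst; first exact: hm.
    exact: within_itvS cu.
  move=> x; rewrite in_itv/= => /andP[x1 x2]; apply: hd.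
  - by rewrite in_itv/= (le_trans i1)// (le_trans x2).
  - by rewrite in_itv/= i1.
  - rewrite ger0_norm ?subr_ge0//; apply: le_lt_trans hN.
    by rewrite -(meshB a b N.+1 i) lerB.
rewrite -mulr_sumr -(big_mkord xpredT (fun i => mesh a b N.+1 i.+1 - mesh a b N.+1 i)) telescope_sumr//.
rewrite mesh0 meshN.
by rewrite -mulrA ler_piMr ?(ltW e0)// mulrC ler_pdivrMr ?mul1r ?lerDl// ltr_wpDl// subr_ge0.
Qed.

(** A simple process is constant on half-open cells, so a function built from it agrees with one
    continuous on the closed cell except at the left endpoint, a null set. *)
Lemma Rintegral_piecewise (e : nat -> R) (v : R -> R) (w : nat -> R -> R) K :
  (forall j, (j < K)%N -> e j <= e j.+1) ->
  (forall j, (j < K)%N -> {within `[e j, e j.+1], continuous (w j)}) ->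
  (forall j x, (j < K)%N -> x \in `]e j, e j.+1] -> v x = w j x) ->
  mu.-integrable `[e 0%N, e K] (EFin \o v) /\
  \int[mu]_(x in `[e 0%N, e K]) v x = \sum_(j < K) \int[mu]_(x in `[e j, e j.+1]) w j x.
Proof.
elim: K => [|K ih] he cw vw.
  rewrite big_ord0 set_itv1 Rintegral_set1; split => //.
  apply: (eq_integrable _ (EFin \o (fun=> v (e 0%N)))) => //.
    by move=> x; rewrite inE /= => ->.
  rewrite -set_itv1; apply: within_itv_integrable.
  by apply: continuous_subspaceT => x; exact: cvg_cst.
have [||j x jK|iv Ev] := ih.
- by move=> j jK; apply: he; rewrite ltnS ltnW.
- by move=> j jK; apply: cw; rewrite ltnS ltnW.
- by apply: vw; rewrite ltnS ltnW.
have e0K : e 0%N <= e K.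
  have : forall j, (j <= K)%N -> e 0%N <= e j.
    elim=> // j ihj jK; apply: (le_trans (ihj (ltnW jK))).
    by apply: he; rewrite ltnS ltnW.
  exact.
have eKK : e K <= e K.+1 by exact: he.
have iw := within_itv_integrable (cw K (ltnSn K)).
have iwo : mu.-integrable `]e K, e K.+1] (EFin \o w K).
  by apply: integrableS iw => //; apply: subset_itvr; rewrite bnd_simp.
have ivo : mu.-integrable `]e K, e K.+1] (EFin \o v).
  apply: eq_integrable iwo => // x; rewrite inE => xK.
  by rewrite /= (vw K).
have Eset : `[e 0%N, e K.+1]%classic = `[e 0%N, e K]%classic `|` `]e K, e K.+1]%classic.
  by apply: itv_bndbnd_setU; rewrite bnd_simp.
have disj : [disjoint `[e 0%N, e K]%classic & `]e K, e K.+1]%classic].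
  apply/disj_setPS => y [/=]; rewrite 2!in_itv/= => /andP[_ yx] /andP[].
  by rewrite ltNge yx.
rewrite Eset; have iU : mu.-integrable (`[e 0%N, e K] `|` `]e K, e K.+1]) (EFin \o v).
  have mU : measurable_fun (`[e 0%N, e K] `|` `]e K, e K.+1]) (EFin \o v).
    by apply/measurable_funU => //; split; [move/integrableP: iv => []|move/integrableP: ivo => []].
  apply/integrableP; split => //; rewrite ge0_integral_setU//; last exact: measurableT_comp.
  by rewrite lte_add_pinfty//; [move/integrableP: iv => []|move/integrableP: ivo => []].
split => //; rewrite Rintegral_setU// Ev big_ord_recr/=; congr (_ + _).
rewrite -(Rintegral_itv_obnd_cbnd iwo).
by apply: eq_Rintegral => x; rewrite inE => xK; rewrite (vw K).
Qed.

End riemann_sums.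

(** * Approximation of Ito integrals by Riemann sums *)

Lemma cvg_sum_seq (R : realType) (I : Type) (r : seq I) (f : I -> nat -> R) (l : I -> R) :
  (forall i, f i N @[N --> \oo] --> l i) ->
  \sum_(i <- r) f i N @[N --> \oo] --> \sum_(i <- r) l i.
Proof.
move=> h; elim: r => [|i r ih].
  by rewrite big_nil; under eq_fun do rewrite big_nil; exact: cvg_cst.
by rewrite big_cons; under eq_fun do rewrite big_cons; apply: cvgD.
Qed.

Section ito_approximation.
Set Implicit Arguments.
Unset Strict Implicit.
Context {R : realType} {disp : measure_display} {Omega : measurableType disp}
  (P : probability Omega R) (T : R) (F : R -> set (set Omega))
  (hF : usual_filtration P T F) (W : R -> Omega -> R)
  (hW : brownian_motion P T F W).
Variables (a b : R).
Hypotheses (a0 : 0 <= a) (ab : a <= b) (bT : b <= T).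

Local Notation mu := (@lebesgue_measure R).

Let aT : a <= T. Proof. exact: le_trans bT. Qed.

Lemma elem_int_mesh (s t : R) N (C : R -> Omega -> R) M Q :
  elem_int T F W a s M Q -> s <= t -> t <= T ->
  (forall i, (i < N.+1)%N -> smeasurable (F (mesh s t N.+1 i)) (C (mesh s t N.+1 i))) ->
  elem_int T F W a t
    (fun w => M w + \sum_(i < N.+1) C (mesh s t N.+1 i) w *
        (W (mesh s t N.+1 i.+1) w - W (mesh s t N.+1 i) w))
    (fun p w => Q p w + \sum_(i < N.+1) `|C (mesh s t N.+1 i) w| `^ p *
        ((t - s) / N.+1%:R)).
Proof.
move=> hM st tT hC.
have hm := mesh_homo N.+1 st.
have H n : (n <= N.+1)%N -> elem_int T F W a (mesh s t N.+1 n)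
    (fun w => M w + \sum_(i < n) C (mesh s t N.+1 i) w *
        (W (mesh s t N.+1 i.+1) w - W (mesh s t N.+1 i) w))
    (fun p w => Q p w + \sum_(i < n) `|C (mesh s t N.+1 i) w| `^ p *
        ((t - s) / N.+1%:R)).
  elim: n => [_|n ih nN].
    rewrite mesh0.
    rewrite (_ : (fun w => _) = M); last by apply/funext => w; rewrite big_ord0 addr0.
    by rewrite (_ : (fun p w => _) = Q)//; apply/funext => p; apply/funext => w; rewrite big_ord0 addr0.
  have := elem_intS (ih (ltnW nN)) (hm n n.+1 (leqnSn n)) _ (hC n nN).
  have /andP[_ ht] := mesh_itv st nN.
  move=> /(_ (le_trans ht tT)); congr elem_int.
    by apply/funext => w; rewrite big_ord_recr/= addrA.
  by apply/funext => p; apply/funext => w; rewrite big_ord_recr/= addrA meshB.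
by have := H N.+1 (leqnn _); rewrite meshN.
Qed.

Lemma elem_int_meshes (e : nat -> R) K N (C : nat -> R -> Omega -> R) :
  e 0%N = a -> {homo e : i j / (i <= j)%N >-> i <= j} -> e K <= T ->
  (forall j i, (j < K)%N -> (i < N.+1)%N ->
     smeasurable (F (mesh (e j) (e j.+1) N.+1 i)) (C j (mesh (e j) (e j.+1) N.+1 i))) ->
  elem_int T F W a (e K)
    (fun w => \sum_(j < K) \sum_(i < N.+1) C j (mesh (e j) (e j.+1) N.+1 i) w *
        (W (mesh (e j) (e j.+1) N.+1 i.+1) w - W (mesh (e j) (e j.+1) N.+1 i) w))
    (fun p w => \sum_(j < K) \sum_(i < N.+1)
       `|C j (mesh (e j) (e j.+1) N.+1 i) w| `^ p * ((e j.+1 - e j) / N.+1%:R)).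
Proof.
move=> ea he; elim: K => [_ _|K ih eKT hC].
  have := elem_int0 T F W a; rewrite ea; congr elem_int.
    by apply/funext => w; rewrite big_ord0.
  by apply/funext => p; apply/funext => w; rewrite big_ord0.
have eKK : e K <= e K.+1 by exact: he.
have := elem_int_mesh (C := C K) (N := N) (ih (le_trans eKK eKT) _) eKK eKT _.
move=> /(_ (fun j i jK => hC j i (ltnW jK))) /(_ (fun i => hC K i (ltnSn K))).
by congr elem_int; [apply/funext => w|apply/funext => p; apply/funext => w];
  rewrite [RHS]big_ord_recr.
Qed.

(** * A simple process seen on a grid of [[a, b]] *)

Section simple_process_grid.
Variable (S : simple_process Omega R).
Hypothesis hS : sp_predictable T F S.
Let n := sp_size S.
Let t := sp_time S.

Let t_homo i j : (i <= j)%N -> (j <= n)%N -> t i <= t j.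
Proof.
move=> + jn; elim: j jn => [|j ih] jn; first by rewrite leqn0 => /eqP ->.
rewrite leq_eqVlt => /predU1P[->//|]; rewrite ltnS => ij.
have [_ h _ _] := hS.
exact: (le_trans (ih (ltnW jn) ij) (h j jn)).
Qed.

Lemma sp_val_in k s w : (k < n)%N -> t k < s <= t k.+1 -> sp_val S s w = sp_coef S k w.
Proof.
move=> kn /andP[ks sk]; rewrite /sp_val (bigD1 (Ordinal kn))//= big1 => [|i ik].
  by rewrite indicE mem_set ?mulr1 ?addr0//= in_itv/= -/t ks sk.
rewrite indicE memNset ?mulr0//= in_itv/= -/t => /andP[h1 h2].
have /orP[ik'|ki] : (i < k)%N || (k < i)%N by rewrite -neq_ltn.
  have := t_homo ik' (ltnW kn); lra.
have := t_homo ki (ltnW (ltn_ord i)); lra.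
Qed.

Lemma sp_val_out s w : s <= t 0%N \/ t n < s -> sp_val S s w = 0.
Proof.
move=> h; rewrite /sp_val big1// => i _.
rewrite indicE memNset ?mulr0//= in_itv/= -/t => /andP[h1 h2].
have h3 := t_homo (leq0n i) (ltnW (ltn_ord i)).
have h4 := t_homo (ltn_ord i) (leqnn _).
by case: h => h; lra.
Qed.

Definition sp_clip (x : R) := Num.max a (Num.min x b).

(** Indices 1 to [n + 1] are the times of [S] clipped to [[a, b]]; the end points [a] and [b] are
    added so that the first and last cells carry the value 0 of [S] outside its time range. *)
Definition sp_grid j :=
  if j is k.+1 then (if (k <= n)%N then sp_clip (t k) else b) else a.

(** On an empty cell the value is set to 0: if [t k > b], the coefficient is only
    [F (t k)]-measurable, while the clipped grid point is [b]. *)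
Definition sp_piece j w :=
  if j is k.+1 then
    (if (k < n)%N && (sp_grid j < sp_grid j.+1) then sp_coef S k w else 0)
  else 0.

Lemma sp_clip_itv x : a <= sp_clip x <= b.
Proof. by rewrite /sp_clip le_max lexx/= ge_max ab ge_min lexx orbT. Qed.

Lemma sp_clip_homo x y : x <= y -> sp_clip x <= sp_clip y.
Proof.
move=> xy; rewrite /sp_clip ge_max le_max lexx/= le_max; apply/orP; right.
by rewrite le_min !ge_min xy lexx/= orbT.
Qed.

Lemma sp_grid_homo : {homo sp_grid : i j / (i <= j)%N >-> i <= j}.
Proof.
apply: homo_leq => [x|y x z|j]; [exact: lexx|exact: le_trans|].
case: j => [|k] /=; first by case/andP: (sp_clip_itv (t 0%N)).
case: (leqP k n) => [kn|nk]; case: (leqP k.+1 n) => [kn1|nk1] //.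
- by apply: sp_clip_homo; exact: t_homo.
- by case/andP: (sp_clip_itv (t k)).
- by move: nk; rewrite ltnNge (ltnW kn1).
Qed.

Lemma sp_grid_last : sp_grid n.+2 = b. Proof. by rewrite /= ltnn. Qed.

Lemma sp_grid_itv j : a <= sp_grid j <= b.
Proof.
case: j => [|k] /=; first by rewrite lexx.
by case: ifP => _; rewrite ?sp_clip_itv// ab lexx.
Qed.

Lemma sp_piece_measurable j : smeasurable (F (sp_grid j)) (sp_piece j).
Proof.
have /andP[ja jb] := sp_grid_itv j.
have jT : 0 <= sp_grid j <= T by rewrite (le_trans a0 ja) (le_trans jb).
have sF := filtration_sigma hF jT.
case: j ja jb jT sF => [|k] ja jb jT sF; first exact: smeasurable_cst.
have -> : sp_piece k.+1 = if (k < n)%N && (sp_grid k.+1 < sp_grid k.+2)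
    then sp_coef S k else fun=> 0.
  by apply/funext => w; rewrite /sp_piece; case: ifP.
case: ifPn => [/andP[kn kk]|_]; last exact: smeasurable_cst.
have [h1 _ h3 _] := hS.
apply: smeasurableS (h3 k kn).
have /andP[t0 tT] := h1 k (ltnW kn).
case/andP: jT => j0 jT.
apply: (filtration_mono hF) => //.
move: kk; rewrite /= (ltnW kn) kn /sp_clip -/t => kk.
have [tb|bt] := leP (t k) b; first by rewrite le_max lexx orbT.
move: kk; rewrite ltNge; move/negP; case.
rewrite [Num.min (t k) b](min_idPr (ltW bt)).
have mb : Num.min (t k.+1) b <= b by rewrite ge_min lexx orbT.
by rewrite ge_max !le_max lexx/= mb orbT.
Qed.

Lemma sp_piece_val j s w : (j < n.+2)%N -> s \in `]sp_grid j, sp_grid j.+1] ->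
  sp_val S s w = sp_piece j w.
Proof.
rewrite in_itv/= => jn /andP[js sj].
have jj : sp_grid j < sp_grid j.+1 by exact: lt_le_trans sj.
have [_ sb] := andP (sp_grid_itv j.+1).
have {}sb : s <= b by apply: le_trans sj sb.
have [aj _] := andP (sp_grid_itv j).
have as_ : a < s by apply: le_lt_trans js.
have up k : s <= sp_clip (t k) -> s <= t k.
  rewrite /sp_clip le_max => /orP[|]; first by rewrite leNgt as_.
  by rewrite le_min => /andP[].
have lo k : sp_clip (t k) < s -> t k < s.
  by rewrite /sp_clip gt_max => /andP[_]; rewrite gt_min => /orP[//|]; rewrite ltNge sb.
case: j jn js sj jj aj => [|k] jn js sj jj aj.
  by rewrite sp_val_out//; left; exact: up.
rewrite /sp_piece jj andbT; move: js sj => /=; rewrite -ltnS.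
have kn : (k <= n)%N by exact: jn.
rewrite ltnS kn => /lo js; case: ifP => kn1 sj.
  by rewrite (@sp_val_in k)// js up.
rewrite sp_val_out//; right.
by have -> : n = k by apply/eqP; rewrite eqn_leq kn andbT leqNgt kn1.
Qed.

Lemma sp_integral_grid w : sp_integral W S b w - sp_integral W S a w =
  \sum_(j < n.+2) sp_piece j w * (W (sp_grid j.+1) w - W (sp_grid j) w).
Proof.
rewrite big_ord_recl /= mul0r add0r big_ord_recr /= ltnn /= mul0r addr0.
rewrite /sp_integral -sumrB; apply: eq_bigr => k _; rewrite /bump /= add1n add0n.
have kn := ltn_ord k; rewrite kn (ltnW kn) /= -/t.
(* The value stopped at [b] minus the one stopped at [a] is the value at the clipped time minus
   [W a], and [W a] cancels in each increment. *)
have G x : W (Num.min x b) w - W (Num.min x a) w = W (sp_clip x) w - W a w.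
  rewrite /sp_clip; have [xa|ax] := leP x a.
    have xb : x <= b by exact: le_trans ab.
    by rewrite (min_idPl xb) (max_idPl xa) !subrr.
  by rewrite (max_idPr _)// le_min ab ltW.
transitivity (sp_coef S k w * (W (sp_clip (t k.+1)) w - W (sp_clip (t k)) w)).
  rewrite -mulrBr; congr (_ * _).
  by have := G (t k.+1); have := G (t k); lra.
case: ifPn => // kk.
have -> : sp_clip (t k.+1) = sp_clip (t k).
  apply/eqP; rewrite eq_le leNgt kk/=; apply: sp_clip_homo.
  by apply: t_homo.
by rewrite !subrr !mulr0.
Qed.

Section path.
Variable h : R -> R.
Hypothesis ch : {within `[a, b], continuous h}.

(** This is the [Q 2] of the elementary integral whose integrand is [S] minus the path [h]; the real
    power makes the two agree by computation. *)
Definition sp_sqdist_sum w N : R := \sum_(j < n.+2)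
  riemann_sum (sp_grid j) (sp_grid j.+1) (fun s => `|sp_piece j w - h s| `^ 2) N.

Let cpw j w : {within `[sp_grid j, sp_grid j.+1],
  continuous (fun s => `|sp_piece j w - h s| `^ 2)}.
Proof.
have [aj _] := andP (sp_grid_itv j); have [_ jb] := andP (sp_grid_itv j.+1).
have ch' := within_itvS aj jb ch.
have -> : (fun s => `|sp_piece j w - h s| `^ 2) = fun s => `|sp_piece j w - h s| * `|sp_piece j w - h s|.
  by apply/funext => s; rewrite (powR_mulrn 2).
have cn : {within `[sp_grid j, sp_grid j.+1], continuous (fun s => `|sp_piece j w - h s|)}.
  by move=> x; apply: (@cvg_norm _ R^o); apply: cvgB; [exact: cvg_cst|exact: ch'].
by move=> x; apply: cvgM; exact: cn.
Qed.

Lemma sp_sqdist w : mu.-integrable `[a, b] (EFin \o (fun s => (sp_val S s w - h s) ^+ 2)) /\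
  sp_sqdist_sum w N @[N --> \oo] --> \int[mu]_(s in `[a, b]) (sp_val S s w - h s) ^+ 2.
Proof.
have [|||i1 i2] := @Rintegral_piecewise R sp_grid (fun s => (sp_val S s w - h s) ^+ 2)
  (fun j s => `|sp_piece j w - h s| `^ 2) n.+2.
- by move=> j _; exact: sp_grid_homo.
- by move=> j _; exact: cpw.
- by move=> j x jn xj; rewrite (powR_mulrn 2)// real_normK ?num_real// (@sp_piece_val j).
move: i1 i2; rewrite sp_grid_last => i1 i2; split => //; rewrite i2.
apply: cvg_sum_seq => j; apply: riemann_sum_cvg; last exact: cpw.
exact: sp_grid_homo.
Qed.

End path.
End simple_process_grid.
End ito_approximation.

(** * Almost sure limits of measurable functions *)

Section ae_limits.
Set Implicit Arguments.
Unset Strict Implicit.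
Context {R : realType} {disp : measure_display} {Omega : measurableType disp}
  (P : probability Omega R).
Local Open Scope ereal_scope.

(** Dominated convergence applied to the indicators of the deviation sets. *)
Lemma ae_cvg_in_measure (f : nat -> Omega -> R) (g : Omega -> R) :
  (forall n, measurable_fun setT (f n)) -> measurable_fun setT g ->
  {ae P, forall w, f n w @[n --> \oo] --> g w} ->
  forall d, (0 < d)%R -> P [set w | d < `|f n w - g w|]%R @[n --> \oo] --> 0.
Proof.
move=> mf mg fg d d0.
have mA n : measurable [set w | d < `|f n w - g w|]%R.
  by apply: measurable_lt_set; apply: measurableT_comp => //; exact: measurable_funB.
have h1 : {ae P, forall w, setT w ->
    (\1_[set w | d < `|f n w - g w|]%R w : R)%:E @[n --> \oo] --> (cst 0 w : \bar R)}.
  apply: filterS fg => w hw _.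
  move/cvgrPdist_lt : hw => /(_ d d0) hw.
  apply: (@cvg_near_cst _ _ _ _ _ _); apply: filterS hw => n hn.
  by rewrite indicE memNset//= distrC; apply/negP; rewrite -leNgt ltW.
have h2 : {ae P, forall w n, setT w ->
    `|(\1_[set w | d < `|f n w - g w|]%R w : R)%:E| <= cst 1 w}.
  by apply: aeW => w n _; rewrite /= lee_fin indicE; case: (_ \in _); rewrite ?normr1 ?normr0.
have h0 n : measurable_fun setT (fun w => (\1_[set w | d < `|f n w - g w|]%R w : R)%:E).
  by apply/measurable_EFinP; exact: measurable_indic.
have [_ _] := dominated_convergence measurableT h0 (measurable_cst 0)
  h1 (finite_measure_integrable_cst P 1 measurableT) h2.
rewrite integral0; apply: cvg_trans; apply: near_eq_cvg; apply: nearW => n.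
by rewrite /= integral_indic// setIT.
Qed.

(** The pointwise theorem applies on the convergence set; by completeness, the values on the
    exceptional null set are harmless. *)
Lemma ae_cvg_measurable (f : nat -> Omega -> \bar R) (g : Omega -> \bar R) :
  (forall N, P.-negligible N -> measurable N) ->
  (forall n, measurable_fun setT (f n)) ->
  {ae P, forall w, f n w @[n --> \oo] --> g w} -> measurable_fun setT g.
Proof.
move=> cP mf fg _ B mB; rewrite setTI.
set G := [set w | f n w @[n --> \oo] --> g w].
have nG : P.-negligible (~` G) by exact: fg.
have mG : measurable G by rewrite -[G]setCK; apply: measurableC; exact: cP.
have -> : g @^-1` B = (G `&` g @^-1` B) `|` (~` G `&` g @^-1` B).
  by rewrite -setIUl setUv setTI.
apply: measurableU; last first.
  by apply: cP; apply: negligibleS nG => w [].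
have : measurable_fun G g.
  apply: (@emeasurable_fun_cvg _ _ _ G f g) => // m.
  exact: measurable_funTS.
exact.
Qed.

End ae_limits.

Lemma cvge0_lt (R : realType) (f : nat -> \bar R) (r : R) : 0 < r ->
  (f n @[n --> \oo] --> 0)%E -> \forall n \near \oo, (f n < r%:E)%E.
Proof.
move=> r0 hf; have : (0 < r%:E)%E by rewrite lte_fin.
by move=> /open_ereal_lt' h; exact: (hf _ h).
Qed.

(** * Grid sums of the integrand itself *)

Section ito_grid.
Set Implicit Arguments.
Unset Strict Implicit.
Context {R : realType} {disp : measure_display} {Omega : measurableType disp}
  (P : probability Omega R) (T : R) (F : R -> set (set Omega))
  (hF : usual_filtration P T F) (W : R -> Omega -> R)
  (hW : brownian_motion P T F W).
Hypothesis T0 : 0 < T.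
Local Notation mu := (@lebesgue_measure R).

Variable H : R -> Omega -> R.
Hypothesis mH : forall s, 0 <= s <= T -> smeasurable (F s) (H s).
Hypothesis cH : {ae P, forall w, {within `[0, T], continuous (H ^~ w)}}.

Lemma negligible_measurable (N : set Omega) : P.-negligible N -> measurable N.
Proof.
move=> hN; apply: (filtration_sub hF (t := 0)); first by rewrite lexx ltW.
exact: (filtration_complete hF).
Qed.

Let mHT s : 0 <= s <= T -> measurable_fun setT (H s).
Proof. by move=> sT; apply: (adapted_measurable hF sT); exact: mH. Qed.

Lemma sp_sqdist_sum_measurable a b (S : simple_process Omega R) N :
  0 <= a -> a <= b -> b <= T -> sp_predictable T F S ->
  measurable_fun setT (fun w => sp_sqdist_sum a b S (H ^~ w) w N).
Proof.
move=> a0 ab bT hS; rewrite /sp_sqdist_sum /riemann_sum.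
apply: measurable_sum => j; apply: measurable_sum => i.
apply: measurable_funM => //; apply: measurable_normr_powR.
have /andP[aj jb] := sp_grid_itv ab S j.
have /andP[aj1 j1b] := sp_grid_itv ab S j.+1.
have jj : sp_grid a b S j <= sp_grid a b S j.+1 by apply: (sp_grid_homo ab hS).
have /andP[i1 i2] := mesh_itv jj (ltnW (ltn_ord i)).
apply: measurable_funB.
  apply: (adapted_measurable hF (t := sp_grid a b S j)).
    by rewrite (le_trans a0 aj) (le_trans jb).
  exact: (sp_piece_measurable hF a0 ab bT hS).
apply: mHT; rewrite (le_trans a0) ?(le_trans aj)//=.
by rewrite (le_trans i2) ?(le_trans j1b).
Qed.

Lemma sp_sqdist_ae a b (S : simple_process Omega R) :
  0 <= a -> a <= b -> b <= T -> sp_predictable T F S ->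
  {ae P, forall w,
    mu.-integrable `[a, b] (EFin \o (fun s => (sp_val S s w - H s w) ^+ 2)) /\
    sp_sqdist_sum a b S (H ^~ w) w N @[N --> \oo] -->
      \int[mu]_(s in `[a, b]) (sp_val S s w - H s w) ^+ 2}.
Proof.
move=> a0 ab bT hS; apply: filterS cH => w hw.
by apply: (sp_sqdist ab hS); exact: within_itvS hw.
Qed.

(** [H] is adapted with a.s. continuous paths, so measurability of the time integral in [w] comes
    from Riemann sums and completeness instead of joint measurability. *)
Lemma sp_sqdist_measurable a b (S : simple_process Omega R) :
  0 <= a -> a <= b -> b <= T -> sp_predictable T F S ->
  measurable_fun setT (fun w =>
    \int[mu]_(s in `[a, b]) ((sp_val S s w - H s w) ^+ 2)%:E)%E.
Proof.
move=> a0 ab bT hS.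
apply: (@ae_cvg_measurable _ _ _ P (fun N w => (sp_sqdist_sum a b S (H ^~ w) w N)%:E)).
- exact: negligible_measurable.
- by move=> N; apply/measurable_EFinP; exact: sp_sqdist_sum_measurable.
- apply: filterS (sp_sqdist_ae a0 ab bT hS) => w [iw hw].
  rewrite -[X in _ --> X]fineK; last by apply: integrable_fin_num.
  by apply: cvg_EFin; [exact: nearW|exact: hw].
Qed.

Lemma fine_sp_sqdist_measurable a b (S : simple_process Omega R) :
  0 <= a -> a <= b -> b <= T -> sp_predictable T F S ->
  measurable_fun setT (fun w => \int[mu]_(s in `[a, b]) (sp_val S s w - H s w) ^+ 2).
Proof.
move=> a0 ab bT hS; rewrite /Rintegral.
by apply: (measurableT_comp (@fine_measurable R setT measurableT)); exact: sp_sqdist_measurable.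
Qed.

Definition grid_sum (g : nat -> R) K N (C : nat -> R -> Omega -> R) w :=
  \sum_(j < K) \sum_(i < N.+1) C j (mesh (g j) (g j.+1) N.+1 i) w *
     (W (mesh (g j) (g j.+1) N.+1 i.+1) w - W (mesh (g j) (g j.+1) N.+1 i) w).

Lemma grid_sum_cst (g : nat -> R) K N (c : nat -> Omega -> R) w :
  grid_sum g K N (fun j _ => c j) w =
  \sum_(j < K) c j w * (W (g j.+1) w - W (g j) w).
Proof.
apply: eq_bigr => j _; rewrite -mulr_sumr; congr (_ * _).
rewrite -(big_mkord xpredT (fun i => W (mesh (g j) (g j.+1) N.+1 i.+1) w -
  W (mesh (g j) (g j.+1) N.+1 i) w)).
by rewrite (telescope_sumr (fun i => W (mesh (g j) (g j.+1) N.+1 i) w))// mesh0 meshN.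
Qed.

Lemma grid_sumB (g : nat -> R) K N (C D : nat -> R -> Omega -> R) w :
  grid_sum g K N (fun j s w => C j s w - D j s w) w =
  grid_sum g K N C w - grid_sum g K N D w.
Proof.
rewrite /grid_sum -sumrB; apply: eq_bigr => j _.
by rewrite -sumrB; apply: eq_bigr => i _; rewrite mulrBl.
Qed.

Lemma ito_grid_approx I a b (e eps : R) : ito_integral P T F W H I ->
  0 <= a -> a <= b -> b <= T -> 0 < e -> 0 < eps ->
  exists (g : nat -> R) K N, [/\ g 0%N = a, {homo g : i j / (i <= j)%N >-> i <= j},
    g K = b &
    (P [set w | e < `|I b w - I a w - grid_sum g K N (fun=> H) w|]%R <= eps%:E)%E].
Proof.
move=> [mI _ [S [hS S1 S2]]] a0 ab bT e0 eps0.
have aT : 0 <= a <= T by rewrite a0 (le_trans ab).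
have bT' : 0 <= b <= T by rewrite bT (le_trans a0).
have K0 : 0 < expR cstep * cstep :> R by rewrite mulr_gt0 ?expR_gt0 ?cstep_gt0.
(* [c] is the level at which the second term of [elem_int_lenglart], for the deviation [e / 2],
   equals [eps / 4]. *)
pose c := eps / 4 * (e / 2) ^+ 2 / (expR cstep * cstep).
have e2 : 0 < e / 2 by rewrite divr_gt0.
have c0 : 0 < c by rewrite !mulr_gt0 ?invr_gt0 ?exprn_gt0.
have c20 : 0 < c / 2 by rewrite divr_gt0.
have cE : expR cstep * cstep * c / (e / 2) ^+ 2 = eps / 4.
  by rewrite [_ * c]mulrC /c divfK ?gt_eqF// mulfK// gt_eqF// exprn_gt0.
have e40 : 0 < e / 4 by rewrite divr_gt0.
have eps80 : 0 < eps / 8 by rewrite divr_gt0.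
have eps40 : 0 < eps / 4 by rewrite divr_gt0.
have h1 := cvge0_lt eps80 (S2 _ bT' _ e40).
have h2 := cvge0_lt eps80 (S2 _ aT _ e40).
have h3 := cvge0_lt eps40 (S1 _ c20).
have [n [[hb ha] hint]] := filter_ex (filterI (filterI h1 h2) h3).
have hSn := hS n.
have h4 := @ae_cvg_in_measure _ _ _ P
  (fun N w => sp_sqdist_sum a b (S n) (H ^~ w) w N)
  (fun w => \int[mu]_(s in `[a, b]) (sp_val (S n) s w - H s w) ^+ 2).
have {}h4 := h4 (fun N => sp_sqdist_sum_measurable N a0 ab bT hSn)
  (fine_sp_sqdist_measurable a0 ab bT hSn) _ _ c20.
have ae1 : {ae P, forall w, sp_sqdist_sum a b (S n) (H ^~ w) w N @[N --> \oo] -->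
    \int[mu]_(s in `[a, b]) (sp_val (S n) s w - H s w) ^+ 2}.
  by apply: filterS (sp_sqdist_ae a0 ab bT hSn) => w [].
(* The mesh is refined only after [n] is fixed: the Riemann sums converge for each simple process
   separately. *)
have [N hN] := filter_ex (cvge0_lt eps40 (h4 ae1)).
set g := sp_grid a b (S n).
set K := (sp_size (S n)).+2.
have g0 : g 0%N = a by [].
have gh : {homo g : i j / (i <= j)%N >-> i <= j} by exact: (sp_grid_homo ab hSn).
have gK : g K = b by exact: sp_grid_last.
exists g, K, N; split => //.
set A0 := (X in (P X <= _)%E).
pose A1 := [set w | ((e / 4)%:E < `|(sp_integral W (S n) b w - I b w)%:E|)%E].
pose A2 := [set w | ((e / 4)%:E < `|(sp_integral W (S n) a w - I a w)%:E|)%E].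
pose M := grid_sum g K N (fun j s w => sp_piece a b (S n) j w - H s w).
pose A3 := [set w | e / 2 < `|M w|].
have ad (s : R) (U : Omega -> R) : 0 <= s <= T -> smeasurable (F s) U -> measurable_fun setT U.
  by move=> sT; apply: (adapted_measurable hF sT).
have mspI s : 0 <= s <= T -> measurable_fun setT (sp_integral W (S n) s).
  move=> /andP[s0 sT]; rewrite /sp_integral; apply: measurable_sum => k.
  have [t1 _ t3 _] := hSn; have kn := ltn_ord k.
  have /andP[k0 kT] := t1 k (ltnW kn); have /andP[k10 k1T] := t1 k.+1 kn.
  apply: measurable_funM.
    by apply: (ad (sp_time (S n) k)); [rewrite k0|exact: t3].
  have mW u : 0 <= u -> u <= T -> measurable_fun setT (W (Num.min u s)).
    move=> u0 uT; have us : 0 <= Num.min u s <= T.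
      by rewrite le_min u0 s0/= ge_min uT.
    exact: (ad _ _ us (bm_adapted hW us)).
  by apply: measurable_funB; exact: mW.
have mA12 s : 0 <= s <= T ->
    measurable [set w | ((e / 4)%:E < `|(sp_integral W (S n) s w - I s w)%:E|)%E].
  move=> sT.
  have -> : [set w | ((e / 4)%:E < `|(sp_integral W (S n) s w - I s w)%:E|)%E] =
    [set w | e / 4 < `|sp_integral W (S n) s w - I s w|] by [].
  apply: measurable_lt_set; apply: measurableT_comp => //.
  by apply: measurable_funB; [exact: mspI|exact: (ad _ _ sT (mI _ sT))].
have gitv j : a <= g j <= b by exact: sp_grid_itv.
have mitv j i : (i <= N.+1)%N -> 0 <= mesh (g j) (g j.+1) N.+1 i <= T.
  move=> iN; have /andP[g1 _] := gitv j; have /andP[_ g2] := gitv j.+1.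
  have /andP[i1 i2] := mesh_itv (gh j j.+1 (leqnSn j)) iN.
  by rewrite (le_trans a0 (le_trans g1 i1)) (le_trans (le_trans i2 g2) bT).
have hM : elem_int T F W a b M
    (fun p w => \sum_(j < K) \sum_(i < N.+1)
      `|sp_piece a b (S n) j w - H (mesh (g j) (g j.+1) N.+1 i) w| `^ p *
         ((g j.+1 - g j) / N.+1%:R)).
  have := @elem_int_meshes R disp Omega T F W a g K N
    (fun j s w => sp_piece a b (S n) j w - H s w) g0 gh.
  rewrite gK; apply; first exact: bT.
  move=> j i jK iN.
  have hm := mitv j i (ltnW iN); have /andP[m0 mT] := hm.
  have /andP[i1 i2] := mesh_itv (gh j j.+1 (leqnSn j)) (ltnW iN).
  have /andP[ga _] := gitv j.
  have sF := filtration_sigma hF hm.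
  apply: smeasurableB => //; last exact: mH.
  apply: smeasurableS (sp_piece_measurable hF a0 ab bT hSn j).
  by apply: (filtration_mono hF) => //; exact: le_trans ga.
have [mM _] := elem_int_measurable hF hW a0 (le_trans ab bT) hM.
have mA3 : measurable A3 by apply: measurable_lt_set; exact: measurableT_comp.
have ME w : sp_integral W (S n) b w - sp_integral W (S n) a w - grid_sum g K N (fun=> H) w = M w.
  rewrite (sp_integral_grid W ab hSn) /M.
  rewrite (grid_sumB g K N (fun j _ => sp_piece a b (S n) j) (fun=> H)).
  by rewrite grid_sum_cst.
have mG : measurable_fun setT (fun w => grid_sum g K N (fun=> H) w).
  rewrite (_ : (fun w => _) = fun w => sp_integral W (S n) b w - sp_integral W (S n) a w - M w); last first.
    by apply/funext => w; rewrite -ME; ring.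
  by apply: measurable_funB => //; apply: measurable_funB; exact: mspI.
have mA0 : measurable A0.
  apply: measurable_lt_set; apply: measurableT_comp => //.
  apply: measurable_funB => //; apply: measurable_funB.
    exact: (ad _ _ bT' (mI _ bT')).
  exact: (ad _ _ aT (mI _ aT)).
(* The deviation [e] is shared as [e / 4 + e / 4 + e / 2] between the simple integrals at [b] and at
   [a] and the elementary integral [M]. *)
have sub : A0 `<=` A1 `|` A2 `|` A3.
  move=> w; rewrite /A0 /A1 /A2 /A3 /= !lte_fin -ME => h0.
  have [k1|k1] := ltP (e / 4) `|sp_integral W (S n) b w - I b w|; first by left; left.
  have [k2|k2] := ltP (e / 4) `|sp_integral W (S n) a w - I a w|; first by left; right.
  right.
  have := ler_normD (- (sp_integral W (S n) b w - I b w) + (sp_integral W (S n) a w - I a w))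
    (sp_integral W (S n) b w - sp_integral W (S n) a w - grid_sum g K N (fun=> H) w).
  have := ler_normD (- (sp_integral W (S n) b w - I b w)) (sp_integral W (S n) a w - I a w).
  rewrite normrN.
  rewrite [X in `|X| <= _ -> _](_ : _ = I b w - I a w -
    sp_integral W (S n) b w + sp_integral W (S n) a w); last by ring.
  rewrite [X in _ -> `|X| <= _ -> _](_ : _ = I b w - I a w - grid_sum g K N (fun=> H) w); last by ring.
  rewrite [X in _ -> _ <= `|X| + _ -> _](_ : _ = I b w - I a w -
    sp_integral W (S n) b w + sp_integral W (S n) a w); last by ring.
  lra.
have PM := elem_int_lenglart hF hW a0 (le_trans ab bT) hM (ltW c0) e2 T0.
rewrite cE in PM.
pose QS w := sp_sqdist_sum a b (S n) (H ^~ w) w N.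
pose J w := \int[mu]_(s in `[a, b]) (sp_val (S n) s w - H s w) ^+ 2.
have mQS : measurable_fun setT QS by exact: sp_sqdist_sum_measurable.
have mJ : measurable_fun setT J by exact: fine_sp_sqdist_measurable.
pose B1 := [set w | c < QS w].
pose B2 := [set w | c / 2 < `|QS w - J w|].
pose B3 := [set w | ((c / 2)%:E < `|\int[mu]_(s in `[0%R, T]) ((sp_val (S n) s w - H s w) ^+ 2)%:E|)%E].
pose G := [set w | {within `[0, T], continuous (H ^~ w)}].
have nG : P.-negligible (~` G) by exact: cH.
have mGc : measurable (~` G) by exact: negligible_measurable.
have mB2 : measurable B2.
  by apply: measurable_lt_set; apply: measurableT_comp => //; exact: measurable_funB.
have mB3 : measurable B3.
  have mE := measurableT_comp (@abse_measurable R setT)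
    (sp_sqdist_measurable (lexx 0) (ltW T0) (lexx T) hSn).
  by have := emeasurable_fun_o_infty measurableT mE (c / 2)%:E; rewrite setTI.
have mB1 : measurable B1 by exact: measurable_lt_set.
(* Off the null set of discontinuous paths, a Riemann sum above [c] is either far from its limit [J]
   or has [J > c / 2]; the latter bound passes to the integral over [[0, T]], the one controlled by
   the definition of the Ito integral. *)
have subB : B1 `<=` B2 `|` B3 `|` ~` G.
  move=> w; rewrite /B1 /B2 /B3 /= => cQ.
  have [Gw|nGw] := pselect (G w); last by right.
  left; have [k1|k1] := ltP (c / 2) `|QS w - J w|; [by left|right].
  have cJ : c / 2 < J w by have := ler_norm (QS w - J w); lra.
  have [iT _] := sp_sqdist (ltW T0) hSn Gw w.
  have [iab _] := sp_sqdist ab hSn (within_itvS a0 bT Gw) w.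
  have JE : ((J w)%:E = \int[mu]_(s in `[a, b]) ((sp_val (S n) s w - H s w) ^+ 2)%:E)%E.
    by rewrite /J /Rintegral fineK//; exact: integrable_fin_num.
  rewrite gee0_abs; last by apply: integral_ge0 => s _; rewrite lee_fin sqr_ge0.
  apply: (@lt_le_trans _ _ (J w)%:E); first by rewrite lte_fin.
  rewrite JE; apply: ge0_subset_integral => //.
  - by move/integrableP: iT => [].
  - by move=> s _; rewrite lee_fin sqr_ge0.
  - by move=> s /=; rewrite !in_itv/= => /andP[s1 s2]; rewrite (le_trans a0 s1) (le_trans s2 bT).
have PB1 : (P B1 <= (eps / 4 + eps / 4)%:E)%E.
  apply: (@le_trans _ _ (P (B2 `|` B3 `|` ~` G))).
    apply: le_measure; rewrite ?inE//; apply: measurableU => //; exact: measurableU.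
  apply: (le_trans (measureU2 _ _ _)) => //; first exact: measurableU.
  rewrite (measure_negligible mGc nG) adde0 EFinD.
  apply: (le_trans (measureU2 _ _ _)) => //.
  by apply: leeD; exact: ltW.
have PA3 : (P A3 <= (eps / 4 + eps / 4 + eps / 4)%:E)%E.
  by apply: (le_trans PM); rewrite EFinD; apply: leeD.
apply: (@le_trans _ _ (P (A1 `|` A2 `|` A3))).
  apply: le_measure; rewrite ?inE//.
  by apply: measurableU => //; apply: measurableU; exact: mA12.
apply: (le_trans (measureU2 _ _ _)) => //.
  by apply: measurableU; exact: mA12.
have -> : eps%:E = ((eps / 8 + eps / 8)%:E + (eps / 4 + eps / 4 + eps / 4)%:E)%E.
  by rewrite -EFinD; congr EFin; field.
apply: leeD => //.
apply: (le_trans (measureU2 _ _ _)); [exact: mA12|exact: mA12|].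
by rewrite EFinD; apply: leeD; exact: ltW.
Qed.
End ito_grid.

(** * Moments of Ito integrals *)

Section limit_in_probability.
Set Implicit Arguments.
Unset Strict Implicit.
Context {R : realType} {disp : measure_display} {Omega : measurableType disp}
  (P : probability Omega R).
Implicit Types (J M : Omega -> R).

Lemma integral_probability_cst (c : R) : (\int[P]_w c%:E = c%:E)%E.
Proof.
rewrite integral_cst; last exact: measurableT.
by rewrite -[RHS]mule1; congr (_ * _)%E; exact: probability_setT.
Qed.

(** Monotone convergence; the truncations are bounded whatever is known of the moments of [J]. *)
Lemma moment_le_truncated (p : R) J (B : \bar R) : 0 <= p -> measurable_fun setT J ->
  (forall l, 0 <= l -> (\int[P]_w ((Num.min `|J w| l) `^ p)%:E <= B)%E) ->
  (moment P p J <= B)%E.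
Proof.
move=> p0 mJ hB; rewrite /moment.
have mt n : measurable_fun setT (fun w => ((Num.min `|J w| n%:R) `^ p)).
  apply: (measurableT_comp (measurable_powR p)) => //.
  by apply: measurable_minr => //; exact: measurableT_comp.
have hm w : {homo (fun n : nat => ((Num.min `|J w| n%:R) `^ p)%:E) : n m / (n <= m)%N >-> (n <= m)%E}.
  move=> n k nk; rewrite lee_fin; apply: ge0_ler_powR => //; rewrite ?nnegrE ?le_min ?normr_ge0 ?ler0n//=.
  by rewrite ge_min lexx/= ge_min ler_nat nk orbT.
have := @cvg_monotone_convergence _ _ _ P setT measurableT
  (fun n w => ((Num.min `|J w| n%:R) `^ p)%:E)
  (fun n => iffRL (measurable_EFinP _ _) (mt n))
  (fun n w _ => powR_ge0 _ _) (fun w _ => hm w).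
rewrite [X in _ --> X](_ : _ = \int[P]_w (`|J w| `^ p)%:E)%E.
  move=> hc; have <- := cvg_lim (@ereal_hausdorff R) hc.
  apply: lime_le; first by apply/cvg_ex; eexists; exact: hc.
  by apply: nearW => n; exact: hB.
apply: eq_integral => w _; apply/cvg_lim => //.
apply: cvg_near_cst; exists (Num.truncn `|J w|).+1 => // n /= hn.
rewrite min_l// ltW//; apply: (lt_le_trans (truncnS_gt _)).
by rewrite ler_nat.
Qed.

(** With [J] truncated at [l], the exceptional event [A] costs at most [l^p P(A)], and its
    probability may be chosen after [l]. Off the event [|J| <= |M| + e], which costs the factor
    [2^p]. *)
Lemma inprob_moment_le (p : R) J (B : R) : 0 < p -> measurable_fun setT J ->
  (forall e eps, 0 < e -> 0 < eps -> exists M, [/\ measurable_fun setT M,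
     (P [set w | e < `|J w - M w|]%R <= eps%:E)%E & (moment P p M <= B%:E)%E]) ->
  (moment P p J <= (2 `^ p * B)%:E)%E.
Proof.
move=> p0 mJ hM; apply: moment_le_truncated => //; first exact: ltW.
move=> l l0; apply/lee_addgt0Pr => eps eps0.
have tp0 : 0 < 2 `^ p :> R by rewrite powR_gt0.
(* Chosen so that [2^p e^p = eps / 2]. *)
pose e := (eps / 2 / 2 `^ p) `^ p^-1.
have ep : e `^ p = eps / 2 / 2 `^ p.
  by rewrite /e -powRrM mulVf ?gt_eqF// powRr1// !divr_ge0// ltW.
have e0 : 0 < e by rewrite powR_gt0// !divr_gt0.
(* Chosen so that [l^p ep2 <= eps / 2]; the added 1 covers [l = 0]. *)
pose ep2 := eps / 2 / (l `^ p + 1).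
have ll : 0 < l `^ p + 1 by rewrite ltr_wpDl// powR_ge0.
have ep20 : 0 < ep2 by rewrite !divr_gt0.
have [M [mM PM hB]] := hM e ep2 e0 ep20.
set A := [set w | e < `|J w - M w|]%R.
have mA : measurable A.
  apply: measurable_lt_set; apply: measurableT_comp => //.
  exact: measurable_funB.
have mP (U : Omega -> R) : measurable_fun setT U -> measurable_fun setT (fun w => `|U w| `^ p).
  by move=> mU; apply: measurable_normr_powR.
apply: (@le_trans _ _ (\int[P]_w (2 `^ p * (`|M w| `^ p + e `^ p) + l `^ p * \1_A w)%:E)%E).
  apply: ge0_le_integralR.
  - apply: (measurableT_comp (measurable_powR p)) => //.
    by apply: measurable_minr => //; exact: measurableT_comp.
  - apply: measurable_funD.
      apply: measurable_funM => //; apply: measurable_funD => //; exact: mP.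
    by apply: measurable_funM => //; exact: measurable_indic.
  - by move=> w; exact: powR_ge0.
  - move=> w; rewrite indicE; have [wA|wA] := boolP (w \in A).
      apply: (@le_trans _ _ (l `^ p)).
        apply: ge0_ler_powR => //; rewrite ?nnegrE ?(ltW p0)//; last by rewrite ge_min lexx orbT.
        by rewrite le_min normr_ge0.
      by rewrite mulr1 lerDr mulr_ge0 ?powR_ge0// addr_ge0 ?powR_ge0.
    rewrite mulr0 addr0; apply: (@le_trans _ _ ((`|M w| + e) `^ p)).
      apply: ge0_ler_powR => //; rewrite ?nnegrE ?(ltW p0)//.
      + by rewrite le_min normr_ge0.
      + by rewrite addr_ge0// ltW.
      + rewrite ge_min; apply/orP; left.
        have : `|J w - M w| <= e.
          by rewrite leNgt; apply: contra wA => h; rewrite inE.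
        have := ler_normD (J w - M w) (M w); rewrite subrK; lra.
    by apply: powRD_le => //; exact: ltW.
rewrite ge0_integralDR; last 4 first.
- apply: measurable_funM => //; apply: measurable_funD => //; exact: mP.
- by apply: measurable_funM => //; exact: measurable_indic.
- by move=> w; rewrite mulr_ge0 ?powR_ge0// addr_ge0 ?powR_ge0.
- by move=> w; rewrite mulr_ge0 ?powR_ge0// indicE.
rewrite ge0_integralZlR ?powR_ge0//; last 2 first.
- by apply: measurable_funD => //; exact: mP.
- by move=> w; rewrite addr_ge0 ?powR_ge0.
rewrite ge0_integralZlR ?powR_ge0//.
rewrite integral_indic// setIT.
rewrite ge0_integralDR; [|exact: mP|by []|by move=> w; exact: powR_ge0|by move=> w; exact: powR_ge0].
rewrite integral_probability_cst ep.
have h1 : ((2 `^ p)%:E * (\int[P]_x (`|M x| `^ p)%:E + (eps / 2 / 2 `^ p)%:E) <=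
    (2 `^ p * B + eps / 2)%:E)%E.
  apply: (@le_trans _ _ ((2 `^ p)%:E * (B%:E + (eps / 2 / 2 `^ p)%:E))%E).
    by apply: lee_wpmul2l; [rewrite lee_fin ltW|apply: leeD].
  by rewrite -EFinD -EFinM lee_fin mulrDr [X in _ + X <= _]mulrC divfK ?gt_eqF.
have h2 : ((l `^ p)%:E * P A <= (eps / 2)%:E)%E.
  apply: (@le_trans _ _ ((l `^ p)%:E * ep2%:E)%E).
    by apply: lee_wpmul2l => //; rewrite lee_fin powR_ge0.
  rewrite -EFinM lee_fin /ep2 mulrA ler_pdivrMr// [_ * (eps / 2)]mulrC.
  by rewrite ler_pM2l ?divr_gt0// lerDl.
apply: (le_trans (leeD h1 h2)).
by rewrite -!EFinD lee_fin; lra.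
Qed.

(** Convergence in probability with bounded second moments gives convergence of means: on the bad
    event [E] one uses [x <= eta x^2 + 1 / eta] for [x = |J - M|], elsewhere [x <= eps / 4]. *)
Lemma inprob_mean0 J (B : R) (A : set Omega) : measurable_fun setT J -> measurable A ->
  (moment P 2 J < +oo)%E ->
  (forall e eps, 0 < e -> 0 < eps -> exists M, [/\ measurable_fun setT M,
     (P [set w | e < `|J w - M w|]%R <= eps%:E)%E, (moment P 2 M <= B%:E)%E &
     (\int[P]_w (\1_A w * M w)%:E = 0)%E]) ->
  (\int[P]_w (\1_A w * J w)%:E = 0)%E.
Proof.
move=> mJ mA fJ hM.
have iJ := moment2_integrable mJ fJ.
have m1 (U : Omega -> R) : measurable_fun setT U -> measurable_fun setT (fun w => \1_A w * U w).
  by move=> mU; apply: measurable_funM => //; exact: measurable_indic.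
have i1 (U : Omega -> R) : measurable_fun setT U -> P.-integrable setT (EFin \o U) ->
    P.-integrable setT (EFin \o (fun w => \1_A w * U w)).
  move=> mU iU; apply: (@le_integrableR _ _ _ P _ (fun w => `|U w|)) => //; first exact: m1.
    by move=> w; rewrite normrM indicE normr_nat; case: (_ \in _); rewrite ?mul1r ?mul0r.
  exact: (integrable_abse iU).
pose D := fine (moment P 2 J).
have DE : moment P 2 J = D%:E by rewrite fineK// ge0_fin_numE// moment_ge0.
have D0 : 0 <= D by rewrite fine_ge0// moment_ge0.
pose S := 4 * (D + `|B|) + 1.
have S0 : 0 < S by rewrite ltr_wpDl// mulr_ge0// addr_ge0.
apply/eqP; rewrite -abse_eq0; apply/eqP/le_anti; rewrite abse_ge0 andbT.
apply/lee_addgt0Pr => eps eps0; rewrite add0e.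
(* [eta] makes the quadratic term at most [eps / 4]; [ep2] then makes [P(E) / eta] at most
   [eps / 4]. *)
pose eta := eps / 4 / S.
have eta0 : 0 < eta by rewrite !divr_gt0.
have e0 : 0 < eps / 4 by rewrite divr_gt0.
pose ep2 := eps / 4 * eta.
have ep20 : 0 < ep2 by rewrite mulr_gt0.
have [M [mM PM fM M0]] := hM (eps / 4) ep2 e0 ep20.
have iM : P.-integrable setT (EFin \o M).
  by apply: (moment2_integrable mM); apply: (le_lt_trans fM); exact: ltry.
set E := [set w | eps / 4 < `|J w - M w|]%R.
have mE : measurable E.
  apply: measurable_lt_set; apply: measurableT_comp => //.
  exact: measurable_funB.
have -> : (\int[P]_w (\1_A w * J w)%:E = \int[P]_w (\1_A w * (J w - M w))%:E)%E.
  have <- : (\int[P]_w ((\1_A w * J w)%:E - (\1_A w * M w)%:E) =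
    \int[P]_w (\1_A w * (J w - M w))%:E)%E.
    by apply: eq_integral => w _; rewrite -EFinB mulrBr.
  rewrite integralB//; [|exact: i1|exact: i1].
  by rewrite M0 sube0.
apply: (le_trans (le_abse_integral P measurableT _)).
  by apply/measurable_EFinP; apply: m1; exact: measurable_funB.
have msq (U : Omega -> R) : measurable_fun setT U -> measurable_fun setT (fun w => `|U w| `^ 2).
  by move=> mU; apply: measurable_normr_powR.
apply: (@le_trans _ _ (\int[P]_w (eps / 4 + eta * (4 * (`|J w| `^ 2 + `|M w| `^ 2)) +
    (eta^-1 * \1_E w))%:E)%E).
  apply: ge0_le_integralR.
  - by apply: measurableT_comp => //; apply: m1; exact: measurable_funB.
  - apply: measurable_funD.
      apply: measurable_funD => //; apply: measurable_funM => //; apply: measurable_funM => //.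
      by apply: measurable_funD; exact: msq.
    by apply: measurable_funM => //; exact: measurable_indic.
  - by move=> w.
  - move=> w; rewrite !(powR_mulrn 2)// !real_normK ?num_real//.
    apply: (@le_trans _ _ `|J w - M w|).
      by rewrite normrM indicE normr_nat; case: (_ \in _); rewrite ?mul1r ?mul0r.
    have h4 : (J w - M w) ^+ 2 <= 4 * (J w ^+ 2 + M w ^+ 2).
      have := sqr_ge0 (J w + M w); have := sqr_ge0 (J w); have := sqr_ge0 (M w).
      by rewrite sqrrD sqrrB; lra.
    have h5 : 0 <= eta * (4 * (J w ^+ 2 + M w ^+ 2)).
      by rewrite (mulr_ge0 (ltW eta0))// mulr_ge0// addr_ge0 ?sqr_ge0.
    rewrite indicE; have [wE|wE] := boolP (w \in E).
      have h6 : eta * (J w - M w) ^+ 2 <= eta * (4 * (J w ^+ 2 + M w ^+ 2)).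
        by rewrite ler_pM2l.
      have ei0 : 0 < eta^-1 by rewrite invr_gt0.
      have := sqr_ge0 (eta * `|J w - M w| - 1).
      rewrite sqrrB exprMn real_normK ?num_real// expr1n mulr1 => h7.
      have {}h7 : 0 <= eta^-1 * (eta ^+ 2 * (J w - M w) ^+ 2 - (eta * `|J w - M w|) *+ 2 + 1).
        by rewrite mulr_ge0// ltW.
      have E2 : eta^-1 * (eta ^+ 2 * (J w - M w) ^+ 2 - (eta * `|J w - M w|) *+ 2 + 1) =
        eta * (J w - M w) ^+ 2 - 2 * `|J w - M w| + eta^-1.
        by field; rewrite gt_eqF.
      rewrite mulr1; have := normr_ge0 (J w - M w); lra.
    have : `|J w - M w| <= eps / 4.
      by rewrite leNgt; apply: contra wE => h; rewrite inE.
    rewrite mulr0; lra.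
rewrite ge0_integralDR; last 4 first.
- apply: measurable_funD => //; apply: measurable_funM => //; apply: measurable_funM => //.
  by apply: measurable_funD; exact: msq.
- by apply: measurable_funM => //; exact: measurable_indic.
- by move=> w; rewrite (addr_ge0 (ltW e0))// (mulr_ge0 (ltW eta0))// mulr_ge0// addr_ge0// powR_ge0.
- by move=> w; rewrite mulr_ge0 ?indicE// invr_ge0 (ltW eta0).
have eta0' := ltW eta0.
have pos w : 0 <= 4 * (`|J w| `^ 2 + `|M w| `^ 2) by rewrite mulr_ge0// addr_ge0// powR_ge0.
rewrite ge0_integralDR; last 4 first.
- by [].
- apply: measurable_funM => //; apply: measurable_funM => //.
  by apply: measurable_funD; exact: msq.
- by move=> w; exact: ltW.
- by move=> w; exact: mulr_ge0.
rewrite integral_probability_cst.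
rewrite ge0_integralZlR//; last first.
  by apply: measurable_funM => //; apply: measurable_funD; exact: msq.
rewrite ge0_integralZlR//; [|exact: (measurable_funD (msq _ mJ) (msq _ mM))].
rewrite ge0_integralDR; [|exact: msq|exact: msq|by move=> w; exact: powR_ge0|by move=> w; exact: powR_ge0].
rewrite ge0_integralZlR ?invr_ge0//.
rewrite integral_indic// setIT.
have h1 : (eta%:E * (4%:E * (\int[P]_x (`|J x| `^ 2)%:E + \int[P]_x (`|M x| `^ 2)%:E)) <=
   (eps / 4)%:E)%E.
  apply: (@le_trans _ _ (eta%:E * (4%:E * (D%:E + `|B|%:E)))%E).
    apply: lee_wpmul2l; first by rewrite lee_fin.
    apply: lee_wpmul2l => //.
    apply: leeD; first by rewrite -DE.
    by apply: (le_trans fM); rewrite lee_fin ler_norm.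
  rewrite -EFinD -!EFinM lee_fin /eta mulrAC ler_pdivrMr// ler_pM2l//.
  by rewrite /S lerDl.
have h2 : ((eta^-1)%:E * P E <= (eps / 4)%:E)%E.
  apply: (@le_trans _ _ ((eta^-1)%:E * ep2%:E)%E).
    by apply: lee_wpmul2l => //; rewrite lee_fin invr_ge0.
  by rewrite -EFinM lee_fin /ep2 mulrC mulfK// gt_eqF.
apply: (le_trans (leeD (leeD (lexx _) h1) h2)).
by rewrite -!EFinD lee_fin; lra.
Qed.
End limit_in_probability.

(** * Moments and means of the remainder of an Ito integral *)

Section ito_moments.
Set Implicit Arguments.
Unset Strict Implicit.
Context {R : realType} {disp : measure_display} {Omega : measurableType disp}
  (P : probability Omega R) (T : R) (F : R -> set (set Omega))
  (hF : usual_filtration P T F) (W : R -> Omega -> R)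
  (hW : brownian_motion P T F W).
Hypothesis T0 : 0 < T.
Variables H I : R -> Omega -> R.
Hypothesis mH : forall s, 0 <= s <= T -> smeasurable (F s) (H s).
Hypothesis cH : {ae P, forall w, {within `[0, T], continuous (H ^~ w)}}.
Hypothesis hI : ito_integral P T F W H I.
Variables (a b : R) (xi : Omega -> R).
Hypotheses (a0 : 0 <= a) (ab : a < b) (bT : b <= T) (mxi : smeasurable (F a) xi).

Let aT : 0 <= a <= T. Proof. by rewrite a0 (le_trans (ltW ab)). Qed.
Let bT' : 0 <= b <= T. Proof. by rewrite bT (le_trans a0 (ltW ab)). Qed.

(** For [F a]-measurable [xi] this is the Ito integral of [H - xi] over [[a, b]], written out so
    that no linearity of the integral is required. *)
Definition ito_remainder w := I b w - I a w - xi w * (W b w - W a w).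

Lemma ito_remainder_smeasurable : smeasurable (F b) ito_remainder.
Proof.
have sF := filtration_sigma hF bT'.
have Fab : F a `<=` F b by apply: (filtration_mono hF) => //; exact: ltW.
have [mI _ _] := hI.
apply: smeasurableB => //.
  apply: smeasurableB => //; first exact: mI.
  by apply: smeasurableS Fab _; exact: mI.
apply: smeasurableM => //; first by apply: smeasurableS Fab _; exact: mxi.
apply: smeasurableB => //; first exact: (bm_adapted hW).
by apply: smeasurableS Fab _; exact: (bm_adapted hW).
Qed.

Lemma ito_remainder_measurable : measurable_fun setT ito_remainder.
Proof. by apply: (adapted_measurable hF bT'); exact: ito_remainder_smeasurable. Qed.

Let mHx s : a <= s <= b -> measurable_fun setT (fun w => H s w - xi w).
Proof.
move=> /andP[s1 s2].
have sT : 0 <= s <= T by rewrite (le_trans a0 s1) (le_trans s2 bT).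
apply: measurable_funB.
  by apply: (adapted_measurable hF sT); exact: mH.
exact: (adapted_measurable hF aT).
Qed.

(** For the constant [xi] the grid sum telescopes to [xi (W b - W a)], so the error is that of the
    Ito integral of [H] alone. The bound on [Q p] holds for every [p], hence one approximation
    serves both moments and means. *)
Lemma ito_remainder_approx (e eps : R) : 0 < e -> 0 < eps ->
  exists M Q, [/\ elem_int T F W a b M Q,
    (P [set w | e < `|ito_remainder w - M w|]%R <= eps%:E)%E &
    forall (p K : R), (forall s, a <= s <= b -> (moment P p (fun w => H s w - xi w)%R <= K%:E)%E) ->
      (\int[P]_w (Q p w)%:E <= (K * (b - a))%:E)%E].
Proof.
move=> e0 eps0.
have [g [K [N [g0 gh gK hP]]]] := ito_grid_approx hF hW T0 mH cH hI a0 (ltW ab) bT e0 eps0.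
have gm j : (j <= K)%N -> a <= g j <= b.
  by move=> jK; rewrite -{1}g0 -gK !gh.
have mesh_ab j i : (j < K)%N -> (i <= N.+1)%N -> a <= mesh (g j) (g j.+1) N.+1 i <= b.
  move=> jK iN; have /andP[g1 _] := gm j (ltnW jK); have /andP[_ g2] := gm j.+1 jK.
  have /andP[i1 i2] := mesh_itv (gh j j.+1 (leqnSn j)) iN.
  by rewrite (le_trans g1 i1) (le_trans i2 g2).
have := @elem_int_meshes R disp Omega T F W a g K N
    (fun j s w => H s w - xi w) g0 gh.
rewrite gK => /(_ bT) hM.
have {}hM := hM _.
exists (grid_sum W g K N (fun j s w => H s w - xi w)); eexists; split.
- apply: hM => j i jK iN; have /andP[i1 i2] := mesh_ab j i jK (ltnW iN).
  have sT : 0 <= mesh (g j) (g j.+1) N.+1 i <= T by rewrite (le_trans a0 i1) (le_trans i2 bT).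
  apply: smeasurableB; [exact: (filtration_sigma hF sT)|exact: mH|].
  apply: smeasurableS mxi; apply: (filtration_mono hF) => //.
  by move/andP: sT => [].
- apply: le_trans hP; rewrite le_eqVlt; apply/orP; left; apply/eqP; congr (P _).
  suff key w : ito_remainder w - grid_sum W g K N (fun _ s w => H s w - xi w) w =
      I b w - I a w - grid_sum W g K N (fun=> H) w.
    by apply/seteqP; split => w /=; rewrite key.
  rewrite /ito_remainder (grid_sumB W g K N (fun=> H) (fun _ _ => xi)) grid_sum_cst -mulr_sumr.
  rewrite -(big_mkord xpredT (fun j => W (g j.+1) w - W (g j) w)).
  by rewrite (telescope_sumr (fun j => W (g j) w))// gK g0; ring.
move=> p k hk /=.
have c0 j : 0 <= (g j.+1 - g j) / N.+1%:R by rewrite divr_ge0// subr_ge0 gh.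
have mt j i : (j < K)%N -> (i < N.+1)%N -> measurable_fun setT (fun w =>
    `|H (mesh (g j) (g j.+1) N.+1 i) w - xi w| `^ p * ((g j.+1 - g j) / N.+1%:R)).
  move=> jK iN; apply: measurable_funM => //; apply: measurable_normr_powR.
  by apply: mHx; apply: mesh_ab => //; exact: ltnW.
under eq_integral do rewrite -sumEFin.
rewrite ge0_integral_sum//; last 2 first.
- move=> j; apply/measurable_EFinP; apply: measurable_sum => i; exact: mt.
- by move=> j w _; rewrite lee_fin sumr_ge0// => i _; rewrite mulr_ge0 ?powR_ge0.
have -> : (k * (b - a))%:E = (\sum_(j < K) \sum_(i < N.+1)
    (k * ((g j.+1 - g j) / N.+1%:R))%:E)%E.
  under eq_bigr do rewrite sumEFin.
  rewrite sumEFin; congr EFin.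
  transitivity (\sum_(j < K) (k * (g j.+1 - g j))).
    rewrite -mulr_sumr -(big_mkord xpredT (fun j => g j.+1 - g j)).
    by rewrite telescope_sumr// gK g0.
  apply: eq_bigr => j _; rewrite sumr_const card_ord -[RHS]mulr_natr -!mulrA mulVf ?mulr1// pnatr_eq0.
apply: lee_sum => j _.
under eq_integral do rewrite -sumEFin.
rewrite ge0_integral_sum//; last 2 first.
- by move=> i; apply/measurable_EFinP; exact: mt.
- by move=> i w _; rewrite lee_fin mulr_ge0 ?powR_ge0.
apply: lee_sum => i _.
under eq_integral do rewrite mulrC.
rewrite ge0_integralZlR//; last first.
  by apply: measurable_normr_powR; apply: mHx; apply: mesh_ab => //; exact: ltnW.
rewrite [k * _]mulrC [X in (_ <= X)%E]EFinM; apply: lee_wpmul2l; first by rewrite lee_fin.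
by apply: hk; apply: mesh_ab => //; exact: ltnW.
Qed.

(** [2^p] is lost in the limit in probability; [expR cstep * cstep] is the Gronwall constant when
    the horizon equals the interval length. *)
Definition cito (p : R) : R := 2 `^ p * (expR cstep * cstep).

Lemma cito_ge0 p : 0 <= cito p.
Proof. by rewrite mulr_ge0 ?powR_ge0// mulr_ge0 ?expR_ge0// ltW// cstep_gt0. Qed.

Lemma ito_remainder_moment (p K : R) : 2 <= p <= 4 ->
  (forall s, a <= s <= b -> (moment P p (fun w => H s w - xi w)%R <= K%:E)%E) ->
  (moment P p ito_remainder <= (cito p * K * (b - a) `^ (p / 2))%:E)%E.
Proof.
move=> p24 hK; have ba0 : 0 < b - a by rewrite subr_gt0.
have p0 : 0 < p by case/andP: p24 => [p2 _]; apply: lt_le_trans p2.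
have bb : (b - a) `^ (p / 2) = (b - a) `^ (p / 2 - 1) * (b - a).
  by rewrite [RHS]mulrC (mulr_powRB1 (ltW ba0))// divr_gt0.
have -> : cito p * K * (b - a) `^ (p / 2) =
    2 `^ p * (expR cstep * (cstep * (b - a) `^ (p / 2 - 1)) * (K * (b - a))).
  by rewrite bb /cito; ring.
apply: inprob_moment_le => //; first exact: ito_remainder_measurable.
move=> e eps e0 eps0; have [M [Q [hM hP hQ]]] := ito_remainder_approx e0 eps0.
exists M; split => //.
  by have [] := elem_int_measurable hF hW a0 (le_trans (ltW ab) bT) hM.
apply: (le_trans (elem_int_moment hF hW a0 (le_trans (ltW ab) bT) p24 ba0 hM (lexx _))).
rewrite mulfK ?gt_eqF// [X in (_ <= X)%E]EFinM; apply: lee_wpmul2l.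
  rewrite lee_fin mulr_ge0 ?expR_ge0// mulr_ge0 ?powR_ge0//.
  by rewrite ltW// cstep_gt0.
exact: hQ.
Qed.

Lemma ito_remainder_mean0 (K : R) (A : set Omega) : F a A ->
  (forall s, a <= s <= b -> (moment P 2 (fun w => H s w - xi w)%R <= K%:E)%E) ->
  (\int[P]_w (\1_A w * ito_remainder w)%:E = 0)%E.
Proof.
move=> FA hK; have ba0 : 0 < b - a by rewrite subr_gt0.
have p24 : (2 : R) <= 2 <= (4 : R) by rewrite lexx ler_nat.
have mR := ito_remainder_moment p24 hK.
apply: (inprob_mean0 (B := expR cstep * (cstep * (b - a) `^ (2 / 2 - 1)) * (K * (b - a)))).
- exact: ito_remainder_measurable.
- exact: (filtration_sub hF aT).
- by apply: (le_lt_trans mR); exact: ltry.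
move=> e eps e0 eps0; have [M [Q [hM hP hQ]]] := ito_remainder_approx e0 eps0.
exists M; split => //.
- by have [] := elem_int_measurable hF hW a0 (le_trans (ltW ab) bT) hM.
- apply: (le_trans (elem_int_moment hF hW a0 (le_trans (ltW ab) bT) p24 ba0 hM (lexx _))).
  rewrite mulfK ?gt_eqF// [X in (_ <= X)%E]EFinM; apply: lee_wpmul2l; last exact: hQ.
  rewrite lee_fin mulr_ge0 ?expR_ge0// mulr_ge0 ?powR_ge0//.
  by rewrite ltW// cstep_gt0.
- have [] // := elem_int_mean0 hF hW a0 (le_trans (ltW ab) bT) hM FA.
  by apply: (le_lt_trans (hQ 2 K hK)); exact: ltry.
Qed.
End ito_moments.

(** * Moments of time integrals *)

Section drift.
Set Implicit Arguments.
Unset Strict Implicit.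
Context {R : realType}.

(** The tangent bound for the concave power [1 / p], evaluated at [z^p]. *)
Lemma powR_ge_tangent (p z : R) : 1 <= p -> 0 <= z -> 1 + p * (z - 1) <= z `^ p.
Proof.
move=> p1 z0; have p0 : 0 < p by rewrite (lt_le_trans _ p1).
have h := @powR_le_tangent R (z `^ p) p^-1 (powR_ge0 _ _).
have {}h : z <= 1 + p^-1 * (z `^ p - 1).
  move: h; rewrite -powRrM mulfV ?gt_eqF// powRr1//; apply.
  by rewrite invr_ge0 ltW//= invf_le1.
have : p * (z - 1) <= p * (p^-1 * (z `^ p - 1)) by rewrite ler_pM2l//; lra.
rewrite mulrA mulfV ?gt_eqF// mul1r; lra.
Qed.

(** Jensen's inequality: the tangent bound at the mean [m] is summed, and the linear terms
    cancel. *)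
Lemma powR_mean_le (p : R) n (u : 'I_n.+1 -> R) : 1 <= p -> (forall i, 0 <= u i) ->
  ((\sum_i u i) / n.+1%:R) `^ p <= (\sum_i u i `^ p) / n.+1%:R.
Proof.
move=> p1 u0; have p0 : 0 < p by rewrite (lt_le_trans _ p1).
have n0 : 0 < n.+1%:R :> R by rewrite ltr0n.
set m := _ / _; have m0 : 0 <= m by rewrite divr_ge0// sumr_ge0.
have [->|mn0] := eqVneq m 0.
  by rewrite powR0 ?gt_eqF// divr_ge0// sumr_ge0// => i _; exact: powR_ge0.
have mp : 0 < m by rewrite lt_neqAle eq_sym mn0.
rewrite ler_pdivlMr//.
have E : m `^ p * n.+1%:R = \sum_(i < n.+1) m `^ p * (1 + p * (u i / m - 1)).
  rewrite -mulr_sumr big_split/= sumr_const card_ord -mulr_sumr sumrB -mulr_suml.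
  rewrite sumr_const card_ord (_ : \sum_(i < n.+1) u i = m * n.+1%:R).
    by rewrite mulrAC mulfV// mul1r subrr mulr0 addr0.
  by rewrite /m divfK ?gt_eqF.
rewrite E; apply: ler_sum => i _.
rewrite -{2}(divfK mn0 (u i)) [_ * m]mulrC (powRM p m0 (divr_ge0 (u0 i) m0)).
by rewrite ler_pM2l ?powR_gt0//; apply: powR_ge_tangent => //; rewrite divr_ge0.
Qed.

Context {disp : measure_display} {Omega : measurableType disp} (P : probability Omega R).
Hypothesis cP : forall N, P.-negligible N -> measurable N.
Variables (a b : R) (U : R -> Omega -> R).
Hypothesis ab : a <= b.
Hypothesis mU : forall s, a <= s <= b -> measurable_fun setT (U s).
Hypothesis cU : {ae P, forall w, {within `[a, b], continuous (U ^~ w)}}.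
Local Notation mu := (@lebesgue_measure R).

Let mesh_ab N (i : 'I_N.+1) : a <= mesh a b N.+1 i <= b.
Proof. by apply: mesh_itv => //; exact: ltnW. Qed.

Let mS N : measurable_fun setT (fun w => riemann_sum a b (U ^~ w) N).
Proof.
rewrite /riemann_sum; apply: measurable_sum => i; apply: measurable_funM => //.
exact: mU.
Qed.

Lemma Rintegral_itv_measurable :
  measurable_fun setT (fun w => \int[mu]_(s in `[a, b]) U s w).
Proof.
apply/measurable_EFinP.
apply: (@ae_cvg_measurable _ _ _ P (fun N w => (riemann_sum a b (U ^~ w) N)%:E)) => //.
- by move=> N; apply/measurable_EFinP.
- apply: filterS cU => w cw; apply: cvg_EFin; first exact: nearW.
  exact: riemann_sum_cvg.
Qed.

(** Jensen's inequality is applied to Riemann sums and carried to the integral in probability, so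
    only moments of [U s] at fixed times enter. *)
Lemma Rintegral_itv_moment (p K : R) : 1 <= p ->
  (forall s, a <= s <= b -> (moment P p (U s) <= K%:E)%E) ->
  (moment P p (fun w => \int[mu]_(s in `[a, b]) U s w)%R <=
    (2 `^ p * ((b - a) `^ p * K))%:E)%E.
Proof.
move=> p1 hK; have p0 : 0 < p by rewrite (lt_le_trans _ p1).
have ba0 : 0 <= b - a by rewrite subr_ge0.
apply: inprob_moment_le => //; first exact: Rintegral_itv_measurable.
move=> e eps e0 eps0.
have aeS : {ae P, forall w, riemann_sum a b (U ^~ w) N @[N --> \oo] -->
    \int[mu]_(s in `[a, b]) U s w}.
  by apply: filterS cU => w cw; exact: riemann_sum_cvg.
have [N hN] := filter_ex (cvge0_lt eps0
  (ae_cvg_in_measure mS Rintegral_itv_measurable aeS e0)).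
exists (fun w => riemann_sum a b (U ^~ w) N); split => //.
  apply: le_trans (ltW hN); rewrite le_eqVlt; apply/orP; left; apply/eqP.
  by congr (P _); apply/seteqP; split => w /=; rewrite distrC.
have N0 : 0 < N.+1%:R :> R by rewrite ltr0n.
have mp (i : 'I_N.+1) : measurable_fun setT (fun w => `|U (mesh a b N.+1 i) w| `^ p).
  by apply: measurable_normr_powR; exact: mU.
apply: (@le_trans _ _ (\int[P]_w ((b - a) `^ p / N.+1%:R *
    \sum_(i < N.+1) `|U (mesh a b N.+1 i) w| `^ p)%:E)%E).
  apply: ge0_le_integralR.
  - by apply: measurable_normr_powR; exact: mS.
  - by apply: measurable_funM => //; apply: measurable_sum => i; exact: mp.
  - by move=> w; exact: powR_ge0.
  - move=> w; rewrite /riemann_sum -mulr_suml normrM [`|(b - a) / _|]ger0_norm ?divr_ge0//.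
    rewrite [`|_| * _]mulrCA powRM ?divr_ge0//.
    rewrite [X in _ <= X](_ : _ = (b - a) `^ p *
      ((\sum_(i < N.+1) `|U (mesh a b N.+1 i) w| `^ p) / N.+1%:R)); last by rewrite -!mulrA [_^-1 * _]mulrC.
    rewrite ler_wpM2l ?powR_ge0//.
    apply: le_trans (powR_mean_le p1 (fun i => normr_ge0 (U (mesh a b N.+1 i) w))).
    apply: ge0_ler_powR; rewrite ?nnegrE ?(ltW p0) ?divr_ge0 ?sumr_ge0// ?(ltW N0)//.
    by rewrite ler_pM2r ?invr_gt0//; exact: ler_norm_sum.
have c0 : 0 <= (b - a) `^ p / N.+1%:R by rewrite divr_ge0// powR_ge0.
rewrite ge0_integralZlR//; last 2 first.
- by apply: measurable_sum => i; exact: mp.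
- by move=> w; rewrite sumr_ge0// => i _; exact: powR_ge0.
have -> : ((b - a) `^ p * K)%:E = (((b - a) `^ p / N.+1%:R)%:E * (\sum_(i < N.+1) K)%:E)%E.
  rewrite -EFinM sumr_const card_ord -[K *+ _]mulr_natr; congr EFin.
  by rewrite -[RHS]mulrA [_^-1 * _]mulrCA mulVf ?mulr1// gt_eqF.
apply: lee_wpmul2l; first by rewrite lee_fin.
under eq_integral do rewrite -sumEFin.
rewrite ge0_integral_sum//; last first.
  by move=> i; apply/measurable_EFinP; exact: mp.
by rewrite -sumEFin; apply: lee_sum => i _; exact: hK.
Qed.
End drift.

(** * Euclidean norm and strongly monotone maps *)

Section euclidean.
Set Implicit Arguments.
Unset Strict Implicit.
Context {R : realType} {d : nat}.
Implicit Types (x y z : 'rV[R]_d).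

Lemma dotpC x y : dotp x y = dotp y x.
Proof. by apply: eq_bigr => i _; rewrite mulrC. Qed.

Lemma dotpDl x y z : dotp (x + y) z = dotp x z + dotp y z.
Proof. by rewrite /dotp -big_split/=; apply: eq_bigr => i _; rewrite mxE mulrDl. Qed.

Lemma dotpZl (a : R) x y : dotp (a *: x) y = a * dotp x y.
Proof. by rewrite /dotp mulr_sumr; apply: eq_bigr => i _; rewrite mxE mulrA. Qed.

Lemma dotpNl x y : dotp (- x) y = - dotp x y.
Proof. by rewrite -scaleN1r dotpZl mulN1r. Qed.

Lemma dotpDr x y z : dotp z (x + y) = dotp z x + dotp z y.
Proof. by rewrite ![dotp z _]dotpC dotpDl. Qed.

Lemma dotpZr (a : R) x y : dotp x (a *: y) = a * dotp x y.
Proof. by rewrite dotpC dotpZl dotpC. Qed.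

Lemma dotpNr x y : dotp x (- y) = - dotp x y.
Proof. by rewrite dotpC dotpNl dotpC. Qed.

Lemma dotp_ge0 x : 0 <= dotp x x.
Proof. by rewrite sumr_ge0// => i _; rewrite -expr2 sqr_ge0. Qed.

Lemma enorm_ge0 x : 0 <= enorm x. Proof. exact: sqrtr_ge0. Qed.

Lemma enorm_sqr x : enorm x ^+ 2 = dotp x x.
Proof. by rewrite sqr_sqrtr// dotp_ge0. Qed.

Lemma enorm_sqr_sum x : enorm x ^+ 2 = \sum_i x 0 i ^+ 2.
Proof. by rewrite enorm_sqr; apply: eq_bigr => i _; rewrite expr2. Qed.

Lemma normr_le_enorm x i : `|x 0 i| <= enorm x.
Proof.
rewrite -(@ler_pXn2r _ 2)// ?nnegrE ?enorm_ge0// real_normK ?num_real//.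
rewrite enorm_sqr_sum (bigD1 i)//= lerDl sumr_ge0// => j _; exact: sqr_ge0.
Qed.

Lemma enorm_eq0 x : enorm x = 0 -> x = 0.
Proof.
move=> x0; apply/rowP => i; rewrite mxE; apply/eqP; rewrite -normr_le0 -x0.
exact: normr_le_enorm.
Qed.

Lemma enorm0 : enorm (0 : 'rV[R]_d) = 0.
Proof. by rewrite /enorm /dotp big1 ?sqrtr0// => i _; rewrite mxE mul0r. Qed.

Lemma enormN x : enorm (- x) = enorm x.
Proof. by rewrite /enorm dotpNl dotpNr opprK. Qed.

Lemma enormBC x y : enorm (x - y) = enorm (y - x).
Proof. by rewrite -enormN opprB. Qed.

Lemma enormZ (a : R) x : enorm (a *: x) = `|a| * enorm x.
Proof. by rewrite /enorm dotpZl dotpZr mulrA -expr2 sqrtrM ?sqr_ge0// sqrtr_sqr. Qed.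

Lemma dotp_le x y : dotp x y <= enorm x * enorm y.
Proof.
have [x0|x0] := eqVneq (enorm x) 0.
  rewrite (enorm_eq0 x0) enorm0 mul0r /dotp big1// => i _; by rewrite mxE mul0r.
have [y0|y0] := eqVneq (enorm y) 0.
  rewrite (enorm_eq0 y0) enorm0 mulr0 /dotp big1// => i _; by rewrite mxE mulr0.
have ab : 0 < enorm x * enorm y.
  by rewrite mulr_gt0// lt_neqAle eq_sym ?x0 ?y0 enorm_ge0.
have := dotp_ge0 (enorm y *: x - enorm x *: y).
rewrite dotpDl !dotpDr !(dotpNl, dotpNr, dotpZl, dotpZr) -!enorm_sqr (dotpC y x).
move: (enorm x) (enorm y) (dotp x y) ab => a b D ab.
have -> : b * (b * a ^+ 2) + b * - (a * D) + (b * - (a * D) - a * - (a * b ^+ 2)) =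
  2 * (a * b) * (a * b - D) by ring.
by rewrite pmulr_rge0 ?subr_ge0// mulr_gt0.
Qed.

Lemma enormD_sqr x y : enorm (x + y) ^+ 2 = enorm x ^+ 2 + 2 * dotp x y + enorm y ^+ 2.
Proof. by rewrite !enorm_sqr dotpDl !dotpDr (dotpC y x); ring. Qed.

Lemma enormD_le x y : enorm (x + y) <= enorm x + enorm y.
Proof.
rewrite -(@ler_pXn2r _ 2)// ?nnegrE ?enorm_ge0 ?addr_ge0 ?enorm_ge0//.
rewrite enormD_sqr sqrrD.
have := dotp_le x y; lra.
Qed.

Lemma enormB_le x y : enorm (x - y) <= enorm x + enorm y.
Proof. by rewrite -(enormN y); exact: enormD_le. Qed.

Lemma enorm_sub_le x y : enorm x - enorm y <= enorm (x - y).
Proof. by rewrite lerBlDr -{1}(subrK y x) enormD_le. Qed.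

Lemma enorm_dist_le x y : `|enorm x - enorm y| <= enorm (x - y).
Proof.
rewrite ler_norml; have := enorm_sub_le x y; have := enorm_sub_le y x.
rewrite enormBC; lra.
Qed.

Lemma enorm_le_sum x : enorm x <= \sum_i `|x 0 i|.
Proof.
rewrite -(@ler_pXn2r _ 2)// ?nnegrE ?enorm_ge0 ?sumr_ge0//.
rewrite enorm_sqr_sum expr2 mulr_suml; apply: ler_sum => i _.
rewrite -real_normK ?num_real// expr2 ler_wpM2l//.
by rewrite (bigD1 i)//= lerDl sumr_ge0.
Qed.

Lemma coord_le_normr x i : `|x 0 i| <= `|x|.
Proof.
rewrite [leRHS]/Num.Def.normr/= mx_normrE; apply/bigmax_geP; right => /=.
by exists (0, i).
Qed.

Lemma enorm_le_normr x : enorm x <= d%:R * `|x|.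
Proof.
apply: (le_trans (enorm_le_sum x)).
apply: (@le_trans _ _ (\sum_(i < d) `|x|)); last by rewrite sumr_const card_ord mulr_natl.
by apply: ler_sum => i _; exact: coord_le_normr.
Qed.

Lemma normr_le_enorm_rV x : `|x| <= enorm x.
Proof.
rewrite [leLHS]/Num.Def.normr/= mx_normrE; apply/bigmax_leP; split=> [|[i j] _].
  exact: enorm_ge0.
by rewrite /= [i]ord1 normr_le_enorm.
Qed.

Lemma enorm_continuous_at (h : 'rV[R]_d -> R) x :
  (forall e, 0 < e -> exists2 r, 0 < r & forall y, enorm (y - x) < r -> `|h y - h x| < e) ->
  {for x, continuous h}.
Proof.
move=> H; apply/(@cvgrPdist_lt _ _ _ (nbhs x)) => e e0; have [r r0 hr] := H e e0.
(* Neighbourhoods are those of the sup norm, hence the division by the dimension; [d.+1] covers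
   [d = 0]. *)
have r'0 : 0 < r / d.+1%:R by rewrite divr_gt0// ltr0n.
apply: filterS (nbhsx_ballx x _ r'0) => y; rewrite -ball_normE/= -normrN opprB => hb.
rewrite distrC; apply: hr; apply: (le_lt_trans (enorm_le_normr _)).
apply: (@le_lt_trans _ _ (d.+1%:R * `|y - x|)); first by rewrite ler_wpM2r// ler_nat.
by rewrite mulrC -ltr_pdivlMr ?ltr0n.
Qed.

Lemma enorm_continuous : continuous (@enorm R d).
Proof.
move=> x; apply: enorm_continuous_at => e e0; exists e => // y hy.
exact: le_lt_trans (enorm_dist_le _ _) hy.
Qed.

Lemma enorm_ball_compact (r : R) : compact [set x : 'rV[R]_d | enorm x <= r].
Proof.
apply: bounded_closed_compact.
  exists r; split; first exact: num_real.
  move=> M rM x /= xr; exact: le_trans (normr_le_enorm_rV x) (le_trans xr (ltW rM)).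
rewrite (_ : [set x | _] = @enorm R d @^-1` [set s | s <= r]); last by [].
apply: closed_comp; last exact: closed_le.
by move=> x _; exact: enorm_continuous.
Qed.
End euclidean.

(** * Strongly monotone maps are onto *)

Section strongly_monotone.
Set Implicit Arguments.
Unset Strict Implicit.
Context {R : realType} {d : nat}.
Variables (G : 'rV[R]_d -> 'rV[R]_d) (c : R).
Hypothesis c0 : 0 < c.
Hypothesis Gmon : forall x y, c * enorm (x - y) ^+ 2 <= dotp (G x - G y) (x - y).
Hypothesis Glip : forall r, exists2 K, 0 < K & forall x y, enorm x <= r -> enorm y <= r ->
  enorm (G x - G y) <= K * enorm (x - y).

Lemma strongly_monotone_expand x y : c * enorm (x - y) <= enorm (G x - G y).
Proof.
have [h|h] := eqVneq (enorm (x - y)) 0; first by rewrite h mulr0 enorm_ge0.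
have h0 : 0 < enorm (x - y) by rewrite lt_neqAle eq_sym h enorm_ge0.
rewrite -(ler_pM2r h0) -mulrA -expr2.
exact: le_trans (Gmon x y) (dotp_le _ _).
Qed.

(* A minimiser of [|G y - z|] is a solution of [G y = z]: moving [y] by
   [- s (G y - z)] would otherwise decrease the residual for small [s]. *)
Lemma strongly_monotone_surj z : exists y, G y = z.
Proof.
pose N y := enorm (G y - z).
(* Outside this ball [c |x| <= N x + N 0] forces [N x > N 0], so the minimum over the ball is
   global. *)
pose r := (2 * N 0) / c.
have N0 : 0 <= N 0 by exact: enorm_ge0.
have r0 : 0 <= r by rewrite divr_ge0 ?mulr_ge0// ltW.
have cN : continuous N.
  move=> x; apply: enorm_continuous_at => e e0.
  have [K K0 hK] := Glip (enorm x + 1).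
  exists (Num.min 1 (e / K)) => [|y]; first by rewrite lt_min ltr01 divr_gt0.
  rewrite lt_min => /andP[y1 yK].
  apply: (le_lt_trans (enorm_dist_le _ _)).
  rewrite (_ : G y - z - (G x - z) = G y - G x); last by rewrite opprB addrA subrK.
  apply: (le_lt_trans (hK y x _ _)).
  - have := enormD_le (y - x) x; rewrite subrK; lra.
  - by rewrite lerDl.
  - by rewrite mulrC -ltr_pdivlMr.
have [||y ] := @compact_EVT_min _ _ N _ _ (@enorm_ball_compact R d r).
- by exists 0; rewrite /= enorm0.
- exact: continuous_subspaceT.
rewrite inE/= => yr hy.
have {}hy x : N y <= N x.
  have [xr|rx] := leP (enorm x) r; first by apply: hy; rewrite inE.
  apply: (@le_trans _ _ (N 0)); first by apply: hy; rewrite inE /= enorm0.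
  have := strongly_monotone_expand x 0; rewrite subr0.
  have := enormB_le (G x - z) (G 0 - z).
  rewrite (_ : G x - z - (G 0 - z) = G x - G 0); last by rewrite opprB addrA subrK.
  rewrite -/(N x) -/(N 0).
  have : 2 * N 0 < c * enorm x by rewrite [ltRHS]mulrC -ltr_pdivrMr.
  lra.
exists y; apply/eqP; rewrite -subr_eq0; apply/eqP; set v := G y - z.
apply: enorm_eq0; apply/eqP; apply: contraT => vn0.
have v0 : 0 < enorm v by rewrite lt_neqAle eq_sym vn0 enorm_ge0.
have [K K0 hK] := Glip (r + enorm v).
(* [s <= 1] keeps [y'] in the ball on which [K] is a Lipschitz constant. With [s K^2 <= c] the
   quadratic term adds at most [s c |v|^2], while the linear term removes at least [2 s c |v|^2]. *)
pose s := Num.min 1 (c / K ^+ 2).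
have s0 : 0 < s by rewrite lt_min ltr01 divr_gt0// exprn_gt0.
have s1 : s <= 1 by rewrite ge_min lexx.
have sK : s * K ^+ 2 <= c by rewrite -ler_pdivlMr ?exprn_gt0// ge_min lexx orbT.
pose y' := y - s *: v.
have y'y : y' - y = - (s *: v) by rewrite /y' addrC addKr.
have e1 : enorm (y' - y) = s * enorm v by rewrite y'y enormN enormZ gtr0_norm.
have le1 : enorm (G y' - G y) <= K * (s * enorm v).
  rewrite -e1; apply: hK.
    apply: (le_trans (enormB_le _ _)); rewrite enormZ gtr0_norm//.
    by apply: lerD => //; rewrite ler_piMl// ltW.
  by rewrite (le_trans yr)// lerDl ltW.
have mon := Gmon y' y; rewrite e1 y'y dotpNr dotpZr in mon.
have := hy y'; rewrite leNgt => /negP[].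
rewrite -(@ltr_pXn2r _ 2)// ?nnegrE ?enorm_ge0// /N -/v.
have -> : G y' - z = (G y' - G y) + v by rewrite /v addrA subrK.
move: (G y' - G y) le1 mon => u le1 mon.
rewrite enormD_sqr.
move: (dotp (u) v) mon => D mon.
have h1 : D <= - (c * s * enorm v ^+ 2).
  have : s * D <= s * (- (c * s * enorm v ^+ 2)).
    by move: mon; rewrite exprMn; have := sqr_ge0 s; lra.
  by rewrite ler_pM2l.
have h2 : enorm (u) ^+ 2 <= s * c * enorm v ^+ 2.
  apply: (@le_trans _ _ ((K * (s * enorm v)) ^+ 2)).
    by rewrite ler_pXn2r// ?nnegrE ?enorm_ge0// !mulr_ge0// ?enorm_ge0// ltW.
  have -> : (K * (s * enorm v)) ^+ 2 = s * (s * K ^+ 2) * enorm v ^+ 2 by ring.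
  by rewrite ler_wpM2r ?sqr_ge0// ler_pM2l.
have h3 : 0 < c * s * enorm v ^+ 2 by rewrite !mulr_gt0.
lra.
Qed.
End strongly_monotone.

(** * Coefficients and the inverse of the implicit step *)

Section coefficient_estimates.
Set Implicit Arguments.
Unset Strict Implicit.
Context {R : realType} {d : nat}.

Lemma one_powR (r : R) : 1 `^ r = 1 :> R. Proof. by rewrite powR1. Qed.

Lemma powR_le1D (a r s : R) : 0 <= a -> 0 <= r -> r <= s -> a `^ r <= 1 + a `^ s.
Proof.
move=> a0 r0 rs; have [a1|a1] := leP a 1.
  apply: (@le_trans _ _ 1); last by rewrite lerDl powR_ge0.
  by rewrite -[leRHS](one_powR r); apply: ge0_ler_powR; rewrite ?nnegrE.
apply: (@le_trans _ _ (a `^ s)); last by rewrite lerDr.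
by rewrite ler_powR// ltW.
Qed.

(** Comparing [y] with [x^q] suffices: at [y = x^q] all three terms are the same power
    [x^(4 q - 2)]. *)
Lemma powR_young_q (q x y : R) : 1 < q -> 0 <= x -> 0 <= y ->
  (x `^ (q - 1) * y) ^+ 2 <= x `^ (4 * q - 2) + y `^ ((4 * q - 2) / q).
Proof.
move=> q1 x0 y0; have q0 : 0 < q by rewrite (lt_trans _ q1).
have E (z : R) (r : R) : 0 <= z -> (z `^ r) ^+ 2 = z `^ (r * 2).
  by move=> z0; rewrite powRrM powR_mulrn ?powR_ge0.
have q10 : 0 < q - 1 by rewrite subr_gt0.
have q20 : 0 < 2 * q - 1 by lra.
have [yx|xy] := leP y (x `^ q).
  apply: (@le_trans _ _ (x `^ (4 * q - 2))); last by rewrite lerDl powR_ge0.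
  rewrite (_ : 4 * q - 2 = (q - 1 + q) * 2); last by ring.
  rewrite -E//; apply: lerXn2r; rewrite ?nnegrE ?mulr_ge0 ?powR_ge0//.
  rewrite [leRHS]powRD; last by rewrite (_ : (_ == 0) = false)//; apply/gt_eqF; lra.
  by rewrite ler_wpM2l ?powR_ge0.
apply: (@le_trans _ _ (y `^ ((4 * q - 2) / q))); last by rewrite lerDr powR_ge0.
have y1 : 0 < y by apply: le_lt_trans xy; exact: powR_ge0.
have xyq : x <= y `^ q^-1.
  have -> : x = (x `^ q) `^ q^-1 by rewrite -powRrM mulfV ?gt_eqF// powRr1.
  by apply: ge0_ler_powR; rewrite ?nnegrE ?powR_ge0 ?invr_ge0// ltW.
rewrite (_ : (4 * q - 2) / q = (q^-1 * (q - 1) + 1) * 2); last first.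
  by field; rewrite gt_eqF.
rewrite -E//; apply: lerXn2r; rewrite ?nnegrE ?mulr_ge0 ?powR_ge0//.
rewrite [leRHS]powRD; last by rewrite (gt_eqF y1) implybT.
rewrite powRr1// ler_wpM2r// powRrM; apply: ge0_ler_powR; rewrite ?nnegrE ?powR_ge0//.
exact: ltW.
Qed.

Lemma sqr_sum3_le (a b c : R) : (a + b + c) ^+ 2 <= 3 * (a ^+ 2 + b ^+ 2 + c ^+ 2).
Proof.
have := sqr_ge0 (a - b); have := sqr_ge0 (b - c); have := sqr_ge0 (a - c).
rewrite !expr2; lra.
Qed.

(** The bounds that [admissible] grants to [f] and to every [g r] alike, so that one error estimate
    serves drift and diffusion. *)
Definition coef_regular (T L q : R) (h : R -> 'rV[R]_d -> 'rV[R]_d) :=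
  [/\ forall t x, 0 <= t <= T -> enorm (h t x) <= L * (1 + enorm x `^ q),
      forall t1 t2 x, 0 <= t1 <= T -> 0 <= t2 <= T ->
        enorm (h t1 x - h t2 x) <= L * (1 + enorm x `^ q) * `|t1 - t2| `^ 2^-1 &
      forall t x1 x2, 0 <= t <= T ->
        enorm (h t x1 - h t x2) <=
        L * (1 + enorm x1 `^ (q - 1) + enorm x2 `^ (q - 1)) * enorm (x1 - x2)].

Lemma admissible_regular m T L eta q f (g : 'I_m -> R -> 'rV[R]_d -> 'rV[R]_d) :
  admissible T L eta q f g -> coef_regular T L q f /\ forall r, coef_regular T L q (g r).
Proof.
move=> h; split=> [|r]; split.
- by move=> t x tT; have [] := adm_growth h x tT.
- by move=> t1 t2 x t1T t2T; have [] := adm_time h x t1T t2T.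
- by move=> t x1 x2 tT; have [] := adm_lipschitz h x1 x2 tT.
- by move=> t x tT; have [] := adm_growth h x tT.
- by move=> t1 t2 x t1T t2T; have [] := adm_time h x t1T t2T.
- by move=> t x1 x2 tT; have [] := adm_lipschitz h x1 x2 tT.
Qed.

Section regular.
Variables (T L q : R) (h : R -> 'rV[R]_d -> 'rV[R]_d).
Hypotheses (L0 : 0 < L) (q1 : 1 < q) (hh : coef_regular T L q h).

Let q0 : 0 < q. Proof. by rewrite (lt_trans _ q1). Qed.
Let q10 : 0 < q - 1. Proof. by rewrite subr_gt0. Qed.

Lemma coef_locally_lipschitz t r : 0 <= t <= T -> exists2 K, 0 < K &
  forall x y, enorm x <= r -> enorm y <= r -> enorm (h t x - h t y) <= K * enorm (x - y).
Proof.
move=> tT; have [_ _ hl] := hh.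
exists (L * (1 + `|r| `^ (q - 1) + `|r| `^ (q - 1))) => [|x y xr yr].
  by rewrite mulr_gt0// -addrA ltr_pwDl// addr_ge0// powR_ge0.
apply: (le_trans (hl t x y tT)); rewrite ler_wpM2r ?enorm_ge0// ler_wpM2l ?(ltW L0)//.
have H z : enorm z <= r -> enorm z `^ (q - 1) <= `|r| `^ (q - 1).
  move=> zr; apply: ge0_ler_powR; rewrite ?nnegrE ?enorm_ge0// ?(ltW q10)//.
  exact: le_trans zr (ler_norm r).
by rewrite lerD ?H// lerD ?H.
Qed.

Lemma coef_growth_moment p t x : 0 <= p -> 0 <= t <= T ->
  enorm (h t x) `^ p <= L `^ p * 2 `^ p * (1 + enorm x `^ (q * p)).
Proof.
move=> p0 tT; have [hg _ _] := hh.
apply: (@le_trans _ _ ((L * (1 + enorm x `^ q)) `^ p)).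
  apply: ge0_ler_powR; rewrite ?nnegrE ?enorm_ge0//; last exact: hg.
  by rewrite (mulr_ge0 (ltW L0))// addr_ge0// powR_ge0.
rewrite powRM ?(ltW L0) ?addr_ge0 ?powR_ge0// -mulrA ler_wpM2l ?powR_ge0//.
apply: (le_trans (powRD_le _ _ _)); rewrite ?powR_ge0//.
by rewrite powR1 -powRrM.
Qed.

(* The exponents [4 q - 2] and [(4 q - 2) / q] are conjugate in Young's
   inequality for [|x|^(2 (q - 1)) D^2], where [D = |z - x| / sqrt delta]. *)
Lemma coef_error c hbar : 0 < c -> 0 < hbar -> exists2 C, 0 <= C &
  forall t s u x y z delta, 0 <= t -> t <= s -> s <= u -> u <= T -> u = t + delta ->
    0 < delta -> delta <= hbar ->
    c * enorm y <= enorm x + 1 ->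
    c * enorm (x - y) <= delta * (L * (1 + enorm x `^ q)) ->
    enorm (h s z - h u y) ^+ 2 <= C * delta *
      (1 + enorm x `^ (4 * q - 2) + enorm z `^ (4 * q - 2) +
        (enorm (z - x) / Num.sqrt delta) `^ ((4 * q - 2) / q)).
Proof.
move=> c0 hb0; have [_ ht hl] := hh.
pose P0 := 4 * q - 2; pose rho := P0 / q.
have q1' := q1; have P00 : 0 < P0 by rewrite /P0; lra.
have rho2 : 2 <= rho by rewrite /rho ler_pdivlMr// /P0; lra.
(* The Lipschitz factor at [x] and [y], with [|y| <= (1 + |x|) / c], times the constant of the stage
   distance [|x - y| <= delta (2 L / c) (1 + |x|)^q]. *)
pose K3 := L * (2 + c^-1 `^ (q - 1)) * (2 * L / c).
have ci0 : 0 <= c^-1 by rewrite invr_ge0 ltW.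
have K30 : 0 <= K3.
  by rewrite /K3 !mulr_ge0 ?addr_ge0 ?powR_ge0// ltW.
pose B3 := K3 ^+ 2 * hbar * 2 `^ P0.
have B30 : 0 <= B3 by rewrite mulr_ge0 ?powR_ge0// mulr_ge0 ?sqr_ge0// ltW.
have L20 : 0 <= L ^+ 2 by exact: sqr_ge0.
exists (3 * (4 * L ^+ 2 + 9 * L ^+ 2 + B3)); first by rewrite mulr_ge0// !addr_ge0// mulr_ge0.
move=> t s u x y z delta t0 ts su uT uE dt0 dth hy hxy.
have sT : 0 <= s <= T by rewrite (le_trans t0 ts) (le_trans su uT).
have uT' : 0 <= u <= T by rewrite uT (le_trans t0 (le_trans ts su)).
have sd : 0 < Num.sqrt delta by rewrite sqrtr_gt0.
have sdE : Num.sqrt delta ^+ 2 = delta by rewrite sqr_sqrtr// ltW.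
(* Sigma types name this and the following quantities without exposing their bodies, so that the
   arithmetic treats them as atoms. *)
have [D DE] : {r | enorm (z - x) / Num.sqrt delta = r} by eexists.
have D0 : 0 <= D by rewrite -DE divr_ge0 ?enorm_ge0// ltW.
have eE : enorm (z - x) = Num.sqrt delta * D by rewrite -DE mulrC divfK ?gt_eqF.
have a0 := enorm_ge0 x; have b0 := enorm_ge0 z.
have [a aE] : {r | enorm x = r} by eexists.
have [b bE] : {r | enorm z = r} by eexists.
rewrite DE aE bE -/P0 -/rho; rewrite aE in a0 hy hxy; rewrite bE in b0.
have [AP APE] : {r | a `^ P0 = r} by eexists.
have [BP BPE] : {r | b `^ P0 = r} by eexists.
have [DP DPE] : {r | D `^ rho = r} by eexists.
have AP0 : 0 <= AP by rewrite -APE powR_ge0.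
have BP0 : 0 <= BP by rewrite -BPE powR_ge0.
have DP0 : 0 <= DP by rewrite -DPE powR_ge0.
rewrite APE BPE DPE; have [S SE] : {r | 1 + AP + BP + DP = r} by eexists.
rewrite SE.
(* [h s z - h u y] is split at [h u z] and [h u x]: time regularity, increment of the solution,
   distance to the stage. The square of the last is of order [delta^2], and one factor is bounded by
   [hbar]. *)
have T1 : enorm (h s z - h u z) ^+ 2 <= 4 * L ^+ 2 * delta * S.
  have e1 : enorm (h s z - h u z) <= L * (1 + b `^ q) * Num.sqrt delta.
    apply: (le_trans (ht s u z sT uT')); rewrite bE ler_wpM2l//.
      by rewrite mulr_ge0 ?addr_ge0 ?powR_ge0// ltW.
    rewrite powR12_sqrt; last exact: normr_ge0.
    rewrite ler_sqrt ?(ltW dt0)//.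
    by rewrite ler0_norm; lra.
  apply: (@le_trans _ _ ((L * (1 + b `^ q) * Num.sqrt delta) ^+ 2)).
    apply: lerXn2r => //; rewrite ?nnegrE ?enorm_ge0//.
    by rewrite !mulr_ge0 ?addr_ge0 ?powR_ge0// ltW.
  rewrite !exprMn sdE (_ : 4 * L ^+ 2 * delta * S = L ^+ 2 * (4 * S) * delta); last by ring.
  rewrite ler_wpM2r ?(ltW dt0)// ler_wpM2l//.
  have : b `^ (2 * q) <= 1 + BP by rewrite -BPE; apply: powR_le1D => //; rewrite /P0; lra.
  have -> : b `^ (2 * q) = (b `^ q) ^+ 2 by rewrite mulrC powRrM powR_mulrn ?powR_ge0.
  have := sqr_ge0 (b `^ q - 1); rewrite -SE sqrrB sqrrD !expr1n; lra.
have T2 : enorm (h u z - h u x) ^+ 2 <= 9 * L ^+ 2 * delta * S.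
  have e2 : enorm (h u z - h u x) <= L * (D + b `^ (q - 1) * D + a `^ (q - 1) * D) * Num.sqrt delta.
    apply: (le_trans (hl u z x uT')); rewrite eE aE bE.
    by rewrite le_eqVlt; apply/orP; left; apply/eqP; ring.
  apply: (@le_trans _ _ ((L * (D + b `^ (q - 1) * D + a `^ (q - 1) * D) * Num.sqrt delta) ^+ 2)).
    apply: lerXn2r => //; rewrite ?nnegrE ?enorm_ge0//.
    apply: mulr_ge0 (ltW sd); apply: mulr_ge0 (ltW L0) _.
    apply: addr_ge0; last by rewrite mulr_ge0// powR_ge0.
    by rewrite addr_ge0// mulr_ge0// powR_ge0.
  rewrite !exprMn sdE (_ : 9 * L ^+ 2 * delta * S = L ^+ 2 * (9 * S) * delta); last by ring.
  rewrite ler_wpM2r ?(ltW dt0)// ler_wpM2l//.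
  have := sqr_sum3_le D (b `^ (q - 1) * D) (a `^ (q - 1) * D).
  have := powR_young_q q1 a0 D0; have := powR_young_q q1 b0 D0; rewrite -/P0 -/rho APE BPE DPE.
  have : D ^+ 2 <= 1 + DP by rewrite -powR_mulrn// -DPE; apply: powR_le1D.
  rewrite -SE; lra.
have T3 : enorm (h u x - h u y) ^+ 2 <= B3 * delta * S.
  have [a' a'E] : {r | 1 + a = r} by eexists.
  have a'0 : 0 <= a' by rewrite -a'E addr_ge0.
  have a'1 : 1 <= a' by rewrite -a'E lerDl.
  have aa' : a <= a' by rewrite -a'E lerDr.
  have p1 : 1 <= a' `^ (q - 1).
    by rewrite -[leLHS](one_powR (q - 1)); apply: ge0_ler_powR; rewrite ?nnegrE// ltW.
  have p2 : a `^ (q - 1) <= a' `^ (q - 1).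
    by apply: ge0_ler_powR; rewrite ?nnegrE// ltW.
  have p3 : enorm y `^ (q - 1) <= c^-1 `^ (q - 1) * a' `^ (q - 1).
    rewrite -powRM//; apply: ge0_ler_powR; rewrite ?nnegrE ?enorm_ge0 ?mulr_ge0// ?(ltW q10)//.
    by rewrite mulrC ler_pdivlMr// mulrC -a'E [1 + a]addrC.
  have p4 : enorm (x - y) <= delta * (2 * L / c) * a' `^ q.
    have : c * enorm (x - y) <= delta * (L * (2 * a' `^ q)).
      apply: (le_trans hxy); rewrite ler_wpM2l ?(ltW dt0)// ler_wpM2l ?(ltW L0)//.
      rewrite [2 * _](_ : _ = a' `^ q + a' `^ q); last by ring.
      apply: lerD; last by apply: ge0_ler_powR; rewrite ?nnegrE// ltW.
      by rewrite -[leLHS](one_powR q); apply: ge0_ler_powR; rewrite ?nnegrE// ltW.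
    rewrite mulrC -ler_pdivlMr// => h1; apply: (le_trans h1).
    by rewrite le_eqVlt; apply/orP; left; apply/eqP; field; rewrite gt_eqF.
  have e3 : enorm (h u x - h u y) <= K3 * delta * a' `^ (2 * q - 1).
    apply: (le_trans (hl u x y uT')); rewrite aE.
    have -> : K3 * delta * a' `^ (2 * q - 1) =
        L * ((2 + c^-1 `^ (q - 1)) * a' `^ (q - 1)) * (delta * (2 * L / c) * a' `^ q).
      rewrite (_ : 2 * q - 1 = q - 1 + q); last by ring.
      rewrite powRD; last by rewrite (_ : (_ == 0) = false)//; apply/gt_eqF; lra.
      by rewrite /K3; ring.
    apply: ler_pM => //.
    - by rewrite !mulr_ge0 ?addr_ge0 ?powR_ge0// ltW.
    - exact: enorm_ge0.
    - rewrite ler_wpM2l ?(ltW L0)//; lra.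
  apply: (@le_trans _ _ ((K3 * delta * a' `^ (2 * q - 1)) ^+ 2)).
    apply: lerXn2r => //; rewrite ?nnegrE ?enorm_ge0//.
    by rewrite mulr_ge0 ?powR_ge0// mulr_ge0// ltW.
  have -> : (K3 * delta * a' `^ (2 * q - 1)) ^+ 2 = K3 ^+ 2 * delta * delta * a' `^ P0.
    rewrite !exprMn -[X in _ * X = _]powR_mulrn ?powR_ge0// -powRrM.
    by rewrite (_ : (2 * q - 1) * 2%:R = P0); [ring|rewrite /P0; ring].
  have p5 : a' `^ P0 <= 2 `^ P0 * S.
    apply: (@le_trans _ _ (2 `^ P0 * (1 `^ P0 + a `^ P0))).
      by rewrite -a'E; apply: powRD_le => //; exact: ltW.
    by rewrite powR1 ler_wpM2l ?powR_ge0// APE -SE; lra.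
  have -> : B3 * delta * S = K3 ^+ 2 * hbar * delta * (2 `^ P0 * S) by rewrite /B3; ring.
  have k2 : 0 <= K3 ^+ 2 by exact: sqr_ge0.
  apply: ler_pM => //; [|exact: powR_ge0|].
    by apply: mulr_ge0 (ltW dt0); exact: mulr_ge0 k2 (ltW dt0).
  by rewrite ler_wpM2r ?(ltW dt0)// ler_wpM2l.
have -> : h s z - h u y = (h s z - h u z) + (h u z - h u x) + (h u x - h u y).
  by rewrite !addrA !subrK.
apply: (@le_trans _ _ (3 * (enorm (h s z - h u z) ^+ 2 + enorm (h u z - h u x) ^+ 2 +
    enorm (h u x - h u y) ^+ 2))).
  apply: le_trans (sqr_sum3_le _ _ _).
  apply: lerXn2r => //; rewrite ?nnegrE ?enorm_ge0 ?addr_ge0 ?enorm_ge0//.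
  apply: (le_trans (enormD_le _ _)); rewrite lerD2r; exact: enormD_le.
lra.
Qed.
End regular.

(** * The implicit stage of the split-step method *)

Section ssbe_inverse.
Variables (m : nat) (T L eta q : R) (f : R -> 'rV[R]_d -> 'rV[R]_d)
  (g : 'I_m -> R -> 'rV[R]_d -> 'rV[R]_d).
Hypothesis hfg : admissible T L eta q f g.
Variables (hbar delta t : R).
Hypotheses (dt0 : 0 < delta) (dth : delta <= hbar) (hL : hbar < L^-1) (tT : 0 <= t <= T).

Let L0 := adm_L hfg.
Let q1 := adm_q hfg.
Let c := 1 - hbar * L.

Lemma ssbe_c_gt0 : 0 < c.
Proof. by rewrite subr_gt0 -ltr_pdivlMr// div1r. Qed.

(** The diffusion sum in [adm_monotone] is nonnegative, which leaves a one-sided Lipschitz bound for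
    [f]; bounding [delta] by [hbar] makes the constant uniform in the step size. *)
Lemma ssbe_F_monotone x y :
  c * enorm (x - y) ^+ 2 <= dotp (ssbe_F f delta t x - ssbe_F f delta t y) (x - y).
Proof.
rewrite (_ : ssbe_F f delta t x - _ = (x - y) + (- delta) *: (f t x - f t y)); last first.
  by apply/rowP => i; rewrite !mxE; ring.
rewrite dotpDl dotpZl -enorm_sqr.
have h1 : dotp (f t x - f t y) (x - y) <= L * enorm (x - y) ^+ 2.
  apply: le_trans (adm_monotone hfg x y tT); rewrite lerDl mulr_ge0//.
    by apply: ltW; apply: lt_trans (adm_eta hfg); rewrite invr_gt0.
  by rewrite sumr_ge0// => r _; exact: sqr_ge0.
have h2 : delta * dotp (f t x - f t y) (x - y) <= delta * (L * enorm (x - y) ^+ 2).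
  by rewrite ler_pM2l.
have h3 : delta * (L * enorm (x - y) ^+ 2) <= hbar * (L * enorm (x - y) ^+ 2).
  by rewrite ler_wpM2r// mulr_ge0 ?sqr_ge0// ltW.
rewrite /c; lra.
Qed.

Lemma ssbe_F_lipschitz r : exists2 K, 0 < K & forall x y, enorm x <= r -> enorm y <= r ->
  enorm (ssbe_F f delta t x - ssbe_F f delta t y) <= K * enorm (x - y).
Proof.
have [hf _] := admissible_regular hfg.
have [K K0 hK] := coef_locally_lipschitz L0 q1 hf r tT.
exists (1 + delta * K) => [|x y xr yr]; first by rewrite ltr_wpDr// mulr_ge0// ltW.
rewrite (_ : ssbe_F f delta t x - _ = (x - y) - delta *: (f t x - f t y)); last first.
  by apply/rowP => i; rewrite !mxE; ring.
apply: (le_trans (enormB_le _ _)); rewrite enormZ gtr0_norm// mulrDl mul1r lerD2l.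
by rewrite -mulrA ler_pM2l// hK.
Qed.

(** Surjectivity of the implicit map rules out the default value of [pinv_]. *)
Lemma ssbe_FinvK x : ssbe_F f delta t (ssbe_Finv f delta t x) = x.
Proof.
rewrite /ssbe_Finv pinvK// inE.
have [y <-] := strongly_monotone_surj ssbe_c_gt0 ssbe_F_monotone ssbe_F_lipschitz x.
by exists y.
Qed.

Lemma ssbe_FinvE x :
  ssbe_Finv f delta t x = x + delta *: f t (ssbe_Finv f delta t x).
Proof. by rewrite -{2}(ssbe_FinvK x) /ssbe_F subrK. Qed.

Lemma ssbe_Finv_lipschitz x y :
  c * enorm (ssbe_Finv f delta t x - ssbe_Finv f delta t y) <= enorm (x - y).
Proof.
by rewrite -{2}(ssbe_FinvK x) -{2}(ssbe_FinvK y);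
  exact: (strongly_monotone_expand ssbe_F_monotone).
Qed.

Lemma ssbe_Finv_bound x : c * enorm (ssbe_Finv f delta t x) <= enorm x + 1.
Proof.
have := strongly_monotone_expand ssbe_F_monotone (ssbe_Finv f delta t x) 0.
rewrite subr0 ssbe_FinvK => h; apply: (le_trans h).
apply: (le_trans (enormB_le _ _)); rewrite lerD2l /ssbe_F sub0r enormN enormZ gtr0_norm//.
have [hg _] := adm_growth hfg 0 tT.
(* At the origin the growth bound is [L], so the additive constant is at most [hbar * L < 1]. *)
apply: (@le_trans _ _ (hbar * L)); last by have := ssbe_c_gt0; rewrite /c; lra.
apply: ler_pM; rewrite ?enorm_ge0 ?(ltW dt0)//.
apply: (le_trans hg); rewrite enorm0 powR0 ?addr0 ?mulr1// gt_eqF//.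
exact: lt_trans q1.
Qed.

(** Strong monotonicity is applied at [x] and at its preimage; the images differ by [delta f(t, x)],
    so the growth of [f] enters at [x] only. *)
Lemma ssbe_Finv_dist x :
  c * enorm (x - ssbe_Finv f delta t x) <= delta * (L * (1 + enorm x `^ q)).
Proof.
apply: (le_trans (strongly_monotone_expand ssbe_F_monotone _ _)).
rewrite ssbe_FinvK /ssbe_F addrAC subrr sub0r enormN enormZ gtr0_norm// ler_pM2l//.
by have [] := adm_growth hfg x tT.
Qed.
End ssbe_inverse.
End coefficient_estimates.

(** * Measurability of functions of random vectors *)

Section vector_measurability.
Set Implicit Arguments.
Unset Strict Implicit.
Context {R : realType} {d : nat}.

Lemma measurable_fun_floor_eq disp (Omega : measurableType disp) (U : Omega -> R) (k : int) :
  measurable_fun setT U -> measurable [set w | Num.floor (U w) = k].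
Proof.
move=> mU.
have -> : [set w | Num.floor (U w) = k] = U @^-1` `[k%:~R, (k + 1)%:~R[%classic.
  apply/seteqP; split => w /=.
    by move=> <-; rewrite in_itv/=; exact: floor_itv.
  by rewrite in_itv/= => h; exact: floor_def.
by rewrite -[X in measurable X]setTI; apply: mU.
Qed.

(* [Y] is approximated by vectors on a grid, which take countably many values. *)
Lemma measurable_continuous_comp disp (Omega : measurableType disp)
    (Y : Omega -> 'rV[R]_d) (h : 'rV[R]_d -> R) :
  (forall i, measurable_fun setT (fun w => Y w 0 i)) -> continuous h ->
  measurable_fun setT (fun w => h (Y w)).
Proof.
move=> mY ch.
pose k (n : nat) w : {ffun 'I_d -> int} := [ffun i => Num.floor (n.+1%:R * Y w 0 i)].
pose v (n : nat) (a : {ffun 'I_d -> int}) : 'rV[R]_d := \row_i ((a i)%:~R / n.+1%:R).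
apply: (@measurable_fun_cvg _ _ _ setT (fun n w => h (v n (k n w)))); last first.
  move=> w _; apply: (@continuous_cvg _ _ _ _ _ (fun n => v n (k n w)) h); first exact: ch.
  apply/cvgrPdist_le => e e0.
  have : \forall n \near \oo, n.+1%:R^-1 <= e.
    have := @cvg_harmonic R; move/cvgrPdist_le => /(_ _ e0); apply: filterS => n /=.
    by rewrite sub0r normrN ger0_norm ?invr_ge0.
  apply: filterS => n ne.
  rewrite [leLHS]/Num.Def.normr/= mx_normrE; apply/bigmax_leP; split=> [|[j i] _]; first exact: ltW.
  rewrite /= [j]ord1 !mxE ffunE; apply: le_trans ne.
  have n0 : 0 < n.+1%:R :> R by rewrite ltr0n.
  have /andP[h1 h2] := floor_itv (n.+1%:R * Y w 0 i).
  rewrite (_ : Y w 0 i - _ =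
    (n.+1%:R * Y w 0 i - (Num.floor (n.+1%:R * Y w 0 i))%:~R) / n.+1%:R); last first.
    by rewrite mulrBl [n.+1%:R * _]mulrC mulfK// gt_eqF.
  rewrite normrM.
  have n1 : 0 <= n.+1%:R^-1 :> R by rewrite invr_ge0 ltW.
  rewrite (ger0_norm n1) ler_piMl//.
  rewrite ger0_norm; last by rewrite subr_ge0.
  by rewrite lerBlDl -intrD1 ltW.
move=> n _ B mB; rewrite setTI.
have mk (a : {ffun 'I_d -> int}) : measurable [set w | k n w = a].
  have -> : [set w | k n w = a] =
      \big[setI/setT]_(i < d) [set w | Num.floor (n.+1%:R * Y w 0 i) = a i].
    apply/seteqP; split => w /=.
      by move=> <-; apply: (big_ind (fun S : set Omega => S w)) => //= i _; rewrite ffunE.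
    by move=> hw; apply/ffunP => i; rewrite ffunE; move: hw; rewrite (bigD1 i)//= => -[].
  apply: bigsetI_measurable => i _; apply: measurable_fun_floor_eq.
  exact: measurable_funM.
(* A countable union over the grid values, enumerated by [pickle]; a number that encodes no grid
   value contributes the empty set. *)
have -> : (fun w => h (v n (k n w))) @^-1` B =
    \bigcup_(j : nat) (if @unpickle {ffun 'I_d -> int} j is Some a then
      (if `[< B (h (v n a)) >] then [set w | k n w = a] else set0) else set0).
  apply/seteqP; split => w /=.
    by move=> hw; exists (pickle (k n w)) => //; rewrite pickleK; case: asboolP.
  by move=> [j _]; case: unpickle => // a; case: asboolP => //= hB ->.
apply: bigcupT_measurable => j; case: unpickle => // a; by case: ifP.
Qed.

Lemma vmeasurable_comp disp (Omega : measurableType disp) (G : set (set Omega))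
    (Y : Omega -> 'rV[R]_d) (h : 'rV[R]_d -> R) : sigma_algebra setT G ->
  vmeasurable G Y -> continuous h -> smeasurable G (fun w => h (Y w)).
Proof.
move=> sG mY ch; apply/(smeasurableP sG).
apply: (@measurable_continuous_comp _ (g_sigma_algebraType G) Y h) => // i.
exact/(smeasurableP sG).
Qed.

(** The coefficients are continuous only on the strip of times in [[0, T]], so the composition is
    carried out with filters restricted to [A] and [B]. *)
Lemma within_comp_pair (A : set R) (B : set (R * 'rV[R]_d)) (X : R -> 'rV[R]_d)
    (h : R * 'rV[R]_d -> 'rV[R]_d) i :
  {within A, continuous X} -> {within B, continuous h} ->
  (forall s, A s -> B (s, X s)) -> {within A, continuous (fun s => h (s, X s) 0 i)}.
Proof.
move=> /subspace_continuousP cX /subspace_continuousP ch AB.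
apply/subspace_continuousP => s As.
apply: (@continuous_cvg _ _ _ _ _ (fun s => h (s, X s)) (fun M => M 0 i)).
  exact: coord_continuous.
apply: (@cvg_comp _ _ _ _ h _ (within B (nbhs (s, X s)))); last exact: ch _ (AB _ As).
have h1 := @cvg_pair _ _ _ (within A (nbhs s)) (nbhs s) (nbhs (X s)) _ _ _ id X
  (@cvg_within _ _ _ A) (cX s As).
move=> Q hQ.
change (\forall s' \near nbhs s, A s' -> Q (s', X s')).
have h2 := h1 (within_filter _ (nbhs_filter s)) (nbhs_filter s) (nbhs_filter (X s)) (nbhs_filter s)
  (fun x => B x -> Q x) hQ.
have {h2} : \forall s' \near nbhs s, A s' -> B (s', X s') -> Q (s', X s') by exact: h2.
by apply: filterS => s' h2 As'; apply: h2 => //; exact: AB.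
Qed.

Lemma lipschitz_coord_continuous (h : 'rV[R]_d -> 'rV[R]_d) i :
  (forall r, exists2 K, 0 < K & forall x y, enorm x <= r -> enorm y <= r ->
     enorm (h x - h y) <= K * enorm (x - y)) ->
  continuous (fun x => h x 0 i).
Proof.
move=> hl x; apply: enorm_continuous_at => e e0.
have [K K0 hK] := hl (enorm x + 1).
exists (Num.min 1 (e / K)) => [|y]; first by rewrite lt_min ltr01 divr_gt0.
rewrite lt_min => /andP[y1 yK].
rewrite (_ : h y 0 i - h x 0 i = (h y - h x) 0 i); last by rewrite !mxE.
apply: (le_lt_trans (normr_le_enorm _ _)).
apply: (le_lt_trans (hK y x _ _)).
- have := enormD_le (y - x) x; rewrite subrK; lra.
- by rewrite lerDl.
- by rewrite mulrC -ltr_pdivlMr.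
Qed.

Lemma coef_coord_continuous T L q (h : R -> 'rV[R]_d -> 'rV[R]_d) t i :
  0 < L -> 1 < q -> coef_regular T L q h -> 0 <= t <= T ->
  continuous (fun x => h t x 0 i).
Proof.
move=> L0 q1 hh tT; apply: lipschitz_coord_continuous => r.
exact: (coef_locally_lipschitz L0 q1 hh r tT).
Qed.

Lemma ssbe_Finv_continuous m T L eta q (f : R -> 'rV[R]_d -> 'rV[R]_d)
    (g : 'I_m -> R -> 'rV[R]_d -> 'rV[R]_d) hbar delta t i :
  admissible T L eta q f g -> 0 < delta -> delta <= hbar -> hbar < L^-1 ->
  0 <= t <= T -> continuous (fun x => ssbe_Finv f delta t x 0 i).
Proof.
move=> hfg dt0 dth hL tT; apply: lipschitz_coord_continuous => r.
have c0 := ssbe_c_gt0 hfg hL.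
exists (1 - hbar * L)^-1 => [|x y _ _]; first by rewrite invr_gt0.
rewrite mulrC ler_pdivlMr// mulrC.
exact: (ssbe_Finv_lipschitz hfg dt0 dth hL tT).
Qed.
End vector_measurability.

(** * Conditional expectation *)

Section conditional_expectation.
Set Implicit Arguments.
Unset Strict Implicit.
Context {R : realType} {disp : measure_display} {Omega : measurableType disp}
  (P : probability Omega R) (G : set (set Omega)).
Hypotheses (sG : sigma_algebra setT G) (GM : G `<=` measurable).
Implicit Types U V Z : Omega -> R.
Local Notation T' := (g_sigma_algebraType G).

Let GE (A : set Omega) : measurable (A : set T') <-> G A.
Proof.
split=> [hA|hA].
  have : (<<s G >>) A by exact: hA.
  by rewrite sigma_algebra_id.
by change ((<<s G >>) A); rewrite sigma_algebra_id.
Qed.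

Let phi : Omega -> T' := id.
Let mphi : measurable_fun setT phi.
Proof. by move=> _ A mA; rewrite setTI; apply: GM; apply/GE. Qed.
Let phi_mfun : {mfun Omega >-> T'} := HB.pack phi (isMeasurableFun.Build _ _ _ _ phi mphi).

(** Radon-Nikodym on the sub-sigma-algebra: the charge with density [V] and the probability are
    pushed forward by the identity [phi] to the type generated by [G], which makes the derivative
    [G]-measurable. *)
Lemma cond_expectation_exists V : P.-integrable setT (EFin \o V) ->
  exists Z, cond_expectation P G V Z.
Proof.
move=> iV.
pose mu' := distribution P phi_mfun.
pose nu : {charge set Omega -> \bar R} := induced_charge iV.
pose nuf : {charge set T' -> \bar R} := pushforward nu phi.
pose nu' : {charge set T' -> \bar R} := nuf mphi.
have numu : nu' `<< mu'.
  apply/null_content_dominatesP => A mA A0; rewrite /nu' /nuf /nu /= /induced_charge /pushforward.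
  have mA' : measurable (phi @^-1` A) by rewrite -[X in measurable X]setTI; exact: mphi.
  apply: null_set_integral => //.
  by have /integrableP[mV _] := iV; exact: measurable_funTS.
pose Z0 := Radon_Nikodym nu' mu'.
have fZ w : Z0 w \is a fin_num by exact: Radon_Nikodym_fin_num.
have iZ' : mu'.-integrable setT Z0 by exact: Radon_Nikodym_integrable.
have mZ' : measurable_fun (setT : set T') Z0.
  by move/integrableP: iZ' => [].
have EZ w : EFin (fine (Z0 w)) = Z0 w.
  by rewrite fineK.
have iZ : P.-integrable setT Z0.
  apply/integrableP; split; first exact: (measurableT_comp mZ' mphi).
  move/integrableP: iZ' => [_]; apply: le_lt_trans.
  rewrite /mu' /distribution (ge0_integral_pushforward mphi)//.
  by apply: measurableT_comp.
pose Z w := fine (Z0 w).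
have EZ' : EFin \o Z = Z0 by apply/funext => w; rewrite /Z /= EZ.
exists Z; split => //.
- apply/(smeasurableP sG); apply: (measurableT_comp (@fine_measurable R setT measurableT)).
  exact: mZ'.
- by rewrite EZ'.
- move=> A GA; have mA : measurable (A : set T') by apply/GE.
  rewrite /Rintegral; congr fine.
  transitivity (\int[P]_(x in A) Z0 x)%E.
    by apply: eq_integral => x _; rewrite EZ.
  have <- : nu' A = (\int[P]_(x in A) (V x)%:E)%E by [].
  rewrite (Radon_Nikodym_integral numu mA) /mu' /distribution.
  rewrite (integral_pushforward mphi)//.
  exact: (integrableS measurableT (GM GA)).
Qed.

(** The integral inequality is tested on the event [U > V], which belongs to [G]. *)
Lemma cond_le_ae U V : smeasurable G U -> smeasurable G V ->
  P.-integrable setT (EFin \o U) -> P.-integrable setT (EFin \o V) ->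
  (forall A, G A -> \int[P]_(w in A) U w <= \int[P]_(w in A) V w) ->
  {ae P, forall w, U w <= V w}.
Proof.
move=> mU mV iU iV h; pose D w := U w - V w.
have mD : smeasurable G D by exact: (smeasurableB sG).
pose A := [set w | 0 < D w].
have GA : G A.
  have -> : A = D @^-1` `]0, +oo[.
    by apply/seteqP; split => w; rewrite /A/= in_itv/= andbT.
  exact: mD.
have mA := GM GA.
have mDP : measurable_fun setT D by exact: smeasurable_measurable GM mD.
have iUA := integrableS measurableT mA (@subsetT _ A) iU.
have iVA := integrableS measurableT mA (@subsetT _ A) iV.
have iDA : P.-integrable A (EFin \o D).
  by apply: (eq_integrable mA _ _ _ (integrableB mA iUA iVA)) => // w _ /=; rewrite EFinB.
have D0 : \int[P]_(w in A) D w <= 0.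
  by rewrite /D RintegralB// subr_le0; exact: h.
have E0 : (\int[P]_(w in A) `|(D w)%:E| = 0)%E.
  have -> : (\int[P]_(w in A) `|(D w)%:E| = \int[P]_(w in A) (D w)%:E)%E.
    by apply: eq_integral => w; rewrite inE => Aw; rewrite gee0_abs// lee_fin ltW.
  rewrite -[LHS]fineK; last exact: integrable_fin_num.
  congr EFin; apply/le_anti; rewrite D0/=.
  by apply: Rintegral_ge0 => w Aw; exact: ltW.
have := proj1 (ae_eq_integral_abs P mA (f := EFin \o D) _).
move=> /(_ _ E0)[]; first by apply/measurable_EFinP; exact: measurable_funTS.
move=> N [mN N0 sN]; exists N; split => // w /= /negP; rewrite -ltNge => VU; apply: sN => /=.
have Aw : A w by rewrite /A /= /D subr_gt0.
by move=> /(_ Aw)[] /eqP; rewrite subr_eq0 gt_eqF.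
Qed.

(** Conditional Jensen for the square: [2 c V - c^2 <= V^2] passes to conditional expectations for
    each [c]. Using all rational [c] off a single null set gives [Z^2 <= W], where [W] is a version
    of [E[V^2 | G]]. *)
Lemma cond_expectation_moment2 V Z : measurable_fun setT V -> (moment P 2 V < +oo)%E ->
  cond_expectation P G V Z -> (moment P 2 Z <= moment P 2 V)%E.
Proof.
move=> mV fV [iV mZ iZ hZ].
have mZP : measurable_fun setT Z by exact: smeasurable_measurable GM mZ.
have iV2 : P.-integrable setT (EFin \o (fun w => `|V w| `^ 2)).
  by apply: ge0_integrableR => //; apply: measurable_normr_powR.
have [W [_ mW iW hW]] := cond_expectation_exists iV2.
have mWP : measurable_fun setT W by exact: smeasurable_measurable GM mW.
have sub A U : G A -> P.-integrable setT (EFin \o U) -> P.-integrable A (EFin \o U).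
  by move=> GA; apply: (integrableS measurableT (GM GA) (@subsetT _ A)).
have ic A (c : R) : G A -> P.-integrable A (EFin \o (fun _ : Omega => c)).
  move=> GA; apply: sub GA _; exact: (finite_measure_integrable_cst P c measurableT).
have key (c : R) : {ae P, forall w, 2 * c * Z w - c ^+ 2 <= W w}.
  have iT : P.-integrable setT (EFin \o (fun w => 2 * c * Z w - c ^+ 2)).
    apply: (eq_integrable measurableT (fun w => (2 * c)%:E * (Z w)%:E - (c ^+ 2)%:E)%E).
      by move=> w _ /=; rewrite EFinB EFinM.
    apply: integrableB => //; first exact: integrableZl.
    exact: (finite_measure_integrable_cst P _ measurableT).
  apply: cond_le_ae => //.
    apply: smeasurableB => //; last exact: smeasurable_cst.
    by apply: smeasurableM => //; exact: smeasurable_cst.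
  move=> A GA; have mA := GM GA; rewrite hW//.
  have iZA := sub _ _ GA iZ; have iVA := sub _ _ GA iV.
  have iZl U : P.-integrable A (EFin \o U) -> P.-integrable A (EFin \o (fun w => 2 * c * U w)).
    move=> iU; apply: (eq_integrable mA (fun w => (2 * c)%:E * (U w)%:E)%E) => //.
    exact: integrableZl.
  rewrite RintegralB//; [|exact: iZl|exact: ic].
  rewrite RintegralZl// hZ// -RintegralZl// -RintegralB//; [|exact: iZl|exact: ic].
  apply: le_Rintegral => //.
  - apply: (eq_integrable mA (fun w => (2 * c)%:E * (V w)%:E - (c ^+ 2)%:E)%E).
      by move=> w _ /=; rewrite EFinB EFinM.
    by apply: integrableB => //; [exact: integrableZl|exact: ic].
  - exact: sub.
  - move=> w _; rewrite (powR_mulrn 2)// real_normK ?num_real//.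
    by have := sqr_ge0 (V w - c); rewrite sqrrB; lra.
have ZW : {ae P, forall w, Z w ^+ 2 <= W w}.
  have h := @ae_foralln _ _ _ P (fun n w => forall r : rat, unpickle n = Some r ->
    2 * ratr r * Z w - ratr r ^+ 2 <= W w).
  have {}h := h _.
  apply: filterS (h _) => [w hw|n]; last first.
    case: (unpickle n) => [r|]; last by apply: aeW.
    by apply: filterS (key (ratr r)) => w hw _ [<-].
  rewrite leNgt; apply/negP => WZ.
  (* Since [2 r Z - r^2 = Z^2 - (r - Z)^2], a rational [r] within [s <= 1] of [Z] misses [Z^2] by
     less than the gap [Z^2 - W]. *)
  pose s := Num.min 1 (Z w ^+ 2 - W w); have s0 : 0 < s by rewrite lt_min ltr01 subr_gt0.
  have /rat_in_itvoo[r] : Z w < Z w + s by rewrite ltrDl.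
  rewrite in_itv/= => /andP[r1 r2].
  have := hw (pickle r) r (pickleK r).
  have rs : ratr r - Z w < s by rewrite ltrBlDl.
  have rs2 : (ratr r - Z w) ^+ 2 < s.
    apply: (@lt_le_trans _ _ (s ^+ 2)).
      by rewrite ltr_pXn2r// nnegrE ?subr_ge0 ltW.
    by rewrite expr2 ler_piMl ?(ltW s0)// ge_min lexx.
  have : s <= Z w ^+ 2 - W w by rewrite ge_min lexx orbT.
  move: rs2; rewrite sqrrB; lra.
apply: (@le_trans _ _ (\int[P]_w (`|W w|)%:E)%E).
  apply: ae_ge0_le_integral => //.
  - by apply/measurable_EFinP; exact: measurable_normr_powR.
  - by apply/measurable_EFinP; exact: measurableT_comp.
  - apply: filterS ZW => w hw _; rewrite lee_fin (powR_mulrn 2)// real_normK ?num_real//.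
    exact: le_trans hw (ler_norm _).
have -> : (\int[P]_w (`|W w|)%:E = \int[P]_w (W w)%:E)%E.
  apply: ae_eq_integral => //.
  - by apply/measurable_EFinP; exact: measurableT_comp.
  - exact/measurable_EFinP.
  - apply: filterS ZW => w hw _ /=; rewrite ger0_norm//.
    exact: le_trans (sqr_ge0 _) hw.
have GT : G setT by have [h1 h2 _] := sG; rewrite -[setT]setD0; exact: h2.
have h := congr1 (@EFin R) (hW _ GT).
rewrite /Rintegral !fineK in h; [by rewrite h|exact: integrable_fin_num|exact: integrable_fin_num].
Qed.
End conditional_expectation.

(** * Moments of random vectors *)

Section moments.
Set Implicit Arguments.
Unset Strict Implicit.
Context {R : realType} {disp : measure_display} {Omega : measurableType disp}
  (P : probability Omega R).
Implicit Types U V : Omega -> R.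

Lemma moment_ae_eq p U V : measurable_fun setT U -> measurable_fun setT V ->
  {ae P, forall w, U w = V w} -> moment P p U = moment P p V.
Proof.
move=> mU mV UV; apply: ge0_ae_eq_integral => //.
- by apply/measurable_EFinP; exact: measurable_normr_powR.
- by apply/measurable_EFinP; exact: measurable_normr_powR.
- by apply: filterS UV => w /= -> _.
Qed.

Lemma moment_add_le p U V (K L : R) : 0 <= p -> measurable_fun setT U -> measurable_fun setT V ->
  (moment P p U <= K%:E)%E -> (moment P p V <= L%:E)%E ->
  (moment P p (fun w => U w + V w)%R <= (2 `^ p * (K + L))%:E)%E.
Proof.
move=> p0 mU mV hU hV.
apply: (@le_trans _ _ (\int[P]_w (2 `^ p * (`|U w| `^ p + `|V w| `^ p))%:E)%E).
  apply: ge0_le_integralR.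
  - by apply: measurable_normr_powR; exact: measurable_funD.
  - by apply: measurable_funM => //; apply: measurable_funD; exact: measurable_normr_powR.
  - by move=> w; exact: powR_ge0.
  - move=> w; apply: (@le_trans _ _ ((`|U w| + `|V w|) `^ p)); last exact: powRD_le.
    by apply: ge0_ler_powR; rewrite ?nnegrE ?addr_ge0// ler_normD.
rewrite ge0_integralZlR ?powR_ge0//; last by apply: measurable_funD; exact: measurable_normr_powR.
rewrite EFinM; apply: lee_wpmul2l; first by rewrite lee_fin powR_ge0.
rewrite ge0_integralDR//; last 2 first.
- exact: measurable_normr_powR.
- exact: measurable_normr_powR.
by rewrite EFinD; exact: leeD.
Qed.

Lemma powR_sum_le n (u : 'I_n -> R) p : 1 <= p -> (forall i, 0 <= u i) ->
  (\sum_i u i) `^ p <= n%:R `^ p * \sum_i u i `^ p.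
Proof.
move=> p1 u0; have p0 : 0 < p by exact: lt_le_trans p1.
case: n u u0 => [|n] u u0; first by rewrite big_ord0 powR0 ?gt_eqF// mul0r.
have n0 : 0 < n.+1%:R :> R by rewrite ltr0n.
have n1 : n.+1%:R != 0 :> R by rewrite gt_eqF.
rewrite -{1}(divfK n1 (\sum_i u i)).
rewrite mulrC powRM ?divr_ge0 ?sumr_ge0// ler_wpM2l ?powR_ge0//.
apply: (le_trans (powR_mean_le p1 u0)).
rewrite ler_pdivrMr// ler_peMr ?sumr_ge0// => [i _|]; first exact: powR_ge0.
by rewrite ler1n.
Qed.

Lemma moment_sum_le n (U : 'I_n -> Omega -> R) p (K : R) : 1 <= p ->
  (forall i, measurable_fun setT (U i)) -> (forall i, (moment P p (U i) <= K%:E)%E) ->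
  (\int[P]_w ((\sum_i `|U i w|) `^ p)%:E <= (n%:R `^ p * (n%:R * K))%:E)%E.
Proof.
move=> p1 mU hU.
have mp i : measurable_fun setT (fun w => `|U i w| `^ p) by exact: measurable_normr_powR.
apply: (@le_trans _ _ (\int[P]_w (n%:R `^ p * \sum_i `|U i w| `^ p)%:E)%E).
  apply: ge0_le_integralR.
  - apply: (measurableT_comp (measurable_powR p)); apply: measurable_sum => i.
    exact: measurableT_comp.
  - by apply: measurable_funM => //; exact: measurable_sum.
  - by move=> w; exact: powR_ge0.
  - by move=> w; apply: powR_sum_le.
rewrite ge0_integralZlR ?powR_ge0//; last 2 first.
- exact: measurable_sum.
- by move=> w; rewrite sumr_ge0// => i _; exact: powR_ge0.
rewrite EFinM; apply: lee_wpmul2l; first by rewrite lee_fin powR_ge0.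
under eq_integral do rewrite -sumEFin.
rewrite ge0_integral_sum//; last by move=> i; apply/measurable_EFinP.
rewrite mulr_natl -[n in leRHS]card_ord -sumr_const -sumEFin.
by apply: lee_sum => i _; exact: hU.
Qed.

Lemma moment_sum_le_norm n (U : 'I_n -> Omega -> R) p (K : R) : 1 <= p ->
  (forall i, measurable_fun setT (U i)) -> (forall i, (moment P p (U i) <= K%:E)%E) ->
  (moment P p (fun w => \sum_i U i w)%R <= (n%:R `^ p * (n%:R * K))%:E)%E.
Proof.
move=> p1 mU hU; apply: le_trans (moment_sum_le p1 mU hU).
apply: ge0_le_integralR.
- by apply: measurable_normr_powR; exact: measurable_sum.
- apply: (measurableT_comp (measurable_powR p)); apply: measurable_sum => i.
  exact: measurableT_comp.
- by move=> w; exact: powR_ge0.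
- move=> w; apply: ge0_ler_powR; rewrite ?nnegrE ?sumr_ge0//; first exact: le_trans p1.
  exact: ler_norm_sum.
Qed.

Section vectors.
Variable d : nat.
Implicit Types Y : Omega -> 'rV[R]_d.

Lemma measurable_enorm Y : (forall i, measurable_fun setT (fun w => Y w 0 i)) ->
  measurable_fun setT (fun w => enorm (Y w)).
Proof. by move=> mY; apply: measurable_continuous_comp => //; exact: enorm_continuous. Qed.

Lemma moment_enorm_le Y p (K : R) : 1 <= p ->
  (forall i, measurable_fun setT (fun w => Y w 0 i)) ->
  (forall i, (moment P p (fun w => Y w 0%R i) <= K%:E)%E) ->
  (moment P p (fun w => enorm (Y w)) <= (d%:R `^ p * (d%:R * K))%:E)%E.
Proof.
move=> p1 mY hY; apply: le_trans (moment_sum_le p1 mY hY).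
apply: ge0_le_integralR.
- by apply: measurable_normr_powR; exact: measurable_enorm.
- apply: (measurableT_comp (measurable_powR p)); apply: measurable_sum => i.
  by apply: measurableT_comp => //; exact: mY.
- by move=> w; exact: powR_ge0.
- move=> w; apply: ge0_ler_powR; rewrite ?nnegrE ?sumr_ge0//; first exact: le_trans p1.
  by rewrite ger0_norm ?enorm_ge0// enorm_le_sum.
Qed.

Lemma LpNorm_powR p Y : p != 0 ->
  (poweR (LpNorm P p Y) p = moment P p (fun w => enorm (Y w)))%E.
Proof.
move=> p0; rewrite /LpNorm poweR_Lnorm//; exact: eq_integral.
Qed.

Lemma LpNorm_le_moment p Y (M : R) : 0 < p -> (LpNorm P p Y <= M%:E)%E ->
  (moment P p (fun w => enorm (Y w)) <= (M `^ p)%:E)%E.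
Proof.
move=> p0 hM; rewrite -LpNorm_powR ?gt_eqF//.
have := Lnorm_ge0 P p%:E (fun w => (enorm (Y w))%:E); rewrite -/(LpNorm P p Y).
move: hM; case: (LpNorm P p Y) => //= r rM r0.
rewrite lee_fin in rM; rewrite lee_fin in r0; rewrite lee_fin.
by apply: ge0_ler_powR; rewrite ?nnegrE ?(ltW p0)// (le_trans r0).
Qed.

Lemma moment_LpNorm_le p Y (M : R) : 0 < p -> 0 <= M ->
  (moment P p (fun w => enorm (Y w)) <= (M `^ p)%:E)%E -> (LpNorm P p Y <= M%:E)%E.
Proof.
move=> p0 M0; rewrite -LpNorm_powR ?gt_eqF//.
have := Lnorm_ge0 P p%:E (fun w => (enorm (Y w))%:E); rewrite -/(LpNorm P p Y).
case: (LpNorm P p Y) => //= [r|_].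
  rewrite !lee_fin => r0 h; rewrite leNgt; apply: contraTN h => Mr.
  by rewrite -ltNge; apply: gt0_ltr_powR; rewrite ?nnegrE.
by rewrite gt_eqF// leye_eq.
Qed.
End vectors.
End moments.

(** * The one-step error *)

Section sode_estimates.
Set Implicit Arguments.
Unset Strict Implicit.
Context {R : realType} {disp : measure_display} {Omega : measurableType disp}
  {P : probability Omega R} {d m : nat} {T : R}.
Hypothesis T0 : 0 < T.
Context {F : R -> set (set Omega)} {W : 'I_m -> R -> Omega -> R} {L eta q : R}
  {f : R -> 'rV[R]_d -> 'rV[R]_d} {g : 'I_m -> R -> 'rV[R]_d -> 'rV[R]_d}
  {X : R -> Omega -> 'rV[R]_d} {I : 'I_m -> 'I_d -> R -> Omega -> R}
  {X0 : Omega -> 'rV[R]_d}.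
Hypothesis hF : usual_filtration P T F.
Hypothesis hW : forall r, brownian_motion P T F (W r).
Hypothesis hfg : admissible T L eta q f g.
Hypothesis hXad : forall t : R, 0 <= t <= T -> vmeasurable (F t) (X t).
Hypothesis hXc : {ae P, forall w, {within `[0, T], continuous (X ^~ w)}}.
Hypothesis hI : forall r i, ito_integral P T F (W r) (fun s w => g r s (X s w) 0 i) (I r i).
Hypothesis hXE : forall t : R, 0 <= t <= T -> {ae P, forall w, forall i : 'I_d,
  X t w 0 i = X0 w 0 i + \int[lebesgue_measure]_(s in `[0, t]) (f s (X s w) 0 i)
    + \sum_(r < m) I r i t w}.
Local Notation mu := (@lebesgue_measure R).
Local Notation P0 := (4 * q - 2).
Local Notation rho := ((4 * q - 2) / q).
Variable K1 : R.
Hypothesis hK1 : forall t, 0 <= t <= T -> (moment P P0 (fun w => enorm (X t w)) <= K1%:E)%E.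

Let L0 := adm_L hfg.
Let q1 := adm_q hfg.

Let q0 : 0 < q. Proof. exact: lt_trans q1. Qed.
Let P00 : 0 < P0. Proof. have := q1; lra. Qed.
(** [rho = 4 - 2 / q] falls in the range of the stochastic moment bounds because [q > 1]. *)
Let rho24 : 2 <= rho <= 4.
Proof. by have := q1; rewrite ler_pdivlMr// ler_pdivrMr// => h; apply/andP; split; lra. Qed.
Let rho1 : 1 <= rho. Proof. by case/andP: rho24 => + _; apply: le_trans; rewrite ler1n. Qed.
Let rho0 : 0 < rho. Proof. exact: lt_le_trans rho1. Qed.
Let qrho : q * rho = P0. Proof. by rewrite mulrC divfK// gt_eqF. Qed.

Let mneg (N : set Omega) : P.-negligible N -> measurable N.
Proof. exact: negligible_measurable hF T0 N. Qed.

Let mX t i : 0 <= t <= T -> measurable_fun setT (fun w => X t w 0 i).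
Proof. by move=> tT; apply: (adapted_measurable hF tT); exact: hXad. Qed.

Let mXn t : 0 <= t <= T -> measurable_fun setT (fun w => enorm (X t w)).
Proof. by move=> tT; apply: measurable_enorm => i; exact: mX. Qed.

Section coefficient.
Variable h : R -> 'rV[R]_d -> 'rV[R]_d.
Hypothesis hh : coef_regular T L q h.
Hypothesis ch : {within [set z : R * 'rV[R]_d | 0 <= z.1 <= T],
  continuous (fun z : R * 'rV[R]_d => h z.1 z.2)}.

Lemma coef_adapted t i : 0 <= t <= T -> smeasurable (F t) (fun w => h t (X t w) 0 i).
Proof.
move=> tT; apply: (vmeasurable_comp (h := fun x => h t x 0 i) (filtration_sigma hF tT)).
  exact: hXad.
exact: (coef_coord_continuous L0 q1 hh tT).
Qed.

Lemma coef_path_continuous i :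
  {ae P, forall w, {within `[0, T], continuous (fun s => h s (X s w) 0 i)}}.
Proof.
apply: filterS hXc => w cw.
apply: (within_comp_pair (h := fun z => h z.1 z.2) cw ch) => s /=.
by rewrite in_itv.
Qed.

(** Growth of order [q] turns a moment of order [rho] of the coefficient into one of order
    [q rho = 4 q - 2] of the solution. *)
Lemma coef_moment t i : 0 <= t <= T ->
  (moment P rho (fun w => h t (X t w) 0%R i) <= (L `^ rho * 2 `^ rho * (1 + K1))%:E)%E.
Proof.
move=> tT.
have mh := adapted_measurable hF tT (coef_adapted i tT).
have mn : measurable_fun setT (fun w => `|enorm (X t w)| `^ P0).
  by apply: measurable_normr_powR; exact: mXn.
apply: (@le_trans _ _ (\int[P]_w (L `^ rho * 2 `^ rho * (1 + `|enorm (X t w)| `^ P0))%:E)%E).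
  apply: ge0_le_integralR.
  - exact: measurable_normr_powR.
  - by apply: measurable_funM => //; apply: measurable_funD.
  - by move=> w; exact: powR_ge0.
  - move=> w; apply: (@le_trans _ _ (enorm (h t (X t w)) `^ rho)).
      apply: ge0_ler_powR; rewrite ?nnegrE ?enorm_ge0// ?(ltW rho0)//.
      exact: normr_le_enorm.
    apply: (le_trans (coef_growth_moment L0 hh _ (ltW rho0) tT)).
    by rewrite qrho [`|enorm _|]ger0_norm ?enorm_ge0.
have c0 : 0 <= L `^ rho * 2 `^ rho by rewrite mulr_ge0 ?powR_ge0.
rewrite ge0_integralZlR//; last by apply: measurable_funD.
rewrite [X in (_ <= X)%E]EFinM; apply: lee_wpmul2l; first by rewrite lee_fin.
rewrite ge0_integralDR// integral_probability_cst EFinD leeD2l//.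
exact: hK1.
Qed.
End coefficient.

Let hf := (admissible_regular hfg).1.
Let hg := (admissible_regular hfg).2.
Let K2 := L `^ rho * 2 `^ rho * (1 + K1).

Let K10 : 0 <= K1.
Proof.
have := hK1 (t := 0); rewrite lexx ltW// => /(_ isT) h.
by rewrite -lee_fin; apply: le_trans h; exact: moment_ge0.
Qed.

Lemma sode_increment a b i : 0 <= a -> a <= b -> b <= T ->
  {ae P, forall w, X b w 0 i - X a w 0 i =
    \int[mu]_(s in `[a, b]) (f s (X s w) 0 i) + \sum_(r < m) (I r i b w - I r i a w)}.
Proof.
move=> a0 ab bT; have aT : 0 <= a <= T by rewrite a0 (le_trans ab).
have bT' : 0 <= b <= T by rewrite bT (le_trans a0).
apply: filterS3 (hXE aT) (hXE bT') (coef_path_continuous (adm_cont_f hfg) i) => w Ea Eb cw.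
rewrite Ea Eb (@Rintegral_itv_cat _ 0 a b)//; last exact: within_itvS cw.
rewrite sumrB; ring.
Qed.

(** Counterpart of [ito_remainder] for the time integral: [c = 0] gives the drift of [X], and a
    coordinate of [f(u, Y)] gives the drift error. *)
Definition drift_remainder a b (c : Omega -> R) i w :=
  \int[mu]_(s in `[a, b]) (f s (X s w) 0 i - c w).

Let mfX i s : 0 <= s <= T -> measurable_fun setT (fun w => f s (X s w) 0 i).
Proof. by move=> sT; apply: (adapted_measurable hF sT); exact: (coef_adapted hf). Qed.

Section remainders.
Variables (a b : R) (c : Omega -> R) (i : 'I_d).
Hypotheses (a0 : 0 <= a) (ab : a < b) (bT : b <= T) (mc : measurable_fun setT c).

Let sT s : a <= s <= b -> 0 <= s <= T.
Proof. by move=> /andP[s1 s2]; rewrite (le_trans a0 s1) (le_trans s2 bT). Qed.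

Variable xi : Omega -> R.
Hypothesis sxi : smeasurable (F a) xi.

Lemma diffusion_remainder_measurable r :
  measurable_fun setT (ito_remainder (W r) (I r i) a b xi).
Proof. exact: (ito_remainder_measurable hF (hW r) (hI r i) a0 ab bT sxi). Qed.

Lemma diffusion_remainder_moment r p K : 2 <= p <= 4 ->
  (forall s, a <= s <= b -> (moment P p (fun w => g r s (X s w) 0 i - xi w)%R <= K%:E)%E) ->
  (moment P p (ito_remainder (W r) (I r i) a b xi) <=
    (cito p * K * (b - a) `^ (p / 2))%:E)%E.
Proof.
exact: (ito_remainder_moment (H := fun s w => g r s (X s w) 0 i) hF (hW r) T0
  (fun s sT => coef_adapted (hg r) i sT)
  (coef_path_continuous (@adm_cont_g R d m T L eta q f g hfg r) i) (hI r i) a0 ab bT sxi).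
Qed.

Lemma diffusion_remainder_mean0 r K (A : set Omega) : F a A ->
  (forall s, a <= s <= b -> (moment P 2 (fun w => g r s (X s w) 0 i - xi w)%R <= K%:E)%E) ->
  (\int[P]_w (\1_A w * ito_remainder (W r) (I r i) a b xi w)%:E = 0)%E.
Proof.
exact: (ito_remainder_mean0 (H := fun s w => g r s (X s w) 0 i) hF (hW r) T0
  (fun s sT => coef_adapted (hg r) i sT)
  (coef_path_continuous (@adm_cont_g R d m T L eta q f g hfg r) i) (hI r i) a0 ab bT sxi).
Qed.

Let mU s : a <= s <= b -> measurable_fun setT (fun w => f s (X s w) 0 i - c w).
Proof. by move=> sab; apply: measurable_funB => //; apply: mfX; exact: sT. Qed.

Let cU : {ae P, forall w, {within `[a, b], continuous (fun s => f s (X s w) 0 i - c w)}}.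
Proof.
apply: filterS (coef_path_continuous (adm_cont_f hfg) i) => w cw.
have {}cw := within_itvS a0 bT cw.
by move=> x; apply: cvgB; [exact: cw|exact: cvg_cst].
Qed.

Lemma drift_remainder_measurable : measurable_fun setT (drift_remainder a b c i).
Proof. exact: (Rintegral_itv_measurable mneg (ltW ab) mU cU). Qed.

Lemma drift_remainder_moment p K : 1 <= p ->
  (forall s, a <= s <= b -> (moment P p (fun w => f s (X s w) 0 i - c w)%R <= K%:E)%E) ->
  (moment P p (drift_remainder a b c i) <= (2 `^ p * ((b - a) `^ p * K))%:E)%E.
Proof. exact: (Rintegral_itv_moment mneg (ltW ab) mU cU). Qed.

Lemma drift_remainderE : {ae P, forall w, drift_remainder a b c i w =
  \int[mu]_(s in `[a, b]) (f s (X s w) 0 i) - c w * (b - a)}.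
Proof.
apply: filterS (coef_path_continuous (adm_cont_f hfg) i) => w cw.
have {}cw := within_itvS a0 bT cw.
rewrite /drift_remainder RintegralB//; last 2 first.
- exact: within_itv_integrable.
- by apply: within_itv_integrable => x; exact: cvg_cst.
by rewrite Rintegral_itv_cst// ltW.
Qed.
End remainders.

(** The stochastic integrals set the order [(s - t)^(rho / 2)]; the drift is of order [(s - t)^rho],
    and half of that power is absorbed into [T^(rho / 2)]. *)
Lemma sode_increment_moment : exists2 C, 0 <= C & forall t s i, 0 <= t -> t <= s -> s <= T ->
  (moment P rho (fun w => X s w 0%R i - X t w 0%R i)%R <= (C * (s - t) `^ (rho / 2))%:E)%E.
Proof.
have K20 : 0 <= K2 by rewrite !mulr_ge0 ?powR_ge0// addr_ge0.
pose A := 2 `^ rho * (T `^ (rho / 2) * K2).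
pose B := m%:R `^ rho * (m%:R * (cito rho * K2)).
have A0 : 0 <= A by rewrite mulr_ge0 ?powR_ge0// mulr_ge0 ?powR_ge0.
have B0 : 0 <= B by rewrite mulr_ge0 ?powR_ge0// mulr_ge0// mulr_ge0// cito_ge0.
exists (2 `^ rho * (A + B)); first by rewrite mulr_ge0 ?powR_ge0// addr_ge0.
(* The remainder estimates require [t < s]; for [t = s] both sides vanish. *)
move=> t s i t0; rewrite le_eqVlt => /predU1P[<- tT|ts sT].
  rewrite subrr powR0 ?mulr0; last by rewrite mulf_neq0 ?gt_eqF// invr_gt0.
  rewrite /moment; under eq_integral do rewrite subrr normr0 powR0 ?gt_eqF//.
  by rewrite integral0.
have tT : 0 <= t <= T by rewrite t0 (le_trans (ltW ts)).
have sT' : 0 <= s <= T by rewrite sT (le_trans t0 (ltW ts)).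
have h0 : 0 < s - t by rewrite subr_gt0.
have mcst : measurable_fun setT (fun _ : Omega => (0 : R)) by [].
have scst : smeasurable (F t) (fun _ : Omega => (0 : R)).
  exact: (smeasurable_cst (filtration_sigma hF tT)).
pose D := drift_remainder t s (fun=> 0) i.
pose N r := ito_remainder (W r) (I r i) t s (fun=> 0).
have mD : measurable_fun setT D by exact: drift_remainder_measurable.
have mN r : measurable_fun setT (N r) by exact: diffusion_remainder_measurable.
set x := (s - t) `^ (rho / 2); have x0 : 0 <= x by exact: powR_ge0.
have E : {ae P, forall w, X s w 0 i - X t w 0 i = D w + \sum_(r < m) N r w}.
  apply: filterS2 (sode_increment i t0 (ltW ts) sT) (drift_remainderE (fun=> 0) i t0 ts sT) => w E1 E2.
  rewrite E1 /D E2 mul0r subr0; congr (_ + _); apply: eq_bigr => r _.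
  by rewrite /N /ito_remainder mul0r subr0.
have hD : (moment P rho D <= (A * x)%:E)%E.
  apply: (le_trans (@drift_remainder_moment t s (fun=> 0) i t0 ts sT mcst rho K2 rho1 _)).
    move=> u /andP[u1 u2]; under eq_fun do rewrite subr0.
    by apply: (coef_moment hf); rewrite (le_trans t0 u1) (le_trans u2 sT).
  rewrite lee_fin (_ : A * x = 2 `^ rho * (T `^ (rho / 2) * x * K2)); last by rewrite /A; ring.
  rewrite ler_wpM2l ?powR_ge0// ler_wpM2r//.
  have -> : (s - t) `^ rho = x * x.
    rewrite /x -powRD; last by rewrite (gt_eqF h0) implybT.
    by congr (_ `^ _); field; rewrite gt_eqF.
  have r20 : 0 <= rho / 2 by apply: divr_ge0 => //; exact: ltW.
  rewrite ler_wpM2r// /x; apply: ge0_ler_powR; rewrite ?nnegrE ?(ltW h0) ?(ltW T0)//.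
  by rewrite lerBlDr (le_trans sT)// lerDl.
have hN r : (moment P rho (N r) <= (cito rho * K2 * x)%:E)%E.
  apply: diffusion_remainder_moment => // u /andP[u1 u2]; under eq_fun do rewrite subr0.
  by apply: (coef_moment (hg r)); rewrite (le_trans t0 u1) (le_trans u2 sT).
rewrite (moment_ae_eq rho _ _ E); last 2 first.
- by apply: measurable_funB; exact: mX.
- by apply: measurable_funD => //; exact: measurable_sum.
have -> : 2 `^ rho * (A + B) * x = 2 `^ rho * (A * x + m%:R `^ rho * (m%:R * (cito rho * K2 * x))).
  by rewrite /B; ring.
apply: moment_add_le => //; first exact: ltW.
- exact: measurable_sum.
- exact: moment_sum_le_norm.
Qed.

Lemma sode_increment_enorm_moment : exists2 C, 0 <= C & forall t s, 0 <= t -> t <= s -> s <= T ->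
  (moment P rho (fun w => enorm (X s w - X t w)) <= (C * (s - t) `^ (rho / 2))%:E)%E.
Proof.
have [C C0 hC] := sode_increment_moment.
exists (d%:R `^ rho * (d%:R * C)); first by rewrite mulr_ge0 ?powR_ge0// mulr_ge0.
move=> t s t0 ts sT.
rewrite [X in (_ <= X%:E)%E](_ : _ = d%:R `^ rho * (d%:R * (C * (s - t) `^ (rho / 2)))); last by ring.
have E i : (fun w => (X s w - X t w) 0 i) = (fun w => X s w 0 i - X t w 0 i).
  by apply/funext => w; rewrite !mxE.
apply: moment_enorm_le => // i; rewrite E; last exact: hC.
apply: measurable_funB; apply: mX; first by rewrite sT (le_trans t0).
by rewrite t0 (le_trans ts).
Qed.

Section one_step.
Variable hbar : R.
Hypotheses (hb0 : 0 < hbar) (hL : hbar < L^-1).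

Let c0 := ssbe_c_gt0 hfg hL.

Definition ssbe_mid t delta w := ssbe_Finv f delta (t + delta) (X t w).

Section coefficient_error.
Variable h : R -> 'rV[R]_d -> 'rV[R]_d.
Hypothesis hh : coef_regular T L q h.

Lemma ssbe_mid_adapted t delta : 0 <= t -> 0 < delta -> delta <= hbar -> t + delta <= T ->
  vmeasurable (F t) (ssbe_mid t delta).
Proof.
move=> t0 dt0 dth tdT i.
have tT : 0 <= t <= T by rewrite t0/= (le_trans _ tdT)// lerDl ltW.
have uT : 0 <= t + delta <= T by rewrite tdT addr_ge0// ltW.
apply: (vmeasurable_comp (h := fun x => ssbe_Finv f delta (t + delta) x 0 i) (filtration_sigma hF tT)).
  exact: hXad.
exact: (ssbe_Finv_continuous hfg dt0 dth hL uT).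
Qed.

Lemma coef_mid_adapted t delta i : 0 <= t -> 0 < delta -> delta <= hbar -> t + delta <= T ->
  smeasurable (F t) (fun w => h (t + delta) (ssbe_mid t delta w) 0 i).
Proof.
move=> t0 dt0 dth tdT.
have tT : 0 <= t <= T by rewrite t0/= (le_trans _ tdT)// lerDl ltW.
have uT : 0 <= t + delta <= T by rewrite tdT addr_ge0// ltW.
apply: (vmeasurable_comp (h := fun x => h (t + delta) x 0 i) (filtration_sigma hF tT)).
  exact: ssbe_mid_adapted.
exact: (coef_coord_continuous L0 q1 hh uT).
Qed.

(** Divided by [sqrt delta], the increment of [X] has a bounded moment of order [rho], so every term
    of [coef_error] has bounded mean and only its prefactor [delta] remains. *)
Lemma coef_error_moment : exists2 C, 0 <= C & forall t delta s i,
  0 <= t -> 0 < delta -> delta <= hbar -> t + delta <= T -> t <= s <= t + delta ->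
  (moment P 2 (fun w => h s (X s w) 0 i - h (t + delta) (ssbe_mid t delta w) 0 i)%R <=
    (C * delta)%:E)%E.
Proof.
have [C1 C10 hC1] := sode_increment_enorm_moment.
have [C2 C20 hC2] := coef_error L0 q1 hh c0 hb0.
exists (C2 * (1 + K1 + K1 + C1)); first by rewrite mulr_ge0// !addr_ge0.
move=> t delta s i t0 dt0 dth tdT /andP[ts su].
have tT : 0 <= t <= T by rewrite t0/= (le_trans _ tdT)// lerDl ltW.
have sT : 0 <= s <= T by rewrite (le_trans t0 ts) (le_trans su tdT).
have uT : 0 <= t + delta <= T by rewrite tdT addr_ge0// ltW.
have sd : 0 < Num.sqrt delta by rewrite sqrtr_gt0.
pose k := (Num.sqrt delta)^-1 `^ rho; have k0 : 0 <= k by exact: powR_ge0.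
have mh : measurable_fun setT (fun w => h s (X s w) 0 i - h (t + delta) (ssbe_mid t delta w) 0 i).
  apply: measurable_funB.
    exact: (adapted_measurable hF sT (coef_adapted hh i sT)).
  exact: (adapted_measurable hF tT (coef_mid_adapted i t0 dt0 dth tdT)).
have mp u : 0 <= u <= T -> measurable_fun setT (fun w => `|enorm (X u w)| `^ P0).
  by move=> uu; apply: measurable_normr_powR; exact: mXn.
have mi : measurable_fun setT (fun w => `|enorm (X s w - X t w)| `^ rho).
  apply: measurable_normr_powR; apply: measurable_enorm => j.
  by under eq_fun do rewrite !mxE; apply: measurable_funB; exact: mX.
apply: (@le_trans _ _ (\int[P]_w (C2 * delta * (1 + `|enorm (X t w)| `^ P0 +
    `|enorm (X s w)| `^ P0 + k * `|enorm (X s w - X t w)| `^ rho))%:E)%E).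
  apply: ge0_le_integralR.
  - exact: measurable_normr_powR.
  - apply: measurable_funM => //; apply: measurable_funD; last exact: measurable_funM.
    by apply: measurable_funD; [apply: measurable_funD; [exact: measurable_cst|]|]; exact: mp.
  - by move=> w; exact: powR_ge0.
  - move=> w; rewrite (powR_mulrn 2)// real_normK ?num_real//.
    have := hC2 t s (t + delta) (X t w) (ssbe_mid t delta w) (X s w) delta t0 ts su tdT erefl dt0 dth
      (ssbe_Finv_bound hfg dt0 dth hL uT (X t w)) (ssbe_Finv_dist hfg dt0 dth hL uT (X t w)).
    rewrite !ger0_norm ?enorm_ge0// powRM ?enorm_ge0 ?invr_ge0 ?(ltW sd)// -/k [_ * k]mulrC.
    apply: le_trans; rewrite -real_normK ?num_real//.
    apply: lerXn2r; rewrite ?nnegrE ?enorm_ge0//.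
    rewrite (_ : _ - _ = (h s (X s w) - h (t + delta) (ssbe_mid t delta w)) 0 i); last by rewrite !mxE.
    exact: normr_le_enorm.
have p0 w : 0 <= `|enorm (X t w)| `^ P0 + `|enorm (X s w)| `^ P0 + k * `|enorm (X s w - X t w)| `^ rho.
  by rewrite addr_ge0 ?mulr_ge0 ?powR_ge0// addr_ge0 ?powR_ge0.
rewrite ge0_integralZlR; last 3 first.
- apply: measurable_funD; last exact: measurable_funM.
  by apply: measurable_funD; [apply: measurable_funD; [exact: measurable_cst|]|]; exact: mp.
- by move=> w; rewrite addr_ge0 ?mulr_ge0 ?powR_ge0// addr_ge0 ?powR_ge0// addr_ge0 ?powR_ge0.
- by rewrite mulr_ge0// ltW.
rewrite [X in (_ <= X%:E)%E](_ : _ = C2 * delta * (1 + K1 + K1 + C1)); last by ring.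
rewrite [X in (_ <= X)%E]EFinM; apply: lee_wpmul2l; first by rewrite lee_fin mulr_ge0// ltW.
have m1 : measurable_fun setT (fun w => 1 + `|enorm (X t w)| `^ P0).
  by apply: measurable_funD; [exact: measurable_cst|exact: mp].
rewrite ge0_integralDR; last 4 first.
- by apply: measurable_funD; [exact: m1|exact: mp].
- exact: measurable_funM.
- by move=> w; rewrite addr_ge0 ?powR_ge0// addr_ge0 ?powR_ge0.
- by move=> w; rewrite mulr_ge0 ?powR_ge0.
rewrite ge0_integralDR; last 4 first.
- exact: m1.
- exact: mp.
- by move=> w; rewrite addr_ge0 ?powR_ge0.
- by move=> w; rewrite powR_ge0.
rewrite ge0_integralDR; last 4 first.
- by [].
- exact: mp.
- by [].
- by move=> w; rewrite powR_ge0.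
rewrite integral_probability_cst ge0_integralZlR; [|exact: mi|by move=> w; exact: powR_ge0|exact: k0].
have h1 : (k%:E * \int[P]_w (`|enorm (X s w - X t w)| `^ rho)%:E <= C1%:E)%E.
  apply: (@le_trans _ _ (k%:E * (C1 * delta `^ (rho / 2))%:E)%E).
    apply: lee_wpmul2l; first by rewrite lee_fin.
    apply: le_trans (hC1 t s t0 ts _) _; first by case/andP: sT.
    rewrite lee_fin ler_wpM2l//; apply: ge0_ler_powR; rewrite ?nnegrE ?subr_ge0 ?(ltW dt0)//.
      by rewrite divr_ge0// ltW.
    by rewrite lerBlDl.
  rewrite -EFinM lee_fin mulrCA -[leRHS]mulr1 ler_wpM2l//.
  have -> : delta `^ (rho / 2) = Num.sqrt delta `^ rho.
    by rewrite -powR12_sqrt ?(ltW dt0)// -powRrM; congr (_ `^ _); rewrite mulrC.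
  rewrite /k -powRM ?invr_ge0 ?(ltW sd)// mulVf ?gt_eqF//.
  by rewrite powR1.
rewrite !EFinD; apply: leeD => //; apply: leeD; last exact: hK1.
by apply: leeD => //; exact: hK1.
Qed.
End coefficient_error.
Lemma ssbe_coord t delta w i : ssbe W f g (X t w) t delta w 0 i =
  ssbe_mid t delta w 0 i + \sum_(r < m) (W r (t + delta) w - W r t w) *
    g r (t + delta) (ssbe_mid t delta w) 0 i.
Proof.
rewrite /ssbe mxE summxE; congr (_ + _); apply: eq_bigr => r _.
by rewrite mxE.
Qed.

(* The drift part [A] has size [delta^(3/2)]; the martingale part [M] only has
   size [delta], but vanishes under the conditional expectation. *)
Lemma ssbe_local_error : exists2 C, 0 <= C & forall t delta i,
  0 <= t -> 0 < delta -> delta <= hbar -> t + delta <= T ->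
  exists A M : Omega -> R,
  [/\ forall w, (X (t + delta) w - ssbe W f g (X t w) t delta w) 0 i = A w + M w,
      measurable_fun setT A /\ measurable_fun setT M,
      (moment P 2 A <= (C * delta ^+ 3)%:E)%E,
      (moment P 2 M <= (C * delta ^+ 2)%:E)%E &
      forall B, F t B -> (\int[P]_w (\1_B w * M w)%:E = 0)%E].
Proof.
have [Cf Cf0 hCf] := coef_error_moment hf.
(* Choice collects one constant per Brownian motion; their sum [Cg] bounds each of them. *)
have /choice[Cr hCr] : forall r : 'I_m, exists C : R, 0 <= C /\ forall t delta s i,
    0 <= t -> 0 < delta -> delta <= hbar -> t + delta <= T -> t <= s <= t + delta ->
    (moment P 2 (fun w => g r s (X s w) 0 i - g r (t + delta) (ssbe_mid t delta w) 0 i)%R <=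
      (C * delta)%:E)%E.
  by move=> r; have [C C0 hC] := coef_error_moment (hg r); exists C.
pose Cg := \sum_(r < m) Cr r.
have Cg0 : 0 <= Cg by apply: sumr_ge0 => r _; exact: (hCr r).1.
have CrCg r : Cr r <= Cg.
  by rewrite /Cg (bigD1 r)//= lerDl; apply: sumr_ge0 => j _; exact: (hCr j).1.
pose Cm := m%:R `^ 2 * (m%:R * (cito 2 * Cg)).
have Cm0 : 0 <= Cm by rewrite mulr_ge0 ?powR_ge0// mulr_ge0// mulr_ge0// cito_ge0.
have t4 : (2 : R) <= 2 <= (4 : R) by rewrite lexx ler_nat.
exists (4 * Cf + Cm); first by rewrite addr_ge0// mulr_ge0.
move=> t delta i t0 dt0 dth tdT.
have tT : 0 <= t <= T by rewrite t0/= (le_trans _ tdT)// lerDl ltW.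
have uT : 0 <= t + delta <= T by rewrite tdT addr_ge0// ltW.
have tu : t < t + delta by rewrite ltrDl.
have dE : t + delta - t = delta by rewrite addrC addKr.
pose xf w := f (t + delta) (ssbe_mid t delta w) 0 i.
pose xg r w := g r (t + delta) (ssbe_mid t delta w) 0 i.
have mxf : measurable_fun setT xf.
  exact: (adapted_measurable hF tT (coef_mid_adapted hf i t0 dt0 dth tdT)).
have sxg r : smeasurable (F t) (xg r) by exact: (coef_mid_adapted (hg r) i t0 dt0 dth tdT).
pose N r := ito_remainder (W r) (I r i) t (t + delta) (xg r).
pose M w := \sum_(r < m) N r w.
have mN r : measurable_fun setT (N r) by exact: diffusion_remainder_measurable.
have mM : measurable_fun setT M by exact: measurable_sum.
pose V w := (X (t + delta) w - ssbe W f g (X t w) t delta w) 0 i.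
have VE w : V w = X (t + delta) w 0 i - (ssbe_mid t delta w 0 i +
    \sum_(r < m) (W r (t + delta) w - W r t w) * xg r w).
  by rewrite /V mxE [X in _ + X]mxE ssbe_coord.
have mV : measurable_fun setT V.
  rewrite (funext VE).
  apply: measurable_funB; first exact: mX.
  apply: measurable_funD.
    by apply: (adapted_measurable hF tT); exact: (ssbe_mid_adapted t0 dt0 dth tdT).
  apply: measurable_sum => r; apply: measurable_funM; last exact: (adapted_measurable hF tT (sxg r)).
  apply: measurable_funB.
    exact: (adapted_measurable hF uT (bm_adapted (hW r) uT)).
  exact: (adapted_measurable hF tT (bm_adapted (hW r) tT)).
pose D := drift_remainder t (t + delta) xf i.
have mD : measurable_fun setT D by exact: drift_remainder_measurable.
(* The stage equation [Y = X_t + delta f(u, Y)] turns the term [Y] of the method into the constant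
   subtracted from the drift. *)
have AE : {ae P, forall w, V w - M w = D w}.
  apply: filterS2 (sode_increment i t0 (ltW tu) tdT) (drift_remainderE xf i t0 tu tdT) => w E1 E2.
  rewrite /D E2 dE VE.
  have EY : ssbe_mid t delta w 0 i = X t w 0 i + delta * xf w.
    by rewrite /xf /ssbe_mid {1}(ssbe_FinvE hfg dt0 dth hL uT) !mxE.
  have EM : M w = \sum_(r < m) (I r i (t + delta) w - I r i t w) -
      \sum_(r < m) (W r (t + delta) w - W r t w) * xg r w.
    by rewrite /M -sumrB; apply: eq_bigr => r _; rewrite /N /ito_remainder [xg r w * _]mulrC.
  have -> : X (t + delta) w 0 i = (X (t + delta) w 0 i - X t w 0 i) + X t w 0 i by rewrite subrK.
  by rewrite EY EM E1; ring.
have hN r : (moment P 2 (N r) <= (cito 2 * Cg * delta ^+ 2)%:E)%E.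
  have := @diffusion_remainder_moment t (t + delta) i t0 tu tdT (xg r) (sxg r) r 2 (Cg * delta) t4.
  rewrite dE mulfV// powRr1 ?(ltW dt0)// => h.
  rewrite (_ : cito 2 * Cg * delta ^+ 2 = cito 2 * (Cg * delta) * delta); last by ring.
  apply: h => s hs; apply: (le_trans ((hCr r).2 t delta s i t0 dt0 dth tdT hs)).
  by rewrite lee_fin ler_wpM2r// ltW.
(* [A] is defined as a difference so that the splitting holds for every [w]; it equals the drift
   remainder only almost surely. *)
exists (fun w => V w - M w), M; split.
- by move=> w; rewrite subrK.
- by split => //; exact: measurable_funB.
- rewrite (moment_ae_eq 2 _ mD AE); last exact: measurable_funB.
  have h1 : (1 : R) <= 2 by rewrite ler1n.
  apply: (le_trans (@drift_remainder_moment t (t + delta) xf i t0 tu tdT mxf 2 (Cf * delta) h1 _)).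
    by move=> s hs; exact: hCf.
  rewrite dE !(powR_mulrn 2) ?(ltW dt0)// lee_fin.
  have h3 : 0 <= Cm * delta ^+ 3 by rewrite mulr_ge0// exprn_ge0// ltW.
  by rewrite mulrDl (_ : 2 ^+ 2 * (delta ^+ 2 * (Cf * delta)) = 4 * Cf * delta ^+ 3) ?lerDl//; ring.
- have h1 : (1 : R) <= 2 by rewrite ler1n.
  apply: (le_trans (moment_sum_le_norm h1 mN hN)); rewrite lee_fin.
  have h3 : 0 <= 4 * Cf * delta ^+ 2 by apply: mulr_ge0; [exact: mulr_ge0|exact: sqr_ge0].
  by rewrite mulrDl (_ : _ `^ 2 * _ = Cm * delta ^+ 2) ?lerDr// /Cm; ring.
- move=> B FB.
  have mB : measurable B by exact: (filtration_sub hF tT).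
  have iN r : P.-integrable setT (fun w => (\1_B w * N r w)%:E).
    apply: (@le_integrableR _ _ _ P _ (fun w => `|N r w|)).
    - by apply: measurable_funM => //; exact: measurable_indic.
    - by move=> w; rewrite normrM indicE normr_nat; case: (_ \in _); rewrite ?mul1r ?mul0r.
    - have iNr : P.-integrable setT (EFin \o N r).
        by apply: moment2_integrable => //; apply: (le_lt_trans (hN r)); exact: ltry.
      exact: (integrable_abse iNr).
  under eq_integral do rewrite /M mulr_sumr -sumEFin.
  rewrite integral_sum// big1// => r _.
  apply: (@diffusion_remainder_mean0 t (t + delta) i t0 tu tdT (xg r) (sxg r) r (Cr r * delta) B FB).
  by move=> s hs; exact: (hCr r).2.
Qed.
End one_step.
End sode_estimates.

(** * From the splitting of the error to consistency *)

Section assembly.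
Set Implicit Arguments.
Unset Strict Implicit.
Context {R : realType} {disp : measure_display} {Omega : measurableType disp}
  (P : probability Omega R).

(** [M] has conditional mean zero, so the conditional mean of the drift part serves for the whole
    error. *)
Lemma cond_expectation_add0 (G : set (set Omega)) (A M Z : Omega -> R) :
  G `<=` measurable -> cond_expectation P G A Z -> P.-integrable setT (EFin \o M) ->
  (forall B, G B -> (\int[P]_w (\1_B w * M w)%:E = 0)%E) ->
  cond_expectation P G (fun w => A w + M w) Z.
Proof.
move=> GM [iA mZ iZ hZ] iM hM; split => //.
  by apply: (eq_integrable measurableT (fun w => (A w)%:E + (M w)%:E)%E) => //; exact: integrableD.
move=> B GB; have mB := GM _ GB.
have sub U : P.-integrable setT (EFin \o U) -> P.-integrable B (EFin \o U).
  exact: (integrableS measurableT mB (@subsetT _ B)).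
rewrite hZ// RintegralD//; [|exact: sub|exact: sub].
rewrite [X in _ = _ + X](_ : _ = 0) ?addr0// /Rintegral integral_mkcond.
rewrite (_ : (_ \_ B) = fun w => (\1_B w * M w)%:E) ?hM//.
by apply/funext => w; rewrite patchE indicE; case: ifP => _; rewrite ?mul1r ?mul0r.
Qed.

(** [d^3] is [d^2 * d]: the Euclidean norm is bounded by the sum of the coordinates, and [d] moments
    are added up. *)
Lemma LpNorm2_le d (Y : Omega -> 'rV[R]_d) (K x : R) : 0 <= K -> 0 <= x ->
  (forall i, measurable_fun setT (fun w => Y w 0 i)) ->
  (forall i, (moment P 2 (fun w => Y w 0%R i) <= (K * x ^+ 2)%:E)%E) ->
  (LpNorm P 2 Y <= (Num.sqrt (d%:R ^+ 3 * K) * x)%:E)%E.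
Proof.
move=> K0 x0 mY hY; have dK : 0 <= d%:R ^+ 3 * K by rewrite mulr_ge0// exprn_ge0.
apply: moment_LpNorm_le => //; first by rewrite mulr_ge0// sqrtr_ge0.
have h1 : (1 : R) <= 2 by rewrite ler1n.
apply: (le_trans (moment_enorm_le h1 mY hY)).
rewrite !(powR_mulrn 2) ?mulr_ge0 ?sqrtr_ge0// exprMn sqr_sqrtr//.
by rewrite lee_fin (_ : d%:R ^+ 2 * _ = d%:R ^+ 3 * K * x ^+ 2)//; ring.
Qed.
End assembly.

Theorem theorem5p7 (R : realType) (disp : measure_display)
    (Omega : measurableType disp) (P : probability Omega R)
    (d m : nat) (T : R) (hT : 0 < T)
    (F : R -> set (set Omega)) (hF : usual_filtration P T F)
    (W : 'I_m -> R -> Omega -> R)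
    (hW : forall r, brownian_motion P T F (W r))
    (hWindep : independent_processes P T W)
    (L eta q : R)
    (f : R -> 'rV[R]_d -> 'rV[R]_d)
    (g : 'I_m -> R -> 'rV[R]_d -> 'rV[R]_d)
    (hfg : admissible T L eta q f g)
    (hbar : R) (hbar_gt0 : 0 < hbar) (hbar_lt : hbar < L^-1) (hbar_le : hbar <= T)
    (X0 : Omega -> 'rV[R]_d) (hX0 : vmeasurable (F 0) X0)
    (p : R) (hp : 2 <= p) (hX0p : (LpNorm P p X0 < +oo)%E)
    (X : R -> Omega -> 'rV[R]_d)
    (hX : sode_solution P T F W f g X0 X)
    (hXmom : (ereal_sup [set LpNorm P (4 * q - 2) (X tau) |
                          tau in `[0%R, T]] < +oo)%E) :
  B_consistent P T F X (ssbe W f g) hbar 2^-1.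
Proof.
have [hXad hXc [I [hI hXE]]] := hX.
have q1 := adm_q hfg.
have P00 : 0 < 4 * q - 2 by lra.
have [K1 hK1] : exists K1, forall t, 0 <= t <= T ->
    (moment P (4 * q - 2) (fun w => enorm (X t w)) <= K1%:E)%E.
  set S := [set _ | _ in _] in hXmom.
  have ub t : 0 <= t <= T -> (LpNorm P (4 * q - 2) (X t) <= ereal_sup S)%E.
    by move=> tT; apply: ereal_sup_ubound; exists t => //=; rewrite in_itv.
  have S0 : (0 <= ereal_sup S)%E.
    by apply: le_trans (ub 0 _); [exact: Lnorm_ge0|rewrite lexx ltW].
  exists (fine (ereal_sup S) `^ (4 * q - 2)) => t tT.
  by apply: LpNorm_le_moment => //; rewrite fineK ?ge0_fin_numE//; exact: ub.
have [C C0 hC] := ssbe_local_error hT hF hW hfg hXad hXc hI hXE hK1 hbar_gt0 hbar_lt.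
(* From [V - Z = (A - Z) + M], two applications of [moment_add_le] with [p = 2] give
   [4 (4 (2 C delta^3) + C delta^2)]; one factor [delta] is bounded by [hbar]. *)
pose C2 := 4 * (8 * C * hbar + C).
have C20 : 0 <= C2 by rewrite mulr_ge0// addr_ge0// mulr_ge0 ?mulr_ge0// ltW.
split; first by rewrite invr_gt0.
(* One constant must serve both bounds, hence the sum. *)
exists (Num.sqrt (d%:R ^+ 3 * C) + Num.sqrt (d%:R ^+ 3 * C2)).
move=> t delta /andP[t0 tT] /andP[dt0 dth] tdT V.
have tT' : 0 <= t <= T by rewrite t0 ltW.
have sF := filtration_sigma hF tT'; have FM := filtration_sub hF tT'.
have h1 : (0 : R) <= 2 by [].
have /choice[Z hZ] i : exists Z : Omega -> R,
    [/\ cond_expectation P (F t) (fun w => V w 0 i) Z, measurable_fun setT Z,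
      measurable_fun setT (fun w => V w 0 i - Z w),
      (moment P 2 Z <= (C * delta ^+ 3)%:E)%E &
      (moment P 2 (fun w => V w 0 i - Z w)%R <= (C2 * delta ^+ 2)%:E)%E].
  have [A [M [VE [mA mM] hA hM M0]]] := hC t delta i t0 dt0 dth tdT.
  have fA : (moment P 2 A < +oo)%E by apply: (le_lt_trans hA); exact: ltry.
  have iA := moment2_integrable mA fA.
  have iM : P.-integrable setT (EFin \o M).
    by apply: (moment2_integrable mM); apply: (le_lt_trans hM); exact: ltry.
  (* Conditioning [A] alone keeps the order [delta^(3/2)]; a bound on the whole error would only
     give [delta]. *)
  have [Z cZ] := cond_expectation_exists sF FM iA.
  have hZ := le_trans (cond_expectation_moment2 sF FM mA fA cZ) hA.
  have [_ smZ _ _] := cZ.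
  have mZ := smeasurable_measurable FM smZ.
  have EV : (fun w => V w 0 i) = fun w => A w + M w by apply/funext => w; exact: VE.
  have EVZ : (fun w => V w 0 i - Z w) = fun w => A w + - Z w + M w.
    by apply/funext => w; rewrite /V VE; ring.
  have mAZ : measurable_fun setT (fun w => A w + - Z w) by exact: measurable_funB.
  exists Z; rewrite EV EVZ; split => //.
  - exact: cond_expectation_add0.
  - exact: measurable_funD.
  - have hNZ : (moment P 2 (fun w => - Z w)%R <= (C * delta ^+ 3)%:E)%E.
      by rewrite /moment; under eq_integral do rewrite normrN.
    have mNZ : measurable_fun setT (fun w => - Z w) by exact: measurableT_comp.
    apply: (le_trans (moment_add_le h1 mAZ mM (moment_add_le h1 mA mNZ hA hNZ) hM)).
    rewrite !(powR_mulrn 2)// lee_fin /C2.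
    have : C * delta ^+ 3 <= C * hbar * delta ^+ 2.
      by rewrite exprS mulrA ler_wpM2r ?sqr_ge0// ler_wpM2l.
    move: (C * delta ^+ 3) => y; move: (delta ^+ 2) => z; lra.
exists (fun w => \row_i Z i w).
have ZE i w : (\row_j Z j w) 0 i = Z i w by rewrite mxE.
have VZE i : (fun w => (V w - \row_j Z j w) 0 i) = (fun w => V w 0 i - Z i w).
  by apply/funext => w; rewrite mxE [X in _ + X]mxE ZE.
have S1 : 0 <= Num.sqrt (d%:R ^+ 3 * C) by exact: sqrtr_ge0.
have S2 : 0 <= Num.sqrt (d%:R ^+ 3 * C2) by exact: sqrtr_ge0.
split.
- move=> i; rewrite (_ : (fun w => (\row_j Z j w) 0 i) = Z i); last by apply/funext => w; rewrite mxE.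
  by have [] := hZ i.
- apply: (@le_trans _ _ (Num.sqrt (d%:R ^+ 3 * C) * delta `^ (2^-1 + 1))%:E); last first.
    by rewrite lee_fin ler_wpM2r ?powR_ge0// lerDl.
  apply: LpNorm2_le => // [|i|i]; first exact: powR_ge0.
    by under eq_fun do rewrite mxE; have [] := hZ i.
  under eq_fun do rewrite mxE.
  rewrite (_ : (delta `^ (2^-1 + 1)) ^+ 2 = delta ^+ 3); first by have [] := hZ i.
  rewrite -!powR_mulrn ?powR_ge0 ?(ltW dt0)// -powRrM; congr (_ `^ _).
  by field.
- apply: (@le_trans _ _ (Num.sqrt (d%:R ^+ 3 * C2) * delta `^ (2^-1 + 2^-1))%:E); last first.
    by rewrite lee_fin ler_wpM2r ?powR_ge0// lerDr.
  apply: LpNorm2_le => // [|i|i]; first exact: powR_ge0.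
    by rewrite VZE; have [] := hZ i.
  rewrite VZE (_ : (delta `^ (2^-1 + 2^-1)) ^+ 2 = delta ^+ 2); first by have [] := hZ i.
  congr (_ ^+ 2); rewrite (_ : 2^-1 + 2^-1 = 1); last by field.
  by rewrite powRr1// ltW.
Qed.
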